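(* There is a randomized algorithm for the Decremental Approximate Maximum Eigenvalue and Eigenvector problem (defined in the context) under a sequence of $T$ updates which, given $n$, $A_0$ and $\epsilon>1/n$ as input, works against an oblivious adversary with probability at least $1-1/n$ and has total running time \[ O\left(\frac{\log^{3}n\,\log^6 \frac{n}{\epsilon}\,\log \frac{\lambda_{\max}(A_0)}{\lambda_{\max}(A_T)}}{\epsilon^{4}}\left(\mathrm{nnz}(A_0) + \sum_{i=1}^T \mathrm{nnz}(v_i)\right) \right). \]
   Context: Decremental Approximate Maximum Eigenvalue and Eigenvector problem: we are given a size parameter $n$, an accuracy parameter $\epsilon\in(0,1)$, a positive semidefinite (psd) $n\times n$ matrix $A_0\succeq 0$, and an online sequence of vectors $v_1,\dots,v_T\in\mathbb{R}^n$ that update $A_t\gets A_{t-1}-v_tv_t^{\top}$, with the promise that $A_t\succeq 0$ for all $t$. For every time $t$ the algorithm must maintain a number $\lambda_t$ and a unit vector $w_t$ with $\max_{\|u\|=1}u^\top A_t u\ge \lambda_t\ge (1-\epsilon)\max_{\|u\|=1}u^\top A_t u$ and $w_t^\top A_t w_t\ge (1-\epsilon)\max_{\|u\|=1}u^\top A_t u$. An oblivious adversary fixes the entire update sequence in advance, independently of the algorithm's randomness. $\mathrm{nnz}(\cdot)$ denotes the number of nonzero entries; $\lambda_{\max}$ denotes the maximum eigenvalue. The total running time includes initialization and processing all $T$ updates.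
   Formalization: The factor log(λ_max(A_0)/λ_max(A_T)) is replaced by max(1, log(...)) and nnz(v_i) by max(1, nnz(v_i)), since the literal bound is 0 for T=0 and zero updates would cost no time; the time bound is asserted only when λ_max(A_T)>0. *)

(* Defs.v *)
From HB Require Import structures.
From mathcomp Require Import all_boot all_order all_algebra.
From mathcomp Require Import boolp classical_sets reals exp.

Set Implicit Arguments.
Unset Strict Implicit.
Unset Printing Implicit Defensive.
Import Order.TTheory GRing.Theory Num.Theory.
Local Open Scope ring_scope.

(** * Linear algebra *)

Section LinearAlgebra.
Variable R : realType.

(* The norm that MathComp-Analysis puts on matrices is the max norm, hence an
   explicit Euclidean norm. *)
Definition l2norm n (u : 'cV[R]_n) : R := Num.sqrt (\sum_i u i 0 ^+ 2).

Definition qform n (A : 'M[R]_n) (u : 'cV[R]_n) : R := (u^T *m A *m u) 0 0.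

Definition psd n (A : 'M[R]_n) : Prop :=
  A^T = A /\ forall u : 'cV[R]_n, 0 <= qform A u.

(* The supremum is a maximum for n > 0: the unit sphere is compact. *)
Definition max_qform n (A : 'M[R]_n) : R :=
  sup [set q | exists2 u : 'cV[R]_n, l2norm u = 1 & q = qform A u].

(* A finite set, nonempty when A is symmetric and n > 0. *)
Definition lambda_max n (A : 'M[R]_n) : R :=
  sup [set a | eigenvalue A a].

Definition nnz m n (A : 'M[R]_(m, n)) : nat :=
  #|[pred p : 'I_m * 'I_n | A p.1 p.2 != 0]|.

(* A_t, for t <= size v *)
Definition decr n (A0 : 'M[R]_n) (v : seq 'cV[R]_n) (t : nat) : 'M[R]_n :=
  foldl (fun A u => A - u *m u^T) A0 (take t v).

End LinearAlgebra.

(** * Randomized real RAM programs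

   The memory has natural-number registers and arrays, and real registers and
   arrays; programs are finite and do not mention R, n or the input.  Each
   instruction, coin toss and evaluated test costs one step.  Integer arithmetic
   is restricted to addition and truncated subtraction, and reals cannot be
   rounded to integers, so that unit cost gives no unintended power. *)

Inductive instr : Type :=
| NConst (x c : nat)      (* n_x := c *)
| NAdd (x y z : nat)      (* n_x := n_y + n_z *)
| NSub (x y z : nat)      (* n_x := n_y - n_z *)
| NLoad (x a y : nat)     (* n_x := N_a[n_y] *)
| NStore (a y x : nat)    (* N_a[n_y] := n_x *)
| ROfNat (x y : nat)      (* r_x := n_y *)
| RAdd (x y z : nat)      (* r_x := r_y + r_z, and so on *)
| RSub (x y z : nat)
| RMul (x y z : nat)
| RDiv (x y z : nat)
| RSqrt (x y : nat)
| RLoad (x a y : nat)     (* r_x := R_a[n_y] *)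
| RStore (a y x : nat).   (* R_a[n_y] := r_x *)

Inductive test : Type :=
| NLt (x y : nat)         (* n_x < n_y *)
| RLt (x y : nat).        (* r_x < r_y *)

Inductive cmd : Type :=
| Skip
| Do (i : instr)
| Flip (x : nat)          (* n_x := a fair coin toss, 0 or 1 *)
| Seq (c d : cmd)
| If (b : test) (c d : cmd)
| While (b : test) (c : cmd).

(* An online algorithm: [init_cmd] is run once on the initial input, then
   [update_cmd] once per update; the memory persists in between. *)
Record program : Type := Program { init_cmd : cmd; update_cmd : cmd }.

Section Semantics.
Variable R : realType.

Record memory : Type := Memory {
  nreg : nat -> nat;
  narr : nat -> nat -> nat;
  rreg : nat -> R;
  rarr : nat -> nat -> R }.

Definition mem0 : memory :=
  Memory (fun=> 0%N) (fun _ _ => 0%N) (fun=> 0) (fun _ _ => 0).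

Definition set_nreg (s : memory) (x k : nat) : memory :=
  Memory [eta nreg s with x |-> k] (narr s) (rreg s) (rarr s).

Definition set_narr (s : memory) (a : nat) (f : nat -> nat) : memory :=
  Memory (nreg s) [eta narr s with a |-> f] (rreg s) (rarr s).

Definition set_rreg (s : memory) (x : nat) (r : R) : memory :=
  Memory (nreg s) (narr s) [eta rreg s with x |-> r] (rarr s).

Definition set_rarr (s : memory) (a : nat) (f : nat -> R) : memory :=
  Memory (nreg s) (narr s) (rreg s) [eta rarr s with a |-> f].

Definition do_instr (i : instr) (s : memory) : memory :=
  match i with
  | NConst x c => set_nreg s x c
  | NAdd x y z => set_nreg s x (nreg s y + nreg s z)%N
  | NSub x y z => set_nreg s x (nreg s y - nreg s z)%N
  | NLoad x a y => set_nreg s x (narr s a (nreg s y))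
  | NStore a y x => set_narr s a [eta narr s a with nreg s y |-> nreg s x]
  | ROfNat x y => set_rreg s x (nreg s y)%:R
  | RAdd x y z => set_rreg s x (rreg s y + rreg s z)
  | RSub x y z => set_rreg s x (rreg s y - rreg s z)
  | RMul x y z => set_rreg s x (rreg s y * rreg s z)
  | RDiv x y z => set_rreg s x (rreg s y / rreg s z)
  | RSqrt x y => set_rreg s x (Num.sqrt (rreg s y))
  | RLoad x a y => set_rreg s x (rarr s a (nreg s y))
  | RStore a y x => set_rarr s a [eta rarr s a with nreg s y |-> rreg s x]
  end.

Definition eval_test (b : test) (s : memory) : bool :=
  match b with
  | NLt x y => (nreg s x < nreg s y)%N
  | RLt x y => rreg s x < rreg s y
  end.

(* [exec c s w s' k]: started in s, the command c halts in s' after k steps,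
   having tossed the coins w. *)
Inductive exec : cmd -> memory -> seq bool -> memory -> nat -> Prop :=
| ExecSkip s : exec Skip s [::] s 0
| ExecDo i s : exec (Do i) s [::] (do_instr i s) 1
| ExecFlip x (b : bool) s : exec (Flip x) s [:: b] (set_nreg s x b) 1
| ExecSeq c d s1 s2 s3 w1 w2 k1 k2 :
    exec c s1 w1 s2 k1 -> exec d s2 w2 s3 k2 ->
    exec (Seq c d) s1 (w1 ++ w2) s3 (k1 + k2)%N
| ExecIf b c d s s' w k :
    exec (if eval_test b s then c else d) s w s' k ->
    exec (If b c d) s w s' k.+1
| ExecWhileEnd b c s :
    ~~ eval_test b s -> exec (While b c) s [::] s 1
| ExecWhileLoop b c s1 s2 s3 w1 w2 k1 k2 :
    eval_test b s1 -> exec c s1 w1 s2 k1 ->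
    exec (While b c) s2 w2 s3 k2 ->
    exec (While b c) s1 (w1 ++ w2) s3 (k1 + k2)%N.+1.

(** ** Input and output conventions *)

(* Matrices and vectors are read in sparse form: the nonzero entries in
   row-major order, entry number l having its row in N_0[l], its column in
   N_1[l] and its value in R_0[l], with the number of entries in n_0. *)
Definition nz_positions m n (A : 'M[R]_(m, n)) : seq ('I_m * 'I_n) :=
  [seq p <- enum {: 'I_m * 'I_n} | A p.1 p.2 != 0].

(* Cells beyond the end of the list keep their contents. *)
Definition load m n (s : memory) (A : 'M[R]_(m, n)) : memory :=
  let ps := nz_positions A in
  let row l := nth (narr s 0 l) [seq val p.1 | p <- ps] l in
  let col l := nth (narr s 1 l) [seq val p.2 | p <- ps] l in
  let entry l := nth (rarr s 0 l) [seq A p.1 p.2 | p <- ps] l in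
  set_rarr (set_narr (set_narr (set_nreg s 0 (size ps)) 0 row) 1 col) 0 entry.

(* Initially n_1 holds the dimension, r_0 the accuracy parameter, and all
   cells that hold no input are zero. *)
Definition init_memory n (eps : R) (A0 : 'M[R]_n) : memory :=
  load (set_rreg (set_nreg mem0 1 n) 0 eps) A0.

(* After the initialization and after every update, lambda_t is in r_1 and
   the coordinates of w_t are in R_1[0], ..., R_1[n-1]. *)
Definition out_value (s : memory) : R := rreg s 1.
Definition out_vector n (s : memory) : 'cV[R]_n := \col_i rarr s 1 i.

(* [exec_updates c s v w tr k]: tr lists the memories reached after each of the
   updates v, w the coins tossed, and k is the total number of steps. *)
Inductive exec_updates n (c : cmd) :
  memory -> seq 'cV[R]_n -> seq bool -> seq memory -> nat -> Prop :=
| ExecUpdatesNil s : exec_updates c s [::] [::] [::] 0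
| ExecUpdatesCons s s' u v w1 w2 tr k1 k2 :
    exec c (load s u) w1 s' k1 -> exec_updates c s' v w2 tr k2 ->
    exec_updates c s (u :: v) (w1 ++ w2) (s' :: tr) (k1 + k2)%N.

(* The whole run; tr lists the memories at times t = 0, ..., size v. *)
Inductive run n (P : program) (eps : R) (A0 : 'M[R]_n) (v : seq 'cV[R]_n) :
  seq bool -> seq memory -> nat -> Prop :=
| Run s0 w1 w2 tr k1 k2 :
    exec (init_cmd P) (init_memory eps A0) w1 s0 k1 ->
    exec_updates (update_cmd P) s0 v w2 tr k2 ->
    run P eps A0 v (w1 ++ w2) (s0 :: tr) (k1 + k2)%N.

(** ** The maintenance problem *)

Definition correct_at n (eps : R) (A : 'M[R]_n) (s : memory) : Prop :=
  let lam := out_value s in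
  let w := out_vector n s in
  [/\ lam <= max_qform A,
      (1 - eps) * max_qform A <= lam,
      l2norm w = 1
    & (1 - eps) * max_qform A <= qform A w].

Definition correct_trace n (eps : R) (A0 : 'M[R]_n) (v : seq 'cV[R]_n)
    (tr : seq memory) : Prop :=
  forall t, (t <= size v)%N -> correct_at eps (decr A0 v t) (nth mem0 tr t).

(* A run of at most k steps tosses at most k coins, so its random choices are
   read off a uniformly random tape of k bits, of which it uses a prefix. *)
Definition prob_coins k (E : k.-tuple bool -> Prop) : R :=
  #|[pred w : k.-tuple bool | `[< E w >]]|%:R / 2 ^+ k.

(* With the coins w, P processes the whole input within k steps, and its
   outputs satisfy Q. *)
Definition outcome n (P : program) (eps : R) (A0 : 'M[R]_n)
    (v : seq 'cV[R]_n) k (Q : seq memory -> Prop) (w : k.-tuple bool) : Prop :=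
  exists w' tr k', [/\ run P eps A0 v w' tr k', prefix w' w, (k' <= k)%N & Q tr].

(* The last argument is the final matrix A_T.  The two floors at 1 account for
   the step that any algorithm spends on a zero update, and on a nonempty input
   whose maximum eigenvalue does not change.  The bound is meant for
   lambda_max AT > 0 (it is infinite for lambda_max AT = 0 < lambda_max A0). *)
Definition time_bound n (eps : R) (A0 : 'M[R]_n) (v : seq 'cV[R]_n)
    (AT : 'M[R]_n) : R :=
  ln n%:R ^+ 3 * ln (n%:R / eps) ^+ 6
    * Num.max 1 (ln (lambda_max A0 / lambda_max AT)) / eps ^+ 4
    * (nnz A0 + \sum_(u <- v) maxn 1 (nnz u))%N%:R.

End Semantics.

(* Main.v *)
Require Import Defs.
From HB Require Import structures.
From mathcomp Require Import all_boot all_order all_algebra.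
From mathcomp Require Import boolp classical_sets reals sequences exp.
From mathcomp Require Import sesquilinear spectral complex ring lra zify.

Set Implicit Arguments.
Unset Strict Implicit.
Unset Printing Implicit Defensive.
Import Order.TTheory GRing.Theory Num.Theory.
Local Open Scope ring_scope.

(** The algorithm keeps the best of the vectors A^k u_i / |A^k u_i|, where
    k = O(log n / eps) and the u_i are O(log n) random sign vectors on the
    support of A_0, drawn once.  It repeats the power iteration only when the
    value w^T A w of the current vector has dropped by the factor 1 - eps/2.

    With high probability, some u_i satisfies tr A^2k <= 2 u_i^T A^2k u_i (a
    second moment bound), and all of them satisfy
    (A^k u_i)^T V (A^k u_i) <= O(log^2 n) tr (A^2k V) (an exponential moment
    bound) for the difference V between A and a later matrix.  A drop of the
    best value therefore multiplies the potential tr A^(2k+1) by at most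
    1 - Omega(eps / log^2 n).  As the potential lies between (tr A / n)^(2k+1)
    and (tr A)^(2k+1), the number of recomputations is proportional to log n
    plus the number of halvings of the trace.

    The union bound runs over pairs of checkpoints only, that is, times at which
    the trace has dropped by the factor 1 - eps/(4n) since the last one; their
    number is polynomial in n until the trace has been halved n^6 times.  From
    then on, the running time allows power iterations from all unit vectors at
    every update. *)

(** * Positive semidefinite matrices *)

(** The starting vectors can serve all matrices because the adversary is oblivious: the matrices,
    and with them the checkpoints, are fixed before the coins are tossed, so both bounds can be
    demanded in advance. The number T of updates is not bounded in terms of n, which rules out a
    union bound over all times. Recomputations happen only at checkpoints, so a drop of the
    potential always compares two of them; in between, the value of a unit vector moves by at most
    eps/4 of the maximum, since the trace is at most n times the maximum.

    The running time is bounded for all coins, but the count of recomputations is justified only for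
    good ones. Each halving of the trace therefore grants a quota of recomputations. Once the credit
    is used up the vector is simply kept, which can only happen with bad starting vectors.

    The trace schedules everything because an update v lowers it by exactly |v|^2. Likewise w^T A w
    falls by (v.w)^2, so a drop is noticed at cost nnz(v), without a matrix product. *)

Lemma exprSD_orthogonal (T : pzRingType) (x y : T) j : x * y = 0 -> y * x = 0 ->
  (x + y) ^+ j.+1 = x ^+ j.+1 + y ^+ j.+1.
Proof.
move=> xy yx; elim: j => [|j IHj]; first by rewrite !expr1.
rewrite exprSr IHj mulrDl !mulrDr -!exprSr.
have -> : x ^+ j.+1 * y = 0 by rewrite exprSr -mulrA xy mulr0.
have -> : y ^+ j.+1 * x = 0 by rewrite exprSr -mulrA yx mulr0.
by rewrite addr0 add0r.
Qed.

(** * Spectral decomposition of real symmetric matrices *)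

Section Spectral.
Variable R : realType.
Implicit Types n : nat.

Definition dotv n (x y : 'cV[R]_n) : R := (x^T *m y) 0 0.

Lemma dotvE n (x y : 'cV[R]_n) : dotv x y = \sum_i x i 0 * y i 0.
Proof. by rewrite /dotv mxE; apply: eq_bigr => i _; rewrite mxE. Qed.

Lemma dotvC n (x y : 'cV[R]_n) : dotv x y = dotv y x.
Proof. by rewrite !dotvE; apply: eq_bigr => i _; rewrite mulrC. Qed.

Lemma dotv_ge0 n (x : 'cV[R]_n) : 0 <= dotv x x.
Proof. by rewrite dotvE sumr_ge0 // => i _; rewrite -expr2 sqr_ge0. Qed.

Lemma dotv_eq0 n (x : 'cV[R]_n) : (dotv x x == 0) = (x == 0).
Proof.
rewrite dotvE psumr_eq0; last by move=> i _; rewrite -expr2 sqr_ge0.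
apply/idP/eqP => [/allP h|->]; last first.
  by apply/allP => i _; rewrite mxE mulr0 eqxx.
apply/matrixP => i j; rewrite ord1 mxE.
by have := h i (mem_index_enum i); rewrite implyTb mulf_eq0 orbb => /eqP.
Qed.

Lemma dotvDr n (x y z : 'cV[R]_n) : dotv x (y + z) = dotv x y + dotv x z.
Proof. by rewrite /dotv mulmxDr mxE. Qed.

Lemma dotvZr n a (x y : 'cV[R]_n) : dotv x (a *: y) = a * dotv x y.
Proof. by rewrite /dotv -scalemxAr mxE. Qed.

Lemma dotvZl n a (x y : 'cV[R]_n) : dotv (a *: x) y = a * dotv x y.
Proof. by rewrite dotvC dotvZr dotvC. Qed.

Lemma scalar_mxE11 (A : 'M[R]_1) : A = (A 0 0)%:M.
Proof. by apply/matrixP => i j; rewrite !ord1 !mxE. Qed.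

(** Over the complex numbers A is hermitian and hence unitarily diagonalizable with real
    eigenvalues. The real and imaginary parts of a complex eigenvector satisfy the same eigenvalue
    equation, and one of them is nonzero. *)
Lemma symmetric_eigenvector n (A : 'M[R]_n) : A^T = A -> A != 0 ->
  exists a (x : 'cV[R]_n), [/\ a != 0, dotv x x = 1 & A *m x = a *: x].
Proof.
move=> Asym An0.
pose B : 'M[R[i]]_n := map_mx (real_complex R) A.
have Bherm : B \is hermsymmx.
  apply/is_hermitianmxP; rewrite expr0 scale1r.
  apply/matrixP => i j; rewrite !mxE -[in LHS]Asym mxE.
  by rewrite conj_Creal //; apply/complex_realP; eexists.
have Bnorm := hermitian_normalmx Bherm.
have BE := orthomx_spectralP Bnorm.
set P := spectralmx B in BE; set d := spectral_diag B in BE.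
have Punit : P \in unitmx by exact: spectral_unit.
have [j dj] : exists j, d 0 j != 0.
  apply/existsP; apply: contraNT An0 => /existsPn h.
  have d0 : diag_mx d = 0.
    apply/matrixP => i j; rewrite !mxE; case: eqP => // _.
    by have /negPn/eqP -> := h i.
  have B0 : B = 0 by rewrite BE d0 mulmx0 mul0mx.
  apply/eqP/matrixP => i j; move/matrixP/(_ i j): B0.
  by rewrite !mxE => /eqP; rewrite eq_complex /= => /andP[/eqP].
pose y := row j P.
have yB : y *m B = d 0 j *: y.
  rewrite /y -row_mul BE !mulmxA mulmxV // mul1mx.
  by rewrite row_mul row_diag_mx -scalemxAl -rowE.
have yn0 : y != 0.
  apply/negP => /eqP y0; have /(congr1 (row j)) := mulmxV Punit.
  rewrite row_mul -/y y0 mul0mx => /rowP/(_ j)/eqP.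
  by rewrite !mxE eqxx eq_sym oner_eq0.
have /complex_realP[a da] : d 0 j \is Num.real.
  by have /mxOverP := hermitian_spectral_diag_real Bherm; exact.
have an0 : a != 0 by apply: contraNneq dj => a0; rewrite da a0.
have comp (f : R[i] -> R) : f = (@complex.Re R) \/ f = (@complex.Im R) ->
    A *m (\col_i f (y 0 i)) = a *: (\col_i f (y 0 i)).
  move=> fE; have fD : {morph f : u v / u + v}.
    by case: fE => -> [u1 u2] [v1 v2].
  have f0 : f 0 = 0 by case: fE => ->.
  have fZ (c : R) z : f (real_complex R c * z) = c * f z.
    by case: fE => ->; case: z => z1 z2 /=; ring.
  apply/matrixP => i k; rewrite !mxE.
  have := congr1 (fun M : 'rV_n => f (M 0 i)) yB.
  rewrite !mxE (big_morph f fD f0) /= da fZ => <-.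
  by apply: eq_bigr => l _; rewrite !mxE [_ * real_complex _ _]mulrC fZ -[in LHS]Asym mxE.
have norm1 (x : 'cV[R]_n) : x != 0 -> A *m x = a *: x ->
  exists a (x : 'cV[R]_n), [/\ a != 0, dotv x x = 1 & A *m x = a *: x].
  move=> xn0 Ax; exists a, ((Num.sqrt (dotv x x))^-1 *: x).
  have x0 : 0 < dotv x x by rewrite lt_def dotv_ge0 dotv_eq0 xn0.
  split=> //; last by rewrite -scalemxAr Ax !scalerA mulrC.
  rewrite dotvZl dotvZr mulrA -expr2 exprVn sqr_sqrtr ?ltW //.
  by rewrite mulVf // gt_eqF.
have [re0|] := eqVneq (\col_i complex.Re (y 0 i)) 0; last first.
  by move/norm1; apply; apply: comp; left.
have [im0|] := eqVneq (\col_i complex.Im (y 0 i)) 0; last first.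
  by move/norm1; apply; apply: comp; right.
case/eqP: yn0; apply/rowP => i; rewrite [RHS]mxE.
move/colP/(_ i): re0; move/colP/(_ i): im0; rewrite !mxE.
by case: (P j i) => u v /= -> ->.
Qed.

(* Only the nonzero eigenvalues are listed, hence the positive powers. *)
Lemma symmetric_spectral n (A : 'M[R]_n) : A^T = A ->
  exists s : seq (R * 'cV[R]_n), [/\ (size s <= n)%N,
    forall p, p \in s ->
      [/\ p.1 != 0, dotv p.2 p.2 = 1 & A *m p.2 = p.1 *: p.2]
  & forall j, A ^+ j.+1 = \sum_(p <- s) p.1 ^+ j.+1 *: (p.2 *m p.2^T)].
Proof.
have [r] := ubnP (\rank A) => le_r Asym.
suff [s [sz sP sE]] : exists s : seq (R * 'cV[R]_n), [/\ (size s <= \rank A)%N,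
    forall p, p \in s ->
      [/\ p.1 != 0, dotv p.2 p.2 = 1 & A *m p.2 = p.1 *: p.2]
  & forall j, A ^+ j.+1 = \sum_(p <- s) p.1 ^+ j.+1 *: (p.2 *m p.2^T)].
  by exists s; split=> //; apply: leq_trans sz (rank_leq_row _).
elim: r A le_r Asym => // r IHr A le_r Asym.
have [->|An0] := eqVneq A 0.
  by exists [::]; split=> // j; rewrite big_nil expr0n.
have [a [x [an0 xx Ax]]] := symmetric_eigenvector Asym An0.
have xA : x^T *m A = a *: x^T by rewrite -[A]Asym -trmx_mul Ax linearZ.
(* Deflation: A' kills x, and its rank is smaller because x lies in the row space of A but not in
   that of A'. *)
pose X := a *: (x *m x^T); pose A' := A - X.
have Xsym : X^T = X by rewrite /X linearZ /= trmx_mul trmxK.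
have A'sym : A'^T = A' by rewrite /A' linearB /= Asym Xsym.
have xxT : x^T *m x = 1%:M by rewrite [LHS]scalar_mxE11 -/(dotv x x) xx.
have A'x : A' *m x = 0.
  by rewrite mulmxBl Ax -scalemxAl -mulmxA xxT mulmx1 subrr.
have xA' : x^T *m A' = 0 by rewrite -[A']A'sym -trmx_mul A'x trmx0.
have rkA' : (\rank A' < \rank A)%N.
  have lt : (A' < A)%MS.
    rewrite /ltmx; apply/andP; split.
      rewrite /A' /X addmx_sub // eqmx_opp scalemx_sub //.
      apply: (submx_trans (submxMl _ _)).
      have -> : x^T = a^-1 *: (x^T *m A) by rewrite xA scalerA mulVf ?scale1r.
      by rewrite scalemx_sub // submxMl.
    apply/negP => h; have : (x^T <= A')%MS.
      apply: submx_trans h.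
      have -> : x^T = a^-1 *: (x^T *m A) by rewrite xA scalerA mulVf ?scale1r.
      by rewrite scalemx_sub // submxMl.
    case/submxP => D xD; have : x^T *m x = 0 by rewrite xD -mulmxA A'x mulmx0.
    by rewrite xxT => /matrixP/(_ 0 0)/eqP; rewrite !mxE eqxx oner_eq0.
  by move: lt; rewrite ltmxErank => /andP[].
have [s [sz sP sE]] := IHr A' (leq_trans rkA' le_r) A'sym.
exists ((a, x) :: s); split.
- exact: leq_ltn_trans sz rkA'.
- move=> p; rewrite inE => /orP[/eqP -> //|ps].
  have [p0 pp A'p] := sP p ps; split=> //.
  have xp : x^T *m p.2 = 0.
    apply: (scalerI p0); rewrite scaler0 scalemxAr -A'p mulmxA xA' mul0mx //.
  have -> : A = A' + X by rewrite subrK.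
  by rewrite mulmxDl A'p -scalemxAl -mulmxA xp mulmx0 scaler0 addr0.
- move=> j; rewrite big_cons /= -sE.
  have AE : A = X + A' by rewrite addrC subrK.
  have XA' : X * A' = 0 by rewrite /X -mulmxE -scalemxAl -mulmxA xA' mulmx0 scaler0.
  have A'X : A' * X = 0 by rewrite /X -mulmxE -scalemxAr mulmxA A'x mul0mx scaler0.
  have Xj i : X ^+ i.+1 = a ^+ i.+1 *: (x *m x^T).
    elim: i => [|i IHi]; first by rewrite !expr1.
    rewrite exprSr IHi [in RHS]exprSr /X -!mulmxE -scalemxAl -scalemxAr scalerA.
    by rewrite -mulmxA (mulmxA x^T) xxT mul1mx.
  rewrite -Xj {1}AE; exact: exprSD_orthogonal.
Qed.

End Spectral.

Section Psd.
Variable R : realType.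
Implicit Types n : nat.

Lemma dotvDl n (x y z : 'cV[R]_n) : dotv (x + y) z = dotv x z + dotv y z.
Proof. by rewrite dotvC dotvDr !(dotvC z). Qed.

Lemma dotv_mull n (A : 'M[R]_n) x y : dotv (A *m x) y = dotv x (A^T *m y).
Proof. by rewrite /dotv trmx_mul -mulmxA. Qed.

Lemma qformE n (A : 'M[R]_n) u : qform A u = dotv u (A *m u).
Proof. by rewrite /qform /dotv mulmxA. Qed.

Lemma qformD n (A B : 'M[R]_n) u : qform (A + B) u = qform A u + qform B u.
Proof. by rewrite !qformE mulmxDl dotvDr. Qed.

Lemma qformN n (A : 'M[R]_n) u : qform (- A) u = - qform A u.
Proof. by rewrite !qformE mulNmx /dotv mulmxN mxE. Qed.

Lemma qformB n (A B : 'M[R]_n) u : qform (A - B) u = qform A u - qform B u.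
Proof. by rewrite qformD qformN. Qed.

Lemma qformZv n a (A : 'M[R]_n) u : qform A (a *: u) = a ^+ 2 * qform A u.
Proof. by rewrite !qformE -scalemxAr dotvZr dotvZl mulrA. Qed.

Lemma qform0 n (u : 'cV[R]_n) : qform 0 u = 0.
Proof. by rewrite qformE mul0mx /dotv mulmx0 mxE. Qed.

Lemma qform_sum n (I : Type) (s : seq I) (F : I -> 'M[R]_n) u :
  qform (\sum_(i <- s) F i) u = \sum_(i <- s) qform (F i) u.
Proof.
elim: s => [|i s IHs]; first by rewrite !big_nil qform0.
by rewrite !big_cons qformD IHs.
Qed.

Lemma qform1 n (u : 'cV[R]_n) : qform 1%:M u = dotv u u.
Proof. by rewrite qformE mul1mx. Qed.

Lemma qform_outer n (b u : 'cV[R]_n) : qform (b *m b^T) u = dotv b u ^+ 2.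
Proof.
rewrite qformE -mulmxA [b^T *m u]scalar_mxE11 -/(dotv b u).
by rewrite mul_mx_scalar dotvZr expr2 (dotvC u).
Qed.

Lemma mxtrace_outer n (x y : 'cV[R]_n) : \tr (x *m y^T) = dotv y x.
Proof. by rewrite mxtrace_mulC /dotv /mxtrace big_ord1. Qed.

Lemma l2normE n (u : 'cV[R]_n) : l2norm u = Num.sqrt (dotv u u).
Proof. by rewrite dotvE; congr Num.sqrt; apply: eq_bigr => i _; rewrite expr2. Qed.

Lemma l2norm1 n (u : 'cV[R]_n) : l2norm u = 1 <-> dotv u u = 1.
Proof.
rewrite l2normE; split=> [h|->]; last by rewrite sqrtr1.
by rewrite -(sqr_sqrtr (dotv_ge0 u)) h expr1n.
Qed.

Lemma psd_ge0 n (A : 'M[R]_n) u : psd A -> 0 <= qform A u.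
Proof. by case. Qed.

Lemma psd0 n : psd (0 : 'M[R]_n).
Proof. by split=> [|u]; rewrite ?trmx0 ?qform0. Qed.

Lemma psdD n (A B : 'M[R]_n) : psd A -> psd B -> psd (A + B).
Proof.
by move=> [As Ap] [Bs Bp]; split=> [|u]; rewrite ?linearD /= ?As ?Bs ?qformD ?addr_ge0.
Qed.

Lemma psd_outer n (b : 'cV[R]_n) : psd (b *m b^T).
Proof.
by split=> [|u]; [rewrite trmx_mul trmxK|rewrite qform_outer sqr_ge0].
Qed.

Lemma trmxX n (A : 'M[R]_n) j : (A ^+ j)^T = A^T ^+ j.
Proof.
elim: j => [|j IHj]; first by rewrite !expr0 -idmxE trmx1.
by rewrite exprSr -mulmxE trmx_mul IHj mulmxE exprS.
Qed.

Lemma psd_congX n (A M : 'M[R]_n) i : psd A -> psd M -> psd (A ^+ i *m M *m A ^+ i).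
Proof.
move=> [As Ap] [Ms Mp]; split=> [|u].
  by rewrite !trmx_mul trmxX As Ms mulmxA.
by rewrite qformE -!mulmxA -{1}[A]As -trmxX -dotv_mull -qformE.
Qed.

Lemma psd1 n : psd (1%:M : 'M[R]_n).
Proof. by split=> [|u]; rewrite ?trmx1 // qform1 dotv_ge0. Qed.

Lemma psdX n (A : 'M[R]_n) j : psd A -> psd (A ^+ j).
Proof.
move=> pA; rewrite -(odd_double_half j) -addnn; case: (odd j) => /=.
  by have := psd_congX j./2 pA pA; rewrite !mulmxE -exprSr -exprD add1n addSn.
by have := psd_congX j./2 pA (psd1 n); rewrite mulmx1 mulmxE -exprD.
Qed.

Lemma psd_CauchySchwarz n (A : 'M[R]_n) x y : psd A ->
  dotv x (A *m y) ^+ 2 <= qform A x * qform A y.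
Proof.
move=> [As Ap].
have E t : qform A (x + t *: y) =
    qform A x + 2 * t * dotv x (A *m y) + t ^+ 2 * qform A y.
  rewrite !qformE mulmxDr dotvDl !dotvDr -scalemxAr !dotvZl !dotvZr.
  rewrite (_ : dotv y (A *m x) = dotv x (A *m y)); first ring.
  by rewrite dotvC dotv_mull As.
set b := dotv x (A *m y) in E *.
have Ax := Ap x; have Ay := Ap y; have := Ap (x - (b / qform A y) *: y).
rewrite -scaleNr E; have [Ay0 _|Ay0] := eqVneq (qform A y) 0.
  rewrite Ay0 mulr0; have [->|b0] := eqVneq b 0; first by rewrite expr0n.
  (* On a null vector y of the form with b nonzero, this shift would give the negative value -
     [qform A x] - 2. *)
  have := Ap (x - ((qform A x + 1) / b) *: y).
  by rewrite -scaleNr E Ay0 mulr0 addr0 mulrN mulNr -mulrA divfK //; lra.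
have Aypos : 0 < qform A y by rewrite lt_def Ay0 Ay.
set t := b / _; have -> : b = t * qform A y by rewrite /t mulfVK.
nra.
Qed.

(** ** Moments *)

(** In an eigenbasis x_i of A with eigenvalues a_i this is the sum of a_i^j (x_i.u)^2, the j-th
    moment of the spectral measure of u. Its log-convexity in j drives the analysis of power
    iteration. *)
Definition moment n (A : 'M[R]_n) u j := qform (A ^+ j) u.

Lemma moment0 n (A : 'M[R]_n) u : moment A u 0 = dotv u u.
Proof. by rewrite /moment expr0 -idmxE qform1. Qed.

Lemma moment1 n (A : 'M[R]_n) u : moment A u 1 = qform A u.
Proof. by rewrite /moment expr1. Qed.

Lemma moment_ge0 n (A : 'M[R]_n) u j : psd A -> 0 <= moment A u j.
Proof. by move=> pA; apply/psd_ge0/psdX. Qed.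

Lemma qform_congX n (A M : 'M[R]_n) u k : psd A ->
  qform M (A ^+ k *m u) = qform (A ^+ k *m M *m A ^+ k) u.
Proof. by case=> As _; rewrite !qformE dotv_mull trmxX As !mulmxA. Qed.

(** Cauchy-Schwarz for the form A^j, at u and A u. *)
Lemma moment_logconvex n (A : 'M[R]_n) u j : psd A ->
  moment A u j.+1 ^+ 2 <= moment A u j * moment A u j.+2.
Proof.
move=> pA; have := psd_CauchySchwarz u (A *m u) (psdX j pA).
rewrite mulmxA -qformE mulmxE -exprSr -/(moment _ _ _) => /le_trans; apply.
have := qform_congX (A ^+ j) u 1 pA; rewrite expr1 => ->.
by rewrite /moment !mulmxE -exprS -exprSr.
Qed.

(** The power mean (m_j / m_0)^(1/j) is nondecreasing in j; this is one step of it, cleared of roots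
    and quotients. *)
Lemma moment_root n (A : 'M[R]_n) u j : psd A ->
  moment A u j ^+ j.+1 <= moment A u 0 * moment A u j.+1 ^+ j.
Proof.
move=> pA; have m0 i : 0 <= moment A u i by exact: moment_ge0.
elim: j => [|j IHj]; first by rewrite expr0 mulr1 expr1.
have [->|mj] := eqVneq (moment A u j.+1) 0.
  by rewrite expr0n /= mulr_ge0 ?exprn_ge0.
have mjp : 0 < moment A u j.+1 ^+ j by rewrite exprn_gt0 // lt_def mj m0.
rewrite -(ler_pM2l mjp) -exprD.
have -> : (j + j.+2 = 2 * j.+1)%N by lia.
rewrite exprM; apply: (@le_trans _ _ ((moment A u j * moment A u j.+2) ^+ j.+1)).
  by rewrite lerXn2r ?nnegrE ?mulr_ge0 ?sqr_ge0 ?moment_logconvex.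
rewrite exprMn (le_trans (ler_wpM2r _ IHj)) ?exprn_ge0 //.
by rewrite mulrCA mulrA.
Qed.

(** By log-convexity the quotients m_(j+1) / m_j are nondecreasing; the j-th is compared with the
    first, again without dividing. *)
Lemma moment_ratio n (A : 'M[R]_n) u j : psd A ->
  moment A u j * moment A u 1 <= moment A u 0 * moment A u j.+1.
Proof.
move=> pA; have m0 i : 0 <= moment A u i by exact: moment_ge0.
elim: j => [|j IHj] //.
have lc := moment_logconvex u j pA.
have [mj|mj] := eqVneq (moment A u j) 0.
  have -> : moment A u j.+1 = 0.
    by apply/eqP; rewrite -sqrf_eq0 eq_le sqr_ge0 andbT (le_trans lc) // mj mul0r.
  by rewrite mul0r mulr_ge0.
have mjp : 0 < moment A u j by rewrite lt_def mj m0.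
rewrite -(ler_pM2l mjp); set a := moment A u in lc IHj mjp *.
apply: (@le_trans _ _ (a 0%N * a j.+1 ^+ 2)).
  rewrite mulrCA expr2 (mulrC (a 0%N)) -mulrA ler_wpM2l ?m0 // mulrC //.
by rewrite [leRHS]mulrCA ler_wpM2l ?m0.
Qed.

Lemma moment_jensen n (A : 'M[R]_n) u j : psd A -> dotv u u = 1 ->
  qform A u ^+ j <= moment A u j.
Proof.
move=> pA u1; elim: j => [|j IHj]; first by rewrite expr0 moment0 u1.
have := moment_ratio u j pA; rewrite moment0 u1 mul1r moment1; apply: le_trans.
by rewrite exprSr ler_wpM2r // psd_ge0.
Qed.

(** ** Traces *)

Lemma mxtrace_mul_outer n (M : 'M[R]_n) b : \tr (M *m (b *m b^T)) = qform M b.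
Proof. by rewrite mulmxA mxtrace_outer qformE. Qed.

Lemma psd_decomp n (A : 'M[R]_n) : psd A ->
  exists s : seq 'cV[R]_n, (size s <= n)%N /\ A = \sum_(b <- s) b *m b^T.
Proof.
case=> As Ap; have [s [sz sP sE]] := symmetric_spectral As.
exists [seq Num.sqrt p.1 *: p.2 | p <- s]; split; first by rewrite size_map.
rewrite big_map -[LHS](expr1 A) (sE 0%N) !big_seq; apply: eq_bigr => p ps.
have [_ pp Ap2] := sP p ps.
rewrite linearZ /= -scalemxAl -scalemxAr scalerA expr1 -expr2 sqr_sqrtr //.
by have := Ap p.2; rewrite qformE Ap2 dotvZr pp mulr1.
Qed.

Lemma mxtrace_mul_psd_ge0 n (M N : 'M[R]_n) : psd M -> psd N -> 0 <= \tr (M *m N).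
Proof.
move=> pM /psd_decomp[s [_ ->]]; rewrite mulmx_sumr linear_sum sumr_ge0 //= => b _.
by rewrite mxtrace_mul_outer psd_ge0.
Qed.

Lemma mxtrace_psd_ge0 n (M : 'M[R]_n) : psd M -> 0 <= \tr M.
Proof. by move=> pM; rewrite -[M]mul1mx mxtrace_mul_psd_ge0 //; exact: psd1. Qed.

Lemma dotv_CauchySchwarz n (x y : 'cV[R]_n) :
  dotv x y ^+ 2 <= dotv x x * dotv y y.
Proof. by have := psd_CauchySchwarz x y (psd1 n); rewrite mul1mx !qform1. Qed.

Lemma qform_le_mxtrace n (M : 'M[R]_n) u : psd M -> qform M u <= \tr M * dotv u u.
Proof.
case/psd_decomp => s [_ ->]; rewrite qform_sum linear_sum mulr_suml.
apply: ler_sum => b _; rewrite qform_outer /= mxtrace_outer; exact: dotv_CauchySchwarz.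
Qed.

Lemma mxtrace_mul_le n (M N : 'M[R]_n) l : psd M ->
  (forall u, qform N u <= l * dotv u u) -> \tr (N *m M) <= l * \tr M.
Proof.
move=> /psd_decomp[s [_ ->]] Nl; rewrite mulmx_sumr !linear_sum mulr_sumr.
by apply: ler_sum => b _ /=; rewrite mxtrace_mul_outer mxtrace_outer.
Qed.

(* Jensen at the eigenvectors of B replaces the missing monotonicity of
   x |-> x^K for the psd order. *)
Lemma mxtraceX_mono n (A B : 'M[R]_n) K : psd B -> psd (A - B) ->
  \tr (B ^+ K.+1) <= \tr (A ^+ K *m B).
Proof.
move=> pB pAB; have pA : psd A by rewrite -(subrK B A); exact: psdD.
case: (pB) => Bs Bp; have [s [sz sP sE]] := symmetric_spectral Bs.
rewrite -[X in _ *m X]expr1 !sE mulmx_sumr !linear_sum !big_seq /=.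
apply: ler_sum => p ps; have [_ pp Bp2] := sP p ps.
rewrite -scalemxAr !linearZ /= mxtrace_mul_outer mxtrace_outer pp mulr1 expr1.
have qB : qform B p.2 = p.1 by rewrite qformE Bp2 dotvZr pp mulr1.
have p1 : 0 <= p.1 by rewrite -qB.
rewrite exprS ler_wpM2l //; apply: le_trans (moment_jensen K pA pp).
rewrite lerXn2r ?nnegrE ?psd_ge0 // -subr_ge0 -qB -qformB; exact: psd_ge0.
Qed.

(** ** The maximum of the quadratic form *)

Lemma max_qform_ub n (A : 'M[R]_n) u : psd A -> dotv u u = 1 ->
  qform A u <= max_qform A.
Proof.
move=> pA u1; apply: ub_le_sup; last by exists u => //; apply/l2norm1.
exists (\tr A) => _ [v /l2norm1 v1 ->].
by rewrite (le_trans (qform_le_mxtrace v pA)) // v1 mulr1.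
Qed.

Lemma dotv_delta n (i : 'I_n) : dotv (delta_mx i 0 : 'cV[R]_n) (delta_mx i 0) = 1.
Proof.
rewrite dotvE (bigD1 i) //= big1 => [|j ji]; rewrite !mxE ?(negPf ji) ?mul0r //.
by rewrite !eqxx mulr1 addr0.
Qed.

Lemma qform_delta n (A : 'M[R]_n) i : qform A (delta_mx i 0) = A i i.
Proof. by rewrite qformE dotvC dotv_mull -colE dotvE (bigD1 i) //= big1
  => [|j ji]; rewrite !mxE ?(negPf ji) ?mul0r // !eqxx mul1r addr0. Qed.

Lemma max_qform_le n (A : 'M[R]_n) l : (0 < n)%N ->
  (forall u, dotv u u = 1 -> qform A u <= l) -> max_qform A <= l.
Proof.
move=> n0 Al; apply: ge_sup; last by move=> _ [v /l2norm1 v1 ->]; exact: Al.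
exists (qform A (delta_mx (Ordinal n0) 0)), (delta_mx (Ordinal n0) 0) => //.
exact/l2norm1/dotv_delta.
Qed.

Lemma max_qform_ge0 n (A : 'M[R]_n) : (0 < n)%N -> psd A -> 0 <= max_qform A.
Proof.
move=> n0 pA; apply: le_trans (max_qform_ub pA (dotv_delta (Ordinal n0))).
exact: psd_ge0.
Qed.

Lemma qform_le_max n (A : 'M[R]_n) u : psd A ->
  qform A u <= max_qform A * dotv u u.
Proof.
move=> pA; have [/eqP|u0] := eqVneq (dotv u u) 0.
  by rewrite dotv_eq0 => /eqP ->; rewrite qformE mulmx0 /dotv !mulmx0 !mxE mulr0.
have up : 0 < dotv u u by rewrite lt_def u0 dotv_ge0.
set c := (Num.sqrt (dotv u u))^-1.
have c2 : c ^+ 2 * dotv u u = 1.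
  by rewrite /c exprVn sqr_sqrtr ?ltW // mulVf.
have := @max_qform_ub _ A (c *: u) pA.
rewrite dotvZl dotvZr mulrA -expr2 c2 qformZv => /(_ erefl) /(ler_wpM2r (ltW up)).
by rewrite mulrAC c2 mul1r.
Qed.

Lemma mxtrace_le_max n (A : 'M[R]_n) : psd A -> \tr A <= n%:R * max_qform A.
Proof.
move=> pA; rewrite mulr_natl -[X in _ *+ X]card_ord -sumr_const.
by apply: ler_sum => i _; rewrite -qform_delta max_qform_ub // dotv_delta.
Qed.

Lemma max_le_mxtrace n (A : 'M[R]_n) : (0 < n)%N -> psd A -> max_qform A <= \tr A.
Proof.
by move=> n0 pA; apply: max_qform_le => // u u1; have := qform_le_mxtrace u pA;
  rewrite u1 mulr1.
Qed.

Lemma max_qform_mono n (A B : 'M[R]_n) : (0 < n)%N -> psd B -> psd (A - B) ->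
  max_qform B <= max_qform A.
Proof.
move=> n0 pB pAB; have pA : psd A by rewrite -(subrK B A); exact: psdD.
apply: max_qform_le => // u u1; apply: le_trans (max_qform_ub pA u1).
by rewrite -subr_ge0 -qformB psd_ge0.
Qed.

(** The supremum is not shown to be attained. Jensen's inequality at single unit vectors therefore
    reaches it through a j-th root of the trace, which bounds every value of the form. *)
Lemma max_qformX_le n (A : 'M[R]_n) j : (0 < n)%N -> psd A ->
  max_qform A ^+ j <= \tr (A ^+ j).
Proof.
move=> n0 pA; rewrite leNgt; apply/negP => h; set T := \tr _ in h.
have T0 : 0 <= T by exact/mxtrace_psd_ge0/psdX.
case: j => [|j] in T h T0 *.
  have := @mxtrace1 R n; rewrite -/T /T expr0 -idmxE in h * => E.
  by move: h; rewrite E expr0 ltNge ler1n n0.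
have bnd u : dotv u u = 1 -> qform A u ^+ j.+1 <= T.
  move=> u1; apply: le_trans (moment_jensen j.+1 pA u1) _.
  by have := qform_le_mxtrace u (psdX j.+1 pA); rewrite u1 mulr1.
pose c := T `^ j.+1%:R^-1.
have cT : c ^+ j.+1 = T.
  by rewrite -powR_mulrn ?powR_ge0 // -powRrM mulVf ?pnatr_eq0 // powRr1.
have : max_qform A <= c.
  apply: max_qform_le => // u /bnd; rewrite -cT ler_pXn2r ?nnegrE ?powR_ge0 //.
  exact: psd_ge0.
rewrite leNgt => /negP; apply; rewrite ltNge; apply/negP => le.
by move: h; rewrite -cT ltNge lerXn2r ?nnegrE ?powR_ge0 ?max_qform_ge0.
Qed.

Lemma mxtraceX_le n (A : 'M[R]_n) j : (0 < n)%N -> psd A ->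
  \tr (A ^+ j.+1) <= max_qform A * \tr (A ^+ j).
Proof.
move=> n0 pA; rewrite exprS -mulmxE; apply: mxtrace_mul_le; first exact: psdX.
by move=> u; exact: qform_le_max.
Qed.

Lemma mxtraceX_ub n (A : 'M[R]_n) j : (0 < n)%N -> psd A ->
  \tr (A ^+ j.+1) <= \tr A ^+ j.+1.
Proof.
move=> n0 pA; elim: j => [|j IHj]; first by rewrite !expr1.
rewrite (le_trans (mxtraceX_le _ n0 pA)) // [leRHS]exprS.
by rewrite ler_pM ?max_qform_ge0 ?max_le_mxtrace // mxtrace_psd_ge0 //; exact: psdX.
Qed.

(** ** Eigenvalues *)

Lemma eigenvalue_psd n (A : 'M[R]_n) a : psd A -> eigenvalue A a -> 0 <= a <= \tr A.
Proof.
move=> pA; case: (pA) => As Ap.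
case/eigenvalueP => x xA x0.
have Ax : A *m x^T = a *: x^T by rewrite -[A]As -trmx_mul xA linearZ.
have xp : 0 < dotv x^T x^T.
  rewrite lt_def dotv_ge0 dotv_eq0 andbT; apply: contraNneq x0 => /(congr1 trmx).
  by rewrite trmxK trmx0 => ->.
have q : qform A x^T = a * dotv x^T x^T by rewrite qformE Ax dotvZr.
apply/andP; split; first by rewrite -(pmulr_lge0 a xp) -q.
by rewrite -(ler_pM2r xp) -q qform_le_mxtrace.
Qed.

(** The trace is a sum of at most n eigenvalues. Together with [lambda_max_le] this lets the trace
    replace the largest eigenvalue at the price of a factor n, which the running time feels only as
    log n. *)
Lemma lambda_max_ge n (A : 'M[R]_n) : (0 < n)%N -> psd A ->
  \tr A <= n%:R * lambda_max A.
Proof.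
move=> n0 pA; case: (pA) => As Ap.
have [s [sz sP sE]] := symmetric_spectral As.
have eig p : p \in s -> eigenvalue A p.1.
  move=> /sP[p0 pp Ap2]; apply/eigenvalueP; exists p.2^T.
    by rewrite -[A]As -trmx_mul Ap2 linearZ.
  by apply/negP => /eqP/(congr1 trmx); rewrite trmxK trmx0 => p20;
    move/eqP: pp; rewrite p20 /dotv mulmx0 mxE eq_sym oner_eq0.
have ubd := eigenvalue_psd pA.
have bounded : has_ubound [set a | eigenvalue A a]%classic.
  by exists (\tr A) => a /= /ubd/andP[].
have lam p : p \in s -> p.1 <= lambda_max A by move=> /eig; apply: ub_le_sup.
have lam0 : 0 <= lambda_max A.
  have [E0|/set0P[a aA]] := eqVneq [set a | eigenvalue A a]%classic set0.
    by rewrite /lambda_max E0 sup0.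
  by apply: le_trans (ub_le_sup bounded aA); have /andP[] := ubd _ aA.
have -> : \tr A = \sum_(p <- s) p.1.
  rewrite -[LHS]/(\tr (A ^+ 1)) sE linear_sum !big_seq; apply: eq_bigr => p /sP[_ pp _].
  by rewrite /= linearZ /= mxtrace_outer pp mulr1.
apply: (@le_trans _ _ ((size s)%:R * lambda_max A)).
  elim: (s) lam => [|p s' IHs] lam; first by rewrite big_nil mul0r.
  rewrite big_cons /= -natr1 mulrDl mul1r addrC lerD ?lam ?mem_head //.
  by apply: IHs => q qs; apply: lam; rewrite inE qs orbT.
by rewrite ler_wpM2r // ler_nat.
Qed.

Lemma lambda_max_le n (A : 'M[R]_n) : psd A -> lambda_max A <= \tr A.
Proof.
move=> pA; have [E0|/set0P h] := eqVneq [set a | eigenvalue A a]%classic set0.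
  by rewrite /lambda_max E0 sup0 mxtrace_psd_ge0.
by apply: ge_sup => // a /(eigenvalue_psd pA)/andP[].
Qed.

End Psd.

(** * Power iteration *)

Section PowerMethod.
Variable R : realType.
Implicit Types n : nat.

Lemma dotv_powX n (A : 'M[R]_n) k u : psd A ->
  dotv (A ^+ k *m u) (A ^+ k *m u) = moment A u (2 * k).
Proof.
by move=> pA; rewrite -qform1 qform_congX // mulmx1 mulmxE -exprD addnn -mul2n.
Qed.

Lemma qform_powX n (A : 'M[R]_n) k u : psd A ->
  qform A (A ^+ k *m u) = moment A u (2 * k).+1.
Proof.
move=> pA; rewrite qform_congX // !mulmxE -exprSr -exprD /moment.
by rewrite addSn addnn mul2n.
Qed.

(* w is the normalization of the longest of the vectors A^k U_i, i < N. *)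
Definition power_best n (A : 'M[R]_n) k (U : nat -> 'cV[R]_n) N (w : 'cV[R]_n) :=
  exists i, [/\ (i < N)%N, 0 < moment A (U i) (2 * k),
    forall j, (j < N)%N -> moment A (U j) (2 * k) <= moment A (U i) (2 * k)
    & w = (Num.sqrt (moment A (U i) (2 * k)))^-1 *: (A ^+ k *m U i)].

(** A Rayleigh quotient of A^k u below c l, where l is the maximum, would by [moment_root] force
    m_2k < |u|^2 (c l)^2k, against the hypothesis. *)
Lemma power_rayleigh n (A : 'M[R]_n) k u c : (0 < n)%N -> (0 < k)%N -> psd A ->
  0 < max_qform A -> 0 < dotv u u -> 0 <= c ->
  c ^+ (2 * k) * dotv u u * max_qform A ^+ (2 * k) <= moment A u (2 * k) ->
  c * max_qform A * moment A u (2 * k) <= moment A u (2 * k).+1.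
Proof.
move=> n0 k0 pA l0 u0 c0; set l := max_qform A in l0 *; set j := (2 * k)%N => h.
rewrite leNgt; apply/negP => lt.
have := moment_root u j pA; rewrite moment0.
have mj : 0 <= moment A u j by exact: moment_ge0.
have mj1 : 0 <= moment A u j.+1 by exact: moment_ge0.
have mjp : 0 < moment A u j.
  rewrite lt_def mj andbT; apply: contraTneq lt => ->.
  by rewrite mulr0 -leNgt.
have lt' : moment A u j.+1 ^+ j < (c * l * moment A u j) ^+ j.
  by rewrite ltrXn2r ?nnegrE ?mulr_ge0 ?(ltW l0) //; lia.
rewrite leNgt exprS => /negP; apply.
have mjj : 0 < moment A u j ^+ j by rewrite exprn_gt0.
apply: (@lt_le_trans _ _ (dotv u u * (c * l * moment A u j) ^+ j)).
  by rewrite ltr_pM2l.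
rewrite !exprMn mulrA ler_pM2r //; apply: le_trans h.
by rewrite mulrCA mulrA.
Qed.

Lemma power_best_unit n (A : 'M[R]_n) k U N w : psd A ->
  power_best A k U N w -> dotv w w = 1.
Proof.
move=> pA [i [_ m0 _ ->]]; rewrite dotvZl dotvZr dotv_powX // mulrA -expr2 exprVn.
by rewrite sqr_sqrtr ?ltW // mulVf // gt_eqF.
Qed.

Lemma power_best_qform n (A M : 'M[R]_n) k U N w : psd A ->
  power_best A k U N w ->
  exists i, [/\ (i < N)%N, 0 < moment A (U i) (2 * k),
    forall j, (j < N)%N -> moment A (U j) (2 * k) <= moment A (U i) (2 * k)
    & qform M (A ^+ k *m U i) = moment A (U i) (2 * k) * qform M w].
Proof.
move=> pA [i [iN m0 im ->]]; exists i; split=> //.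
by rewrite qformZv exprVn sqr_sqrtr ?ltW // mulVKf // gt_eqF.
Qed.

(** Choosing the longest iterate suffices: it is at least as long as the one from a good start, its
    own start has squared norm at most n, and [power_rayleigh] turns length into a Rayleigh
    quotient. *)
Lemma power_best_good n (A : 'M[R]_n) k U N w c a : (0 < n)%N -> (0 < k)%N ->
  psd A -> 0 < max_qform A -> 0 <= c -> 0 < a -> c ^+ (2 * k) * n%:R <= a ->
  (forall j, (j < N)%N -> dotv (U j) (U j) <= n%:R) ->
  (exists2 j, (j < N)%N & a * max_qform A ^+ (2 * k) <= moment A (U j) (2 * k)) ->
  power_best A k U N w -> c * max_qform A <= qform A w.
Proof.
move=> n0 k0 pA l0 c0 a0 ca Un [j jN jm] pb.
have [i [iN m0 im]] := power_best_qform A pA pb.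
rewrite qform_powX // => E.
rewrite -(ler_pM2l m0) -E mulrC; apply: power_rayleigh => //.
  rewrite lt_def dotv_ge0 andbT dotv_eq0; apply: contraTneq m0 => ->.
  by rewrite /moment qformE !mulmx0 /dotv mulmx0 mxE ltxx.
apply: le_trans (im j jN); apply: le_trans jm.
apply: ler_wpM2r; first by rewrite exprn_ge0 // ltW.
by apply: le_trans ca; rewrite ler_wpM2l ?exprn_ge0 ?Un.
Qed.

(** The selected iterate has squared length at least tr A^2k / 2 and loses the share eps/2 of a
    value that is at least 7/8 of the maximum l. As l tr A^2k >= tr A^(2k+1), the loss is at least
    (1/2)(eps/2)(7/8) = 7 eps/32 of the potential. The upper bound charges it to c tr (A^2k (A -
    B)), and [mxtraceX_mono] passes from tr (A^2k B) to the potential of B. *)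
Lemma power_best_drop n (A B : 'M[R]_n) k U N w eps c eta :
  (0 < n)%N -> psd A -> psd B -> psd (A - B) -> 0 < eps -> 0 < c -> 0 <= eta ->
  eta * c <= eps * (7 / 32) ->
  (exists2 j, (j < N)%N & \tr (A ^+ (2 * k)) <= 2 * moment A (U j) (2 * k)) ->
  (forall i, (i < N)%N ->
     qform (A - B) (A ^+ k *m U i) <= c * \tr (A ^+ (2 * k) *m (A - B))) ->
  power_best A k U N w -> (7 / 8) * max_qform A <= qform A w ->
  qform B w <= (1 - eps / 2) * qform A w ->
  \tr (B ^+ (2 * k).+1) <= (1 - eta) * \tr (A ^+ (2 * k).+1).
Proof.
move=> n0 pA pB pAB e0 c0 eta0 etac [j jN jm] up pb good bad.
have [i [iN m0 im E]] := power_best_qform (A - B) pA pb.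
have := up i iN; rewrite E qformB.
set m := moment _ _ _ in m0 im *; rewrite mulmxBr mulmxE -exprSr -mulmxE linearB /=.
have mono := mxtraceX_mono (2 * k) pB pAB; have mj := im j jN.
have lt := mxtraceX_le (2 * k) n0 pA.
set TA := \tr (A ^+ _.+1) in lt *; set TB := \tr (B ^+ _.+1) in mono *.
set T := \tr (_ *m B) in mono *; set T0 := \tr (_ ^+ _) in lt jm.
have T00 : 0 <= T0 by exact/mxtrace_psd_ge0/psdX.
have l0 := max_qform_ge0 n0 pA.
set l := max_qform A in lt good l0; set qA := qform A w in good bad *.
set qB := qform B w in bad *; move=> h.
have s1 : m * (eps / 2 * qA) <= c * (TA - TB).
  apply: (@le_trans _ _ (m * (qA - qB))); first by rewrite (ler_wpM2l (ltW m0)) //; lra.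
  by apply: le_trans h _; rewrite (ler_wpM2l (ltW c0)) //; lra.
have s2 : eps * (7 / 32) * TA <= c * (TA - TB).
  apply: le_trans s1; apply: (@le_trans _ _ (T0 / 2 * (eps / 2 * (7 / 8 * l)))).
    have -> : T0 / 2 * (eps / 2 * (7 / 8 * l)) = eps * (7 / 32) * (l * T0) by field.
    by rewrite ler_wpM2l //; lra.
  have e2 : 0 <= eps / 2 by lra.
  apply: ler_pM; [lra| |lra|]; first by rewrite mulr_ge0 // mulr_ge0 //; lra.
  by rewrite ler_wpM2l.
have TA0 : 0 <= TA by exact/mxtrace_psd_ge0/psdX.
have s3 : eta * c * TA <= c * (TA - TB).
  by apply: le_trans s2; rewrite ler_wpM2r.
have : eta * TA <= TA - TB by rewrite -(ler_pM2l c0) mulrCA mulrA.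
lra.
Qed.

End PowerMethod.

(** * Fair coins *)

Section Coins.
Variable R : realType.

(** Expectation over m fair coins. Recursion on the first coin makes the moment bounds and the
    independence of consecutive blocks plain inductions. *)
Fixpoint mean m (F : seq bool -> R) : R :=
  if m is m'.+1 then
    (mean m' (fun b => F (true :: b)) + mean m' (fun b => F (false :: b))) / 2
  else F [::].

Lemma mean_le m F G : (forall b, size b = m -> F b <= G b) -> mean m F <= mean m G.
Proof.
elim: m F G => [|m IHm] F G FG /=; first exact: FG.
rewrite ler_pM2r ?invr_gt0 // lerD //; apply: IHm => b bm; apply: FG => /=;
  by rewrite bm.
Qed.

Lemma mean_eq m F G : (forall b, size b = m -> F b = G b) -> mean m F = mean m G.
Proof.
by move=> FG; apply/eqP; rewrite eq_le !mean_le // => b bm; rewrite FG.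
Qed.

Lemma meanD m F G : mean m (fun b => F b + G b) = mean m F + mean m G.
Proof. by elim: m F G => [|m IHm] F G //=; rewrite !IHm; field. Qed.

Lemma meanZ m a F : mean m (fun b => a * F b) = a * mean m F.
Proof. by elim: m F => [|m IHm] F //=; rewrite !IHm; field. Qed.

Lemma mean_const m a : mean m (fun=> a) = a.
Proof. by elim: m => [|m IHm] //=; rewrite IHm; field. Qed.

Lemma mean_ge0 m F : (forall b, size b = m -> 0 <= F b) -> 0 <= mean m F.
Proof. by move=> F0; rewrite -[X in X <= _](mean_const m); exact: mean_le. Qed.

Lemma mean_sum m (I : Type) (s : seq I) (F : I -> seq bool -> R) :
  mean m (fun b => \sum_(i <- s) F i b) = \sum_(i <- s) mean m (F i).
Proof.
elim: s => [|i s IHs].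
  rewrite big_nil -[RHS](mean_const m); apply: mean_eq => b _; exact: big_nil.
by rewrite big_cons -IHs -meanD; apply: mean_eq => b _; rewrite big_cons.
Qed.

Lemma mean_cat m p F G :
  mean (m + p) (fun b => F (take m b) * G (drop m b)) = mean m F * mean p G.
Proof.
elim: m F => [|m IHm] F /=.
  by rewrite -meanZ; apply: mean_eq => b _; rewrite take0 drop0.
by rewrite (IHm (fun b => F (true :: b))) (IHm (fun b => F (false :: b))); field.
Qed.

Lemma mean_take m p F : mean (m + p) (fun b => F (take m b)) = mean m F.
Proof.
rewrite -[RHS]mulr1 -(mean_const p 1) -mean_cat.
by apply: mean_eq => b _; rewrite mulr1.
Qed.

Lemma mean_drop m p F : mean (m + p) (fun b => F (drop m b)) = mean p F.
Proof.
rewrite -[RHS]mul1r -{1}(mean_const m 1) -mean_cat.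
by apply: mean_eq => b _; rewrite mul1r.
Qed.

Definition indic (P : Prop) : R := (`[< P >])%:R.

Lemma indic_ge0 P : 0 <= indic P.
Proof. exact: ler0n. Qed.

Lemma indic_le1 P : indic P <= 1.
Proof. by rewrite /indic; case: asbool; rewrite ?ler01. Qed.

Lemma indicT (P : Prop) : P -> indic P = 1.
Proof. by rewrite /indic => /asboolT ->. Qed.

Lemma indicF (P : Prop) : ~ P -> indic P = 0.
Proof. by rewrite /indic => /asboolF ->. Qed.

Lemma indic_le P (x : R) : 0 <= x -> (P -> 1 <= x) -> indic P <= x.
Proof.
move=> x0 Px; have [/[dup] p /indicT -> |/indicF ->] // := pselect P; exact: Px.
Qed.

Definition pr m (P : seq bool -> Prop) : R := mean m (fun b => indic (P b)).

Lemma pr_le m (P Q : seq bool -> Prop) :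
  (forall b, size b = m -> P b -> Q b) -> pr m P <= pr m Q.
Proof.
move=> PQ; apply: mean_le => b bm; apply: indic_le; first exact: indic_ge0.
by move=> /(PQ _ bm)/indicT ->.
Qed.

Lemma pr_ge0 m P : 0 <= pr m P.
Proof. by apply: mean_ge0 => b _; exact: indic_ge0. Qed.

Lemma prC m P : pr m P = 1 - pr m (fun b => ~ P b).
Proof.
rewrite -[X in X - _](mean_const m) -[X in _ = _ + X]mulN1r -meanZ -meanD.
apply: mean_eq => b _; have [p|p] := pselect (P b).
  by rewrite (indicT p) indicF ?mulr0 ?addr0 // => np; exact: np.
by rewrite (indicF p) (indicT (P := ~ P b)) // mulr1 subrr.
Qed.

Lemma pr_bigU (I : eqType) m (s : seq I) (P : I -> seq bool -> Prop)
    (Q : seq bool -> Prop) p :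
  (forall b, size b = m -> Q b -> exists2 i, i \in s & P i b) ->
  (forall i, i \in s -> pr m (P i) <= p) ->
  pr m Q <= (size s)%:R * p.
Proof.
move=> QP Pp; apply: (@le_trans _ _ (\sum_(i <- s) pr m (P i))).
  rewrite -mean_sum; apply: mean_le => b bm; apply: indic_le.
    by rewrite sumr_ge0 // => i _; exact: indic_ge0.
  case/(QP b bm) => i is_s Pi; rewrite (big_rem i is_s) /= (indicT Pi) lerDl.
  by rewrite sumr_ge0 // => j _; exact: indic_ge0.
rewrite mulr_natl; elim: s {QP} Pp => [|i s IHs] Pp; first by rewrite big_nil.
rewrite big_cons /= mulrS lerD ?Pp ?mem_head //.
by apply: IHs => j js; apply: Pp; rewrite inE js orbT.
Qed.

Lemma prU m (P1 P2 Q : seq bool -> Prop) :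
  (forall b, size b = m -> Q b -> P1 b \/ P2 b) -> pr m Q <= pr m P1 + pr m P2.
Proof.
move=> QP; rewrite -meanD; apply: mean_le => b bm; apply: indic_le.
  by rewrite addr_ge0 ?indic_ge0.
by case/(QP b bm) => /indicT ->; rewrite ?lerDl ?lerDr ?indic_ge0.
Qed.

Lemma mean_tuple m F :
  mean m F = (\sum_(b : m.-tuple bool) F b) / 2 ^+ m.
Proof.
elim: m F => [|m IHm] F /=.
  rewrite (big_pred1 [tuple]) ?expr0 ?divr1 // => t.
  by rewrite [t]tuple0 /= eqxx.
rewrite !IHm exprS invfM mulrA -mulrDl mulrAC; congr (_ * _ / _).
rewrite (reindex (fun p : bool * m.-tuple bool => cons_tuple p.1 p.2)) /=; last first.
  exists (fun t => (thead t, behead_tuple t)) => [[c t] _|t _].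
    by congr (_, _); apply: val_inj.
  by rewrite [RHS](tuple_eta t).
rewrite -(pair_big xpredT xpredT (fun c (t : m.-tuple bool) => F (c :: t))) /=.
by rewrite (bigD1 true) //= (big_pred1 false) //; case.
Qed.

Lemma prob_coinsE k (Q : k.-tuple bool -> Prop) (P : seq bool -> Prop) :
  (forall b : k.-tuple bool, P b -> Q b) -> pr k P <= prob_coins R Q.
Proof.
move=> PQ; rewrite /pr mean_tuple /prob_coins ler_pM2r ?invr_gt0 ?exprn_gt0 //.
rewrite -sum1_card natr_sum [leRHS]big_mkcond /=; apply: ler_sum => b _.
rewrite inE /=; case: asboolP => [_|nQ]; first exact: indic_le1.
by rewrite indicF // => /PQ.
Qed.

(** ** Signed sums *)

Fixpoint signed_sum n (fs : seq 'cV[R]_n) (b : seq bool) : 'cV[R]_n :=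
  match fs, b with
  | f :: fs', c :: b' => (if c then 1 else -1) *: f + signed_sum fs' b'
  | _, _ => 0
  end.

(** The shift x collects the signs already fixed; the cross terms of the next sign cancel on
    average. *)
Lemma mean_qform n (M : 'M[R]_n) x fs : M^T = M ->
  mean (size fs) (fun b => qform M (x + signed_sum fs b)) =
  qform M x + \sum_(f <- fs) qform M f.
Proof.
move=> Ms; elim: fs x => [|f fs IHs] x /=; first by rewrite addr0 big_nil addr0.
rewrite (_ : mean _ _ = mean (size fs) (fun b => qform M ((x + f) + signed_sum fs b)));
  last by apply: mean_eq => b _; rewrite scale1r addrA.
rewrite (_ : mean _ (fun b => qform M (x + (-1 *: _ + _))) =
  mean (size fs) (fun b => qform M ((x - f) + signed_sum fs b)));
  last by apply: mean_eq => b _; rewrite scaleN1r addrA.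
rewrite !IHs big_cons !qformE !mulmxDr !mulmxN !dotvDl !dotvDr.
rewrite -!scaleN1r !dotvZl !dotvZr; by field.
Qed.

(** Averaging over one sign leaves (a + d)^2 + 4 b^2 with b^2 <= a d by Cauchy-Schwarz, where a and
    d are the values at x and f and b is their mixed term; the coefficients 6 and 3 reproduce
    themselves under this step. At x = 0 it says E X^2 <= 3 (E X)^2. *)
Lemma mean_qform2 n (M : 'M[R]_n) x fs (T := \sum_(f <- fs) qform M f) : psd M ->
  mean (size fs) (fun b => qform M (x + signed_sum fs b) ^+ 2) <=
  qform M x ^+ 2 + 6 * qform M x * T + 3 * T ^+ 2.
Proof.
rewrite {}/T => pM; elim: fs x => [|f fs IHs] x /=.
  by rewrite addr0 big_nil !mulr0 expr0n mulr0 !addr0.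
rewrite (_ : mean _ _ = mean (size fs) (fun b => qform M ((x + f) + signed_sum fs b) ^+ 2));
  last by apply: mean_eq => b _; rewrite scale1r addrA.
rewrite (_ : mean _ (fun b => qform M (x + (-1 *: _ + _)) ^+ 2) =
  mean (size fs) (fun b => qform M ((x - f) + signed_sum fs b) ^+ 2));
  last by apply: mean_eq => b _; rewrite scaleN1r addrA.
rewrite big_cons; set T := \sum_(j <- fs) _.
have T0 : 0 <= T by rewrite sumr_ge0 // => g _; exact: psd_ge0.
have := IHs (x + f); have := IHs (x - f); rewrite -/T.
have E (s : R) : qform M (x + s *: f) =
    qform M x + 2 * s * dotv x (M *m f) + s ^+ 2 * qform M f.
  rewrite !qformE mulmxDr dotvDl !dotvDr -scalemxAr !dotvZl !dotvZr.
  rewrite (_ : dotv f (M *m x) = dotv x (M *m f)); first ring.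
  by rewrite dotvC dotv_mull (proj1 pM).
rewrite -[- f]scaleN1r -[in (x + f)](scale1r f) !E.
have := psd_CauchySchwarz x f pM; have := psd_ge0 x pM; have := psd_ge0 f pM.
set a := qform M x; set d := qform M f; set be := dotv _ _.
set m1 := mean _ _; set m2 := mean _ _ => d0 a0 CS h1 h2.
have : m2 + m1 <= 2 * (a ^+ 2 + 6 * a * (d + T) + 3 * (d + T) ^+ 2).
  apply: (le_trans (lerD h2 h1)).
  have : 0 <= d * T by rewrite mulr_ge0.
  have : 0 <= d ^+ 2 by rewrite sqr_ge0.
  nra.
lra.
Qed.

(* Cantelli's inequality, through the quadratic (4/81)(x - 1/2)(19/2 - x) that
   lies below the indicator of [x >= 1/2]. *)
Lemma signed_sum_lower n (M : 'M[R]_n) fs (T := \sum_(f <- fs) qform M f) : psd M ->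
  pr (size fs) (fun b => ~ (T <= 2 * qform M (signed_sum fs b))) <= 8 / 9.
Proof.
move=> pM; have T0 : 0 <= T by rewrite sumr_ge0 // => g _; exact: psd_ge0.
have [Te|Tn] := eqVneq T 0.
  rewrite /pr (@mean_eq _ _ (fun=> 0)) ?mean_const //; first lra.
  move=> b _; apply: indicF; apply; rewrite Te mulr_ge0 //; exact: psd_ge0.
have Tp : 0 < T by rewrite lt_def Tn.
pose X b := qform M (signed_sum fs b).
have X1 : mean (size fs) X = T.
  have := mean_qform 0 fs (proj1 pM).
  rewrite [qform M 0]qformE mulmx0 [dotv 0 0]/dotv mulmx0 mxE add0r -/T => <-.
  by apply: mean_eq => b _; rewrite add0r.
have X2 : mean (size fs) (fun b => X b ^+ 2) <= 3 * T ^+ 2.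
  have := mean_qform2 0 fs pM; rewrite [qform M 0]qformE mulmx0 [dotv 0 0]/dotv mulmx0 mxE -/T.
  rewrite expr0n mulr0 mul0r !add0r; apply: le_trans.
  by apply: mean_le => b _; rewrite add0r.
(* One minus the quadratic, in the variable X / T; its mean is at most (100 - 40 + 12) / 81 =
   8/9. *)
apply: (@le_trans _ _ (mean (size fs) (fun b =>
   (100 / 81 + (- (40 / 81) / T) * X b + (4 / 81 / T ^+ 2) * X b ^+ 2)))).
  apply: mean_le => b _; set x := X b; pose y := x / T.
  have xE : x = y * T by rewrite /y divfK.
  have -> : 100 / 81 + - (40 / 81) / T * x + 4 / 81 / T ^+ 2 * x ^+ 2 =
    100 / 81 - 40 / 81 * y + 4 / 81 * y ^+ 2.
    by rewrite xE; field.
  have x0 : 0 <= x by exact: psd_ge0.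
  have y0 : 0 <= y by rewrite divr_ge0.
  apply: indic_le; first by have := sqr_ge0 (y - 5); nra.
  move/negP; rewrite -ltNge -/(X b) -/x xE mulrA -[ltRHS]mul1r ltr_pM2r // => y2.
  nra.
rewrite !meanD !meanZ mean_const X1.
have -> : - (40 / 81) / T * T = - (40 / 81) by field.
have : 4 / 81 / T ^+ 2 * mean (size fs) (fun b => X b ^+ 2) <= 4 / 81 / T ^+ 2 * (3 * T ^+ 2).
  by rewrite ler_wpM2l // divr_ge0 ?sqr_ge0 //; lra.
have -> : 4 / 81 / T ^+ 2 * (3 * T ^+ 2) = 12 / 81 by field.
lra.
Qed.

(** From exp(-x) >= 1 - x and (1 + x + 2 x^2)(1 - x) = 1 + x^2 (1 - 2 x) >= 1. *)
Lemma expR_le_quadratic (x : R) : `|x| <= 1 / 2 -> expR x <= 1 + x + 2 * x ^+ 2.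
Proof.
rewrite ler_norml => /andP[x1 x2].
have e0 : 0 < expR (- x) by exact: expR_gt0.
rewrite -[x in expR x]opprK expRN -[leLHS]mul1r ler_pdivrMr //.
have := expR_ge1Dx (- x); set e := expR _.
have : 1 <= (1 + x + 2 * x ^+ 2) * (1 - x).
  have -> : (1 + x + 2 * x ^+ 2) * (1 - x) = 1 + x ^+ 2 * (1 - 2 * x) by ring.
  by rewrite lerDl mulr_ge0 ?sqr_ge0 //; lra.
move=> h1 h2; apply: le_trans h1 _; rewrite ler_wpM2l //; nra.
Qed.

(** The terms linear in y = a.f cancel between the two signs, so each sign contributes a factor at
    most 1 + 2 y^2 <= exp(2 y^2). *)
Lemma mean_expR n (a : 'cV[R]_n) fs x :
  (forall f, f \in fs -> `|dotv a f| <= 1 / 2) ->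
  mean (size fs) (fun b => expR (x + dotv a (signed_sum fs b))) <=
  expR (x + 2 * \sum_(f <- fs) dotv a f ^+ 2).
Proof.
elim: fs x => [|f fs IHs] x h /=.
  by rewrite big_nil mulr0 /dotv mulmx0 mxE.
rewrite (_ : mean _ _ = mean (size fs) (fun b => expR ((x + dotv a f) + dotv a (signed_sum fs b))));
  last by apply: mean_eq => b _; rewrite scale1r dotvDr addrA.
rewrite (_ : mean _ (fun b => expR (x + dotv a (-1 *: _ + _))) =
  mean (size fs) (fun b => expR ((x - dotv a f) + dotv a (signed_sum fs b))));
  last by apply: mean_eq => b _; rewrite dotvDr dotvZr mulN1r addrA.
have hs f' : f' \in fs -> `|dotv a f'| <= 1 / 2.
  by move=> f's; apply: h; rewrite inE f's orbT.
have := IHs (x + dotv a f) hs; have := IHs (x - dotv a f) hs.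
rewrite big_cons; set S := \sum_(j <- fs) _; set y := dotv a f.
have hy : `|y| <= 1 / 2 by apply: h; rewrite mem_head.
have e1 := expR_le_quadratic hy.
have e2 : expR (- y) <= 1 + (- y) + 2 * (- y) ^+ 2.
  by apply: expR_le_quadratic; rewrite normrN.
have e3 : 1 + 2 * y ^+ 2 <= expR (2 * y ^+ 2) by exact: expR_ge1Dx.
rewrite (_ : x - y + 2 * S = (x + 2 * S) + - y); last by ring.
rewrite (_ : x + y + 2 * S = (x + 2 * S) + y); last by ring.
rewrite (_ : x + 2 * (y ^+ 2 + S) = (x + 2 * S) + 2 * y ^+ 2); last by ring.
rewrite !expRD; have z0 := expR_gt0 (x + 2 * S); rewrite !expRD in z0.
set z := expR x * _ in z0 *; set m1 := mean _ _; set m2 := mean _ _ => h1 h2.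
have : m2 + m1 <= z * (2 * expR (2 * y ^+ 2)).
  apply: (le_trans (lerD h2 h1)); rewrite -mulrDr ler_pM2l //; nra.
lra.
Qed.

(** Markov's inequality for the exponential of the sum divided by 2 sqrt S. At this scale every
    coefficient is at most 1/2, as [mean_expR] requires, and the squares add up to 1/4, which gives
    the term 1/2 in the exponent. The factor 2 is for the two tails. *)
Lemma signed_sum_upper n (a : 'cV[R]_n) fs (tau : R)
  (S := \sum_(f <- fs) dotv a f ^+ 2) : 0 <= tau ->
  pr (size fs) (fun b => ~ (dotv a (signed_sum fs b) ^+ 2 <= tau ^+ 2 * S)) <=
  2 * expR (1 / 2 - tau / 2).
Proof.
move=> t0; have S0 : 0 <= S by rewrite sumr_ge0 // => f _; exact: sqr_ge0.
have termS f : f \in fs -> dotv a f ^+ 2 <= S.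
  move=> fs_f; rewrite /S (big_rem f) //= lerDl sumr_ge0 // => g _; exact: sqr_ge0.
have [Se|Sn] := eqVneq S 0.
  rewrite /pr (@mean_eq _ _ (fun=> 0)) ?mean_const ?mulr_ge0 ?expR_ge0 // => b _.
  apply: indicF; apply; rewrite Se mulr0.
  suff -> : dotv a (signed_sum fs b) = 0 by rewrite expr0n.
  elim: (fs) b termS => [|f gs IHs] [|c b] h /=; rewrite ?(dotvE _ 0);
    try by rewrite big1 // => i _; rewrite mxE mulr0.
  rewrite dotvDr dotvZr IHs ?addr0; last by move=> g gs_g; apply: h; rewrite inE gs_g orbT.
  have := h f (mem_head _ _); rewrite Se => hf.
  have /eqP -> : dotv a f == 0 by rewrite -sqrf_eq0 eq_le hf sqr_ge0.
  by rewrite mulr0.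
have Sp : 0 < S by rewrite lt_def Sn.
pose s := Num.sqrt S; have sp : 0 < s by rewrite sqrtr_gt0.
have sS : s ^+ 2 = S by rewrite sqr_sqrtr.
have half (sg : R) : sg ^+ 2 = 1 ->
    pr (size fs) (fun b => tau * s < sg * dotv a (signed_sum fs b)) <=
    expR (1 / 2 - tau / 2).
  move=> sg2; pose a' := (sg / (2 * s)) *: a.
  apply: (@le_trans _ _ (mean (size fs) (fun b => expR (- (tau / 2) + dotv a' (signed_sum fs b))))).
    apply: mean_le => b _; apply: indic_le; first exact: expR_ge0.
    move=> h; rewrite -[leLHS]expR0 ler_expR dotvZl.
    rewrite mulrAC -[_ * _ / _]mulrC; move: h; set z := sg * _ => h.
    have -> : z = (z / s) * s by rewrite divfK // gt_eqF.
    rewrite invfM; have : tau < z / s by rewrite ltr_pdivlMr.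
    set q := z / s => tq; have -> : 2^-1 / s * (q * s) = q / 2.
      by field; rewrite gt_eqF.
    lra.
  have a'f f : dotv a' f ^+ 2 = dotv a f ^+ 2 / (4 * S).
    rewrite dotvZl -sS exprMn exprMn sg2 exprVn exprMn; field.
    by rewrite gt_eqF.
  apply: (le_trans (mean_expR _ _)).
    move=> f fs_f; rewrite -(ler_pXn2r (n := 2)) ?nnegrE ?divr_ge0 //.
    rewrite real_normK ?num_real // a'f ler_pdivrMr ?mulr_gt0 //.
    have := termS f fs_f; lra.
  rewrite ler_expR (eq_bigr _ (fun f _ => a'f f)) -mulr_suml -/S.
  have -> : S / (4 * S) = 1 / 4 by field; rewrite gt_eqF.
  lra.
apply: (le_trans (@prU _ (fun b => tau * s < 1 * dotv a (signed_sum fs b))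
   (fun b => tau * s < -1 * dotv a (signed_sum fs b)) _ _)); last first.
  have h1 := half 1 (expr1n _ _); have h2 := half (-1) (etrans (sqrrN 1) (expr1n _ _)); lra.
move=> b _ /negP; rewrite -ltNge -sS -exprMn mul1r mulN1r => h.
have : tau * s < `|dotv a (signed_sum fs b)|.
  rewrite -(ltr_pXn2r (n := 2)) ?nnegrE ?mulr_ge0 // ?ltW //.
  by rewrite real_normK ?num_real.
by rewrite lter_normr => /orP[]; [left|right].
Qed.

End Coins.

(** * Program logic *)

Definition loc := (nat * nat)%type.

Definition instr_loc (i : instr) : loc :=
  match i with
  | NConst x _ | NAdd x _ _ | NSub x _ _ | NLoad x _ _ => (0, x)%N
  | NStore a _ _ => (1, a)%N
  | ROfNat x _ | RAdd x _ _ | RSub x _ _ | RMul x _ _ | RDiv x _ _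
  | RSqrt x _ | RLoad x _ _ => (2, x)%N
  | RStore a _ _ => (3, a)%N
  end.

(* The locations that a command may write: registers and arrays of naturals
   are tagged 0 and 1, those of reals 2 and 3. *)
Fixpoint mods (c : cmd) : seq loc :=
  match c with
  | Skip => [::]
  | Do i => [:: instr_loc i]
  | Flip x => [:: (0, x)%N]
  | Seq c d | If _ c d => mods c ++ mods d
  | While _ c => mods c
  end.

Fixpoint block (l : seq instr) (c : cmd) : cmd :=
  if l is i :: l' then Seq (Do i) (block l' c) else c.

(* Register 40 is reserved for the increment. *)
Definition For (x y : nat) (c : cmd) : cmd :=
  Seq (Do (NConst x 0))
    (While (NLt x y) (Seq c (Seq (Do (NConst 40 1)) (Do (NAdd x x 40))))).

Arguments block : simpl never.
Arguments For : simpl never.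
Arguments mods : simpl never.

Section Triples.
Variable R : realType.
Implicit Types s : memory R.

Definition agree (l : seq loc) s s' :=
  [/\ forall x, (0, x)%N \notin l -> nreg s' x = nreg s x,
      forall x, (1, x)%N \notin l -> narr s' x = narr s x,
      forall x, (2, x)%N \notin l -> rreg s' x = rreg s x
    & forall x, (3, x)%N \notin l -> rarr s' x = rarr s x].

Lemma agn l s s' : agree l s s' -> forall x, (0, x)%N \notin l -> nreg s' x = nreg s x.
Proof. by case. Qed.
Lemma aga l s s' : agree l s s' -> forall x, (1, x)%N \notin l -> narr s' x = narr s x.
Proof. by case. Qed.
Lemma agr l s s' : agree l s s' -> forall x, (2, x)%N \notin l -> rreg s' x = rreg s x.
Proof. by case. Qed.
Lemma agv l s s' : agree l s s' -> forall x, (3, x)%N \notin l -> rarr s' x = rarr s x.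
Proof. by case. Qed.

Lemma agree_refl l s : agree l s s.
Proof. by split. Qed.

Lemma agree_trans l1 l2 s1 s2 s3 :
  agree l1 s1 s2 -> agree l2 s2 s3 -> agree (l1 ++ l2) s1 s3.
Proof.
case=> a1 a2 a3 a4 [b1 b2 b3 b4].
by split=> x; rewrite mem_cat negb_or => /andP[h1 h2];
  [rewrite b1 // a1|rewrite b2 // a2|rewrite b3 // a3|rewrite b4 // a4].
Qed.

Lemma agree_sub l1 l2 s1 s2 : {subset l1 <= l2} -> agree l1 s1 s2 -> agree l2 s1 s2.
Proof.
move=> sub [a1 a2 a3 a4].
by split=> x h; [apply: a1|apply: a2|apply: a3|apply: a4]; apply: contra h => /sub.
Qed.

Lemma agree_instr i s : agree [:: instr_loc i] s (do_instr i s).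
Proof.
by case: i => [x c|x y z|x y z|x a y|a y x|x y|x y z|x y z|x y z|x y z|x y|x a y|a y x];
  split=> z' //=; rewrite inE xpair_eqE eqxx /= => /negPf ->.
Qed.

Lemma exec_mods c s w s' k : exec c s w s' k -> agree (mods c) s s'.
Proof.
elim=> {c s w s' k}; rewrite /mods /= -/mods.
- by move=> s; exact: agree_refl.
- by move=> i s; exact: agree_instr.
- by move=> x b s; split=> z //=; rewrite inE xpair_eqE eqxx /= => /negPf ->.
- by move=> c d s1 s2 s3 w1 w2 k1 k2 _ a1 _ a2; exact: agree_trans a1 a2.
- move=> b c d s s' w k _; case: eval_test => h; apply: agree_sub h => l;
    by rewrite mem_cat => ->; rewrite ?orbT.
- by move=> b c s _; exact: agree_refl.
- move=> b c s1 s2 s3 w1 w2 k1 k2 _ _ a1 _ a2; have := agree_trans a1 a2.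
  by apply: agree_sub => l; rewrite mem_cat => /orP[].
Qed.

(** The initial memory is a parameter rather than a precondition, so that Q can refer to it; w lists
    exactly the coins tossed. *)
Definition triple (c : cmd) s (w : seq bool) (K : nat) (Q : memory R -> Prop) :=
  exists s' k, [/\ exec c s w s' k, (k <= K)%N & Q s'].

(** The frame comes from the syntax: every postcondition may be strengthened by the agreement
    outside [mods c], so specifications mention only what changes. *)
Lemma t_conseq c s w K K' (Q Q' : memory R -> Prop) :
  triple c s w K Q -> (K <= K')%N ->
  (forall s', agree (mods c) s s' -> Q s' -> Q' s') -> triple c s w K' Q'.
Proof.
case=> s' [k [ex kK q]] KK' QQ'; exists s', k; split=> //; first exact: leq_trans kK KK'.
by apply: QQ' q; exact: exec_mods ex.
Qed.

Lemma t_le c s w K K' Q : triple c s w K Q -> (K <= K')%N -> triple c s w K' Q.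
Proof. by move=> t KK'; apply: t_conseq t KK' _. Qed.

Lemma t_skip s (Q : memory R -> Prop) : Q s -> triple Skip s [::] 0 Q.
Proof. by move=> q; exists s, 0%N; split=> //; constructor. Qed.

Lemma t_do i s (Q : memory R -> Prop) : Q (do_instr i s) -> triple (Do i) s [::] 1 Q.
Proof. by move=> q; exists (do_instr i s), 1%N; split=> //; constructor. Qed.

Lemma t_flip x (b : bool) s (Q : memory R -> Prop) :
  Q (set_nreg s x b) -> triple (Flip x) s [:: b] 1 Q.
Proof. by move=> q; exists (set_nreg s x b), 1%N; split=> //; constructor. Qed.

Lemma t_seqw c d s w1 w2 K1 K2 Q :
  triple c s w1 K1 (fun s1 => agree (mods c) s s1 -> triple d s1 w2 K2 Q) ->
  triple (Seq c d) s (w1 ++ w2) (K1 + K2) Q.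
Proof.
case=> s1 [k1 [ex1 k1K h]]; have [s2 [k2 [ex2 k2K q]]] := h (exec_mods ex1).
by exists s2, (k1 + k2)%N; split; [econstructor; eassumption|exact: leq_add|].
Qed.

Lemma t_seq c d s K1 K2 Q :
  triple c s [::] K1 (fun s1 => agree (mods c) s s1 -> triple d s1 [::] K2 Q) ->
  triple (Seq c d) s [::] (K1 + K2) Q.
Proof. exact: t_seqw. Qed.

Lemma t_block l c s w K Q : triple c (foldl (fun s i => do_instr i s) s l) w K Q ->
  triple (block l c) s w (size l + K) Q.
Proof.
elim: l s => [|i l IHl] s //= h; rewrite /block -/block addSn -add1n -[w]cat0s.
by apply: t_seqw; apply: t_do => _; exact: IHl.
Qed.

Lemma t_blocks l s (Q : memory R -> Prop) :
  Q (foldl (fun s i => do_instr i s) s l) -> triple (block l Skip) s [::] (size l) Q.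
Proof. by move=> q; rewrite -[size l]addn0; apply: t_block; exact: t_skip. Qed.

Lemma t_if b c d s w K Q :
  (eval_test b s -> triple c s w K Q) -> (~~ eval_test b s -> triple d s w K Q) ->
  triple (If b c d) s w K.+1 Q.
Proof.
move=> hc hd; case E : (eval_test b s); [have := hc E|have := hd (negbT E)];
  by case=> s' [k [ex kK q]]; exists s', k.+1; split=> //; constructor; rewrite E.
Qed.

Lemma t_while_end b c s (Q : memory R -> Prop) :
  ~~ eval_test b s -> Q s -> triple (While b c) s [::] 1 Q.
Proof. by move=> nb q; exists s, 1%N; split=> //; constructor. Qed.

Lemma t_while_loop b c s w1 w2 K1 K2 Q : eval_test b s ->
  triple c s w1 K1 (fun s1 => agree (mods c) s s1 -> triple (While b c) s1 w2 K2 Q) ->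
  triple (While b c) s (w1 ++ w2) (K1 + K2).+1 Q.
Proof.
move=> eb [s1 [k1 [ex1 k1K h]]]; have [s2 [k2 [ex2 k2K q]]] := h (exec_mods ex1).
exists s2, (k1 + k2).+1; split=> //; last by rewrite ltnS leq_add.
by econstructor; eassumption.
Qed.

Lemma t_while b c s K M (inv : nat -> memory R -> Prop) :
  inv 0%N s ->
  (forall j sj, inv j sj -> agree (mods c) s sj ->
     eval_test b sj = (j < M)%N) ->
  (forall j sj, (j < M)%N -> inv j sj -> agree (mods c) s sj ->
     triple c sj [::] K (inv j.+1)) ->
  triple (While b c) s [::] (M * K.+1).+1 (inv M).
Proof.
move=> inv0 test step.
suff: forall d j sj, (j + d = M)%N -> inv j sj -> agree (mods c) s sj ->
    triple (While b c) sj [::] (d * K.+1).+1 (inv M).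
  by move=> h; apply: (h M 0%N) => //; exact: agree_refl.
elim=> [|d IHd] j sj jd ij aj.
  move: jd; rewrite addn0 => jM; subst j; apply: t_while_end => //.
  by rewrite (test M) // ltnn.
have jM : (j < M)%N by lia.
apply: (@t_le _ _ [::] (K + (d * K.+1).+1).+1); last lia.
rewrite -[[::]]cat0s; apply: t_while_loop; first by rewrite (test j).
apply: t_conseq (step j sj jM ij aj) (leqnn _) _ => s' _ ij' aj'.
apply: (IHd j.+1) => //; first lia.
have := agree_trans aj aj'; apply: agree_sub => l; by rewrite mem_cat => /orP[].
Qed.

(** A round costs three steps beyond its body, one for the test and two for the increment. The body
    must establish the invariant for the memory after the increment, since that writes register 40
    and the counter. *)
Lemma t_forw x y c s (K : nat -> nat) (ws : nat -> seq bool)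
    (inv : nat -> memory R -> Prop) N :
  [&& x != y, x != 40%N, y != 40%N, (0, x)%N \notin mods c & (0, y)%N \notin mods c] ->
  nreg s y = N ->
  inv 0%N (set_nreg s x 0) ->
  (forall j sj, (j < N)%N -> nreg sj x = j -> agree (mods (For x y c)) s sj ->
     inv j sj -> triple c sj (ws j) (K j)
       (fun s' => inv j.+1 (set_nreg (set_nreg s' 40 1) x j.+1))) ->
  triple (For x y c) s (flatten [seq ws j | j <- iota 0 N])
    (\sum_(0 <= j < N) (K j + 3) + 2)
    (fun s' => inv N s' /\ nreg s' x = N).
Proof.
case/and5P=> xy x40 y40 xc yc yN inv0 step.
rewrite addnC -[flatten _]cat0s (_ : (2 + _ = 1 + (\sum_(0 <= j < N) (K j + 3)).+1)%N) //.
apply: t_seqw; apply: t_do => a0 /=.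
set s0 := set_nreg s x 0.
suff: forall d j sj, (j + d = N)%N -> inv j sj -> nreg sj x = j ->
    agree (mods (For x y c)) s sj ->
    triple (While (NLt x y) (Seq c (Seq (Do (NConst 40 1)) (Do (NAdd x x 40)))))
      sj (flatten [seq ws j | j <- iota j d]) (\sum_(j <= i < j + d) (K i + 3)).+1
      (fun s' => inv N s' /\ nreg s' x = N).
  apply=> //=; first by rewrite eqxx.
  by apply: agree_sub a0 => l; rewrite /= !inE => ->.
elim=> [|d IHd] j sj jd ij jx aj.
  move: jd; rewrite !addn0 big_geq // => jN; rewrite jN in ij jx; apply: t_while_end => //=.
  rewrite jx (agn aj) ?yN ?ltnn //=.
  by rewrite inE mem_cat !inE !xpair_eqE /= (eq_sym y x) (negPf xy) (negPf y40) (negPf yc).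
have yj : nreg sj y = N.
  rewrite (agn aj) ?yN //=.
  by rewrite inE mem_cat !inE !xpair_eqE /= (eq_sym y x) (negPf xy) (negPf y40) (negPf yc).
have jN : (j < N)%N by lia.
rewrite big_ltn; last lia.
apply: (@t_le _ _ _ ((K j + (1 + 1)) + (\sum_(j.+1 <= i < j.+1 + d) (K i + 3)).+1).+1);
  last by rewrite (_ : (j.+1 + d = j + d.+1)%N); lia.
rewrite [flatten _]/= -[ws j]cats0; apply: t_while_loop => /=.
  by rewrite jx yj.
apply: t_seqw.
apply: t_conseq (step j sj jN jx aj ij) (leqnn _) _ => s' a' inv' _.
have x' : nreg s' x = j by rewrite (agn a').
apply: t_seq; apply: t_do => _; apply: t_do => a''.
have E : do_instr (NAdd x x 40) (do_instr (NConst 40 1) s') =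
    set_nreg (set_nreg s' 40 1) x j.+1.
  by congr (set_nreg _ _ _); rewrite /= (negPf x40) x' addn1.
rewrite E in a'' *; apply: IHd => //; [lia|by rewrite /= eqxx|].
have E2 : mods (For x y c) =
    (0, x)%N :: mods (Seq c (Seq (Do (NConst 40 1)) (Do (NAdd x x 40)))) by [].
have := agree_trans aj a''; apply: agree_sub => l.
by rewrite E2 mem_cat !in_cons => /orP[//|->]; rewrite orbT.
Qed.

Lemma t_for x y c s (K : nat -> nat) (inv : nat -> memory R -> Prop) N :
  [&& x != y, x != 40%N, y != 40%N, (0, x)%N \notin mods c & (0, y)%N \notin mods c] ->
  nreg s y = N ->
  inv 0%N (set_nreg s x 0) ->
  (forall j sj, (j < N)%N -> nreg sj x = j -> agree (mods (For x y c)) s sj ->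
     inv j sj -> triple c sj [::] (K j)
       (fun s' => inv j.+1 (set_nreg (set_nreg s' 40 1) x j.+1))) ->
  triple (For x y c) s [::] (\sum_(0 <= j < N) (K j + 3) + 2) (inv N).
Proof.
move=> h1 h2 h3 h4; have := t_forw (ws := fun=> [::]) h1 h2 h3 h4.
have -> : flatten [seq [::] | _ <- iota 0 N] = [::] :> seq bool.
  by elim: (iota 0 N).
by move=> t; apply: t_conseq t (leqnn _) _ => s' _ [].
Qed.

Lemma t_forc x y c s K (inv : nat -> memory R -> Prop) N :
  [&& x != y, x != 40%N, y != 40%N, (0, x)%N \notin mods c & (0, y)%N \notin mods c] ->
  nreg s y = N ->
  inv 0%N (set_nreg s x 0) ->
  (forall j sj, (j < N)%N -> nreg sj x = j -> agree (mods (For x y c)) s sj ->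
     inv j sj -> triple c sj [::] K
       (fun s' => inv j.+1 (set_nreg (set_nreg s' 40 1) x j.+1))) ->
  triple (For x y c) s [::] (N * (K + 3) + 2) (inv N).
Proof.
move=> h1 h2 h3 h4; have := t_for (K := fun=> K) h1 h2 h3 h4.
by rewrite sum_nat_const_nat subn0.
Qed.

(* Register 20 is the loop counter. *)
Definition Mul (z x y : nat) : cmd :=
  block [:: NConst z 0] (For 20 y (block [:: NAdd z z x] Skip)).

Lemma t_mul z x y s : [&& z != x, z != y, z != 20%N, y != 20%N, x != 20%N, z != 40%N,
    y != 40%N & x != 40%N] ->
  triple (Mul z x y) s [::] (nreg s y * 4 + 3)
    (fun s' => nreg s' z = (nreg s x * nreg s y)%N).
Proof.
move=> /and5P[zx zy z20 y20 /and4P[x20 z40 y40 x40]].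
apply: (t_le (K := (1 + (nreg s y * (1 + 3) + 2))%N)); last lia.
apply: (@t_block [:: NConst z 0]) => /=.
apply: (t_forc (inv := fun j s' => nreg s' z = (nreg s x * j)%N)) => //=.
- rewrite eq_sym y20 y40 !inE !xpair_eqE /= !(eq_sym _ z) z20 zy //.
- by rewrite eq_sym (negPf zy).
- by rewrite (negPf z20) eqxx muln0.
- move=> j sj jN _ aj ij; apply: t_blocks => /=.
  rewrite (negPf z20) (negPf z40) eqxx ij (agn aj) /=.
    by rewrite eq_sym (negPf zx) mulnS addnC.
  by rewrite /mods /= !inE !xpair_eqE /= (eq_sym x z) (negPf zx) (negPf x20) (negPf x40).
Qed.

End Triples.

Arguments agn {R l s s'} _ x%_N _.
Arguments aga {R l s s'} _ x%_N _.
Arguments agr {R l s s'} _ x%_N _.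
Arguments agv {R l s s'} _ x%_N _.

(** * Sparse matrices in memory

   n_1 dimension, n_2 number of stored matrix entries (N_2, N_3, R_2),
   n_3 size of the support (N_6), n_4 and n_5 number and total length of the
   stored update vectors (offsets N_5, entries N_4, R_4), n_6 [lg], n_7 [Ei],
   n_8 number of power iterations, n_9 number of starting vectors in use (R_5,
   of n_10 vectors), n_11 quota of recomputations per halving of the trace,
   n_12 credit, n_13 number of halvings, n_14 threshold for the deterministic
   mode; r_0 accuracy, r_1 output value, r_2 trace, r_3 trace at the last
   checkpoint, r_4 halved initial trace, r_5 value at the last recomputation;
   R_1 output vector, R_7 and R_8 work vectors.  Registers from n_20 and r_10 on
   and r_6 are temporary. *)

(* R_d[i] := r_10 for i in the support, where [l] computes r_10 from i = n_30. *)
Definition SuppMap (d : nat) (l : seq instr) : cmd :=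
  For 20 3 (block (NLoad 30 6 20 :: l ++ [:: RStore d 30 10]) Skip).

(* r_z := r_z + r_10 over the support. *)
Definition SuppSum (z : nat) (l : seq instr) : cmd :=
  For 20 3 (block (NLoad 30 6 20 :: l ++ [:: RAdd z z 10]) Skip).

(* R_8 := A R_7 for the matrix A stored in sparse form. *)
Definition MatVec : cmd :=
  Seq (SuppMap 8 [:: RSub 10 10 10])
  (Seq (For 20 2 (block [:: NLoad 30 2 20; NLoad 31 3 20; RLoad 10 2 20;
     RLoad 11 7 31; RMul 10 10 11; RLoad 11 8 30; RAdd 10 11 10; RStore 8 30 10] Skip))
  (For 20 4 (block [:: NLoad 32 5 20; NConst 33 1; NAdd 33 20 33; NLoad 33 5 33;
     NSub 33 33 32; RSub 12 12 12]
   (Seq (For 21 33 (block [:: NAdd 34 32 21; NLoad 30 4 34; RLoad 10 4 34;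
          RLoad 11 7 30; RMul 10 10 11; RAdd 12 12 10] Skip))
        (For 21 33 (block [:: NAdd 34 32 21; NLoad 30 4 34; RLoad 10 4 34;
          RMul 10 10 12; RLoad 11 8 30; RSub 11 11 10; RStore 8 30 11] Skip)))))).

Section Sparse.
Variables (R : realType) (n : nat) (S : seq nat).
Hypotheses (Suniq : uniq S) (Sltn : forall i, i \in S -> (i < n)%N).
Implicit Types s : memory R.

Definition geom s := [/\ nreg s 1 = n, nreg s 3 = size S
  & forall a, (a < size S)%N -> narr s 6 a = nth 0%N S a].

Lemma geom_agree l s s' : agree l s s' ->
  [&& (0, 1)%N \notin l, (0, 3)%N \notin l & (1, 6)%N \notin l] ->
  geom s -> geom s'.
Proof.
by move=> ag /and3P[h1 h2 h3] [g1 g2 g3]; split; rewrite ?(agn ag) // (aga ag).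
Qed.

(** Vectors live in dense arrays but are written on the support only, since clearing n cells would
    cost too much. Zeros everywhere else make sums over S equal to sums over all coordinates. *)
Definition isvec (f : nat -> R) (X : 'cV[R]_n) :=
  (forall i, i \notin S -> f i = 0) /\ (forall i : 'I_n, f i = X i 0).

Lemma isvec_inj f X Y : isvec f X -> isvec f Y -> X = Y.
Proof. by move=> [_ fX] [_ fY]; apply/colP => i; rewrite -fX -fY. Qed.

Lemma isvec0 : isvec (fun=> 0) 0.
Proof. by split=> // i; rewrite mxE. Qed.

Definition entry_mx (L : nat) (rows cols : nat -> nat) (vals : nat -> R) : 'M[R]_n :=
  \matrix_(i, j) \sum_(0 <= l < L) (if (rows l == i) && (cols l == j) then vals l else 0).

Definition entry_vec (a b : nat) (idx : nat -> nat) (vals : nat -> R) : 'cV[R]_n :=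
  \col_i \sum_(a <= l < b) (if idx l == i then vals l else 0).

(* The matrix in memory: the entries n_2, N_2, N_3, R_2, minus v v^T for each
   of the n_4 vectors v stored contiguously in N_4, R_4 with offsets N_5. *)
Definition mem_mx s : 'M[R]_n :=
  entry_mx (nreg s 2) (narr s 2) (narr s 3) (rarr s 2) -
  \sum_(0 <= v < nreg s 4)
     entry_vec (narr s 5 v) (narr s 5 v.+1) (narr s 4) (rarr s 4) *m
     (entry_vec (narr s 5 v) (narr s 5 v.+1) (narr s 4) (rarr s 4))^T.

Record repr s : Prop := Repr {
  repr_entry : forall l, (l < nreg s 2)%N -> narr s 2 l \in S /\ narr s 3 l \in S;
  repr_idx : forall l, (l < nreg s 5)%N -> narr s 4 l \in S;
  repr_off0 : narr s 5 0 = 0%N;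
  repr_off : forall v, (v < nreg s 4)%N -> (narr s 5 v <= narr s 5 v.+1)%N;
  repr_offn : narr s 5 (nreg s 4) = nreg s 5 }.

Definition repr_locs : seq loc := [:: (0, 2); (0, 4); (0, 5); (1, 2); (1, 3); (1, 4);
  (1, 5); (3, 2); (3, 4)]%N.

Lemma repr_agree l s s' : agree l s s' -> all (fun x => x \notin l) repr_locs ->
  repr s -> repr s' /\ mem_mx s' = mem_mx s.
Proof.
move=> ag /= /and5P[h1 h2 h3 h4 /and5P[h5 h6 h7 h8 /andP[h9 _]]] [r1 r2 r3 r4 r5].
by split; [split|rewrite /mem_mx]; rewrite ?(agn ag) ?(aga ag) ?(agv ag).
Qed.

Lemma repr_le_off s v : repr s -> (v <= nreg s 4)%N -> (narr s 5 v <= nreg s 5)%N.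
Proof.
move=> [_ _ _ r4 r5]; rewrite -r5; have [d] := ubnP (nreg s 4 - v).
elim: d v => // d IHd v; rewrite ltnS => vd; rewrite leq_eqVlt => /orP[/eqP -> //|vl].
by apply: leq_trans (r4 v vl) (IHd v.+1 _ vl); lia.
Qed.

(** As S has no repetition, each cell is rewritten once, so the code [l] may read the old content of
    the cell that it replaces. *)
Lemma t_suppmap d l s F : geom s ->
  all (fun i => instr_loc i \notin [:: (0, 3); (0, 20); (0, 40); (0, 30); (1, 6); (3, d)]%N) l ->
  (forall sj i, i \in S -> agree (mods (SuppMap d l)) s sj -> nreg sj 30 = i ->
     rarr sj d i = rarr s d i -> rreg (foldl (fun s i => do_instr i s) sj l) 10 = F i) ->
  triple (SuppMap d l) s [::] (size S * (size l + 5) + 2)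
    (fun s' => forall i, rarr s' d i = if i \in S then F i else rarr s d i).
Proof.
move=> [g1 g2 g3] hl lF.
have mE : mods (block (NLoad 30 6 20 :: l ++ [:: RStore d 30 10]) Skip) =
    (0, 30)%N :: map instr_loc l ++ [:: (3, d)%N].
  rewrite /block -/block /mods -/mods /=; congr (_ :: _).
  by elim: (l) => [|i l' IHl] //=; rewrite -IHl.
have notl x : x \in [:: (0, 3); (0, 20); (0, 40); (0, 30); (1, 6); (3, d)]%N ->
    x \notin map instr_loc l.
  move=> xin; elim: (l) hl => //= i l' IHl /andP[hi /IHl nl'].
  by rewrite inE negb_or nl' andbT; apply: contraNneq hi => <-.
have lag sj : agree (map instr_loc l) sj (foldl (fun s i => do_instr i s) sj l).
  elim: (l) sj => [|i l' IHl] sj; first exact: agree_refl.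
  exact: agree_trans (agree_instr i sj) (IHl _).
apply: (t_conseq (Q := fun s' => forall i, rarr s' d i =
    if i \in take (size S) S then F i else rarr s d i)
  (K := (size S * (size l + 5) + 2)%N)); last first.
- by move=> s' _ h i; rewrite h take_size.
- by [].
rewrite (_ : (size l + 5 = (size (NLoad 30 6 20 :: l ++ [:: RStore d 30 10])) + 3)%N);
  last by rewrite /= size_cat /=; lia.
apply: (t_forc (inv := fun a s' => forall i, rarr s' d i =
    if i \in take a S then F i else rarr s d i)) => //.
- by rewrite mE /= !inE !mem_cat !inE !xpair_eqE /= !negb_or !notl ?inE ?eqxx ?orbT.
- by move=> i; rewrite take0.
move=> j sj jS x20 aj ij; apply: t_blocks => i.
have nth_in : nth 0%N S j \in S by rewrite mem_nth.
have mEF : mods (For 20 3 (block (NLoad 30 6 20 :: l ++ [:: RStore d 30 10]) Skip)) =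
    (0, 20)%N :: ((0, 30)%N :: map instr_loc l ++ [:: (3, d)%N]) ++ [:: (0, 40); (0, 20)]%N.
  by rewrite -mE.
have n6 : narr sj 6 j = nth 0%N S j.
  rewrite (aga aj 6) ?g3 // mEF !(inE, mem_cat) (negPf (notl (1, 6)%N _)) //.
rewrite /= foldl_cat /= x20 n6; set s1 := set_nreg sj 30 _.
set s2 := foldl _ s1 l.
have n30 : nreg s2 30 = nth 0%N S j.
  by rewrite (agn (lag s1)) ?notl ?inE ?eqxx ?orbT //= eqxx.
have nin : nth 0%N S j \notin take j S.
  have := Suniq; rewrite -{1}(cat_take_drop j S) (drop_nth 0%N jS) cat_uniq /=.
  by case/and3P => _; rewrite negb_or => /andP[].
have a1 : agree (mods (SuppMap d l)) s s1.
  have h : agree [:: (0, 30)%N] sj s1 by exact: agree_instr (NConst 30 _) sj.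
  have := agree_trans aj h; rewrite /SuppMap mEF; apply: agree_sub => x.
  by rewrite mem_cat => /orP[//|]; rewrite inE => /eqP ->; rewrite !inE eqxx orbT.
have dj : rarr sj d (nth 0%N S j) = rarr s d (nth 0%N S j) by rewrite ij (negPf nin).
rewrite (lF s1 (nth 0%N S j)) //.
rewrite /= eqxx n30 (take_nth 0%N jS) mem_rcons inE.
have [->|ne] := eqVneq i (nth 0%N S j) => //=; rewrite ?eqxx ?(negPf ne) //=.
by rewrite (agv (lag s1)) ?notl ?inE ?eqxx ?orbT //= ij.
Qed.

Lemma big_nth_supp (F : nat -> R) : \sum_(0 <= a < size S) F (nth 0%N S a) =
  \sum_(i <- S) F i.
Proof. by rewrite [RHS](big_nth 0%N). Qed.

Lemma sum_supp (F : nat -> R) : (forall i, i \notin S -> F i = 0) ->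
  \sum_(i <- S) F i = \sum_(i < n) F i.
Proof.
move=> F0; rewrite -(big_mkord xpredT F).
rewrite [RHS](bigID (mem S)) /= [X in _ = _ + X]big1 ?addr0; last by move=> i /F0.
rewrite -[RHS]big_filter; apply: perm_big; apply: uniq_perm => //.
  by rewrite filter_uniq // iota_uniq.
move=> i; rewrite mem_filter mem_index_iota /=.
by case: (boolP (i \in S)) => // iS; rewrite Sltn.
Qed.

Lemma t_suppsum z l s F : geom s ->
  all (fun i => instr_loc i \notin [:: (0, 3); (0, 20); (0, 40); (0, 30); (1, 6); (2, z)]%N) l ->
  (forall sj i, i \in S -> agree (mods (SuppSum z l)) s sj -> nreg sj 30 = i ->
     rreg (foldl (fun s i => do_instr i s) sj l) 10 = F i) ->
  triple (SuppSum z l) s [::] (size S * (size l + 5) + 2)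
    (fun s' => rreg s' z = rreg s z + \sum_(i <- S) F i).
Proof.
move=> [g1 g2 g3] hl lF.
have mE : mods (block (NLoad 30 6 20 :: l ++ [:: RAdd z z 10]) Skip) =
    (0, 30)%N :: map instr_loc l ++ [:: (2, z)%N].
  rewrite /block -/block /mods -/mods /=; congr (_ :: _).
  by elim: (l) => [|i l' IHl] //=; rewrite -IHl.
have notl x : x \in [:: (0, 3); (0, 20); (0, 40); (0, 30); (1, 6); (2, z)]%N ->
    x \notin map instr_loc l.
  move=> xin; elim: (l) hl => //= i l' IHl /andP[hi /IHl nl'].
  by rewrite inE negb_or nl' andbT; apply: contraNneq hi => <-.
have lag sj : agree (map instr_loc l) sj (foldl (fun s i => do_instr i s) sj l).
  elim: (l) sj => [|i l' IHl] sj; first exact: agree_refl.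
  exact: agree_trans (agree_instr i sj) (IHl _).
rewrite -big_nth_supp.
rewrite (_ : (size l + 5 = (size (NLoad 30 6 20 :: l ++ [:: RAdd z z 10])) + 3)%N);
  last by rewrite /= size_cat /=; lia.
apply: (t_forc (inv := fun a s' => rreg s' z =
   rreg s z + \sum_(0 <= a < a) F (nth 0%N S a))) => //.
- by rewrite mE /= !inE !mem_cat !inE !xpair_eqE /= !negb_or !notl ?inE ?eqxx ?orbT.
- by rewrite /= big_nil addr0.
move=> j sj jS x20 aj ij; apply: t_blocks.
have nth_in : nth 0%N S j \in S by rewrite mem_nth.
have mEF : mods (For 20 3 (block (NLoad 30 6 20 :: l ++ [:: RAdd z z 10]) Skip)) =
    (0, 20)%N :: ((0, 30)%N :: map instr_loc l ++ [:: (2, z)%N]) ++ [:: (0, 40); (0, 20)]%N.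
  by rewrite -mE.
have n6 : narr sj 6 j = nth 0%N S j.
  rewrite (aga aj 6) ?g3 // mEF !(inE, mem_cat) (negPf (notl (1, 6)%N _)) //.
rewrite /= foldl_cat /= x20 n6; set s1 := set_nreg sj 30 _.
have a1 : agree (mods (SuppSum z l)) s s1.
  have h : agree [:: (0, 30)%N] sj s1 by exact: agree_instr (NConst 30 _) sj.
  have := agree_trans aj h; rewrite /SuppSum mEF; apply: agree_sub => x.
  by rewrite mem_cat => /orP[//|]; rewrite inE => /eqP ->; rewrite !inE eqxx orbT.
rewrite (lF s1 (nth 0%N S j)) //.
rewrite eqxx big_nat_recr //= (agr (lag s1)) ?notl ?inE ?eqxx ?orbT //= ij.
by rewrite addrA.
Qed.

Lemma entry_mx_mul L rows cols vals (X : 'cV[R]_n) f i : isvec f X ->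
  (entry_mx L rows cols vals *m X) i 0 =
  \sum_(0 <= l < L) (if rows l == i then vals l * f (cols l) else 0).
Proof.
move=> [f0 fX]; rewrite mxE; under eq_bigr do rewrite mxE mulr_suml.
rewrite exchange_big; apply: eq_big_nat => l _.
have [ri|ri] := boolP (rows l == i) => /=; last first.
  by rewrite big1 // => j _; rewrite mul0r.
have [cn|cn] := ltnP (cols l) n.
  rewrite (bigD1 (Ordinal cn)) //= eqxx -fX big1 ?addr0 // => j jc.
  rewrite ifN ?mul0r //; apply: contraNneq jc => E; exact/eqP/val_inj.
rewrite f0; last by apply/negP => /Sltn; rewrite ltnNge cn.
rewrite mulr0 big1 // => j _; case: eqP => [E|_]; rewrite ?mul0r //.
by have := ltn_ord j; rewrite -E ltnNge cn.
Qed.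

Lemma entry_vec_dot a b idx vals (X : 'cV[R]_n) f : isvec f X ->
  ((entry_vec a b idx vals)^T *m X) 0 0 = \sum_(a <= l < b) vals l * f (idx l).
Proof.
move=> [f0 fX]; rewrite mxE; under eq_bigr do rewrite !mxE mulr_suml.
rewrite exchange_big; apply: eq_big_nat => l _.
have [cn|cn] := ltnP (idx l) n.
  rewrite (bigD1 (Ordinal cn)) //= eqxx -fX big1 ?addr0 // => j jc.
  rewrite ifN ?mul0r //; apply: contraNneq jc => E; exact/eqP/val_inj.
rewrite f0; last by apply/negP => /Sltn; rewrite ltnNge cn.
rewrite mulr0 big1 // => j _; case: eqP => [E|_]; rewrite ?mul0r //.
by have := ltn_ord j; rewrite -E ltnNge cn.
Qed.

Definition mv_cost s := (45 * (size S + nreg s 2 + nreg s 4 + nreg s 5 + 1))%N.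

Let ent s (i : nat) := \sum_(0 <= l < nreg s 2)
  (if narr s 2 l == i then rarr s 2 l * rarr s 7 (narr s 3 l) else 0).
Let dt s v := \sum_(narr s 5 v <= l < narr s 5 v.+1) rarr s 4 l * rarr s 7 (narr s 4 l).
Let ev s v (i : nat) := \sum_(narr s 5 v <= l < narr s 5 v.+1)
  (if narr s 4 l == i then rarr s 4 l else 0).

(** The matrix is never assembled: each stored update v contributes - (v.X) v in two passes over its
    nonzero entries, so the cost is linear in the size of the stored data. *)
Lemma t_matvec s (X : 'cV[R]_n) Y : geom s -> repr s ->
  isvec (rarr s 7) X -> isvec (rarr s 8) Y ->
  triple MatVec s [::] (mv_cost s) (fun s' => isvec (rarr s' 8) (mem_mx s *m X)).
Proof.
move=> g rp vX vY; have [g1 g2 g3] := g; have [r1 r2 r3 r4 r5] := rp.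
have offle := @repr_le_off s ^~ rp.
have off0 i : i \notin S -> ent s i - \sum_(0 <= v < nreg s 4) dt s v * ev s v i = 0.
  move=> iS.
  rewrite /ent big_nat_cond big1 ?sub0r; last first.
    move=> l /andP[/andP[_ /r1[rl _]] _]; case: eqP => // E.
    by rewrite -E rl in iS.
  rewrite big_nat_cond big1 ?oppr0 // => v /andP[/andP[_ vV] _].
  rewrite /ev big_nat_cond big1 ?mulr0 // => l /andP[/andP[_ lv] _].
  case: eqP => // E; case/negP: iS; rewrite -E r2 //.
  by apply: leq_trans lv (offle _ vV).
apply: (t_conseq (Q := fun s' => forall i, rarr s' 8 i =
    if i \in S then ent s i - \sum_(0 <= v < nreg s 4) dt s v * ev s v i else 0)
  (K := ((size S * 6 + 2) + ((nreg s 2 * 11 + 2) +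
    (\sum_(0 <= v < nreg s 4) ((narr s 5 v.+1 - narr s 5 v) * 19 + 13) + 2)))%N)).
- apply: t_seq; apply: t_conseq (t_suppmap (F := fun=> 0) g _ _) _ _ => //.
    by move=> sj i iS aj _ _; rewrite /= subrr.
  move=> s1 a1 y1 _; apply: t_seq.
  have {}y1 i : rarr s1 8 i = 0.
    by rewrite y1; case: ifP => // /negbT; exact: (proj1 vY).
  apply: (t_conseq (Q := fun s' => forall i, rarr s' 8 i =
     \sum_(0 <= l < nreg s 2) (if narr s 2 l == i then
        rarr s 2 l * rarr s 7 (narr s 3 l) else 0)) (K := (nreg s 2 * (8 + 3) + 2)%N)) => //.
    apply: (t_forc (inv := fun k s' => forall i, rarr s' 8 i =
     \sum_(0 <= l < k) (if narr s 2 l == i then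
        rarr s 2 l * rarr s 7 (narr s 3 l) else 0))) => //.
    - by rewrite (agn a1).
    - by move=> i; rewrite big_nil /=.
    move=> j sj jL x20 aj ij; have a := agree_trans a1 aj; apply: t_blocks => i /=.
    rewrite x20 (aga a 2 isT) (aga a 3 isT) (agv a 2 isT) (agv a 7 isT).
    rewrite big_nat_recr //= -ij eq_sym.
    by case: eqP => [->|_]; rewrite ?addr0.
  move=> s2 a2 y2 _; have a12 := agree_trans a1 a2.
  apply: (t_conseq (Q := fun s' => forall i, rarr s' 8 i =
     ent s i - \sum_(0 <= v < nreg s 4) dt s v * ev s v i)
     (K := (\sum_(0 <= v < nreg s 4) ((narr s 5 v.+1 - narr s 5 v) * 19 + 10 + 3) + 2)%N)).
  + apply: (t_for (inv := fun k s' => forall i, rarr s' 8 i =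
       ent s i - \sum_(0 <= v < k) dt s v * ev s v i)) => //.
    - by rewrite (agn a12).
    - by move=> i; rewrite big_nil subr0 /= y2.
    move=> v sj vV x20 aj ij; have a := agree_trans a12 aj.
    set cnt := (narr s 5 v.+1 - narr s 5 v)%N.
    apply: (t_le (K := (6 + ((cnt * 9 + 2) + (cnt * 10 + 2)))%N)); last lia.
    apply: t_block; rewrite /= x20 addn1 (aga a 5 isT); set s3 := set_rreg _ 12 _.
    have c3 : agree [:: (0, 32); (0, 33); (2, 12)]%N sj s3.
      by split=> x; rewrite !inE !xpair_eqE /=; do ?case: (x == _) => //=.
    have a3 := agree_trans a c3.
    have n32 : nreg s3 32 = narr s 5 v by [].
    have n33 : nreg s3 33 = cnt by [].
    apply: t_seq.
    apply: (t_conseq (Q := fun s' => rreg s' 12 = dt s v) (K := (cnt * (6 + 3) + 2)%N)) => //.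
      rewrite /dt -{1}[narr s 5 v]add0n (_ : narr s 5 v.+1 = cnt + narr s 5 v)%N;
        last by rewrite subnK ?r4.
      rewrite big_addn addnK.
      apply: (t_forc (inv := fun k s' => rreg s' 12 = \sum_(0 <= i < k)
         rarr s 4 (i + narr s 5 v) * rarr s 7 (narr s 4 (i + narr s 5 v)))) => //.
      - by rewrite big_nil /= subrr.
      move=> j sk jc x21 ak ik; have b := agree_trans a3 ak; apply: t_blocks => /=.
      rewrite x21 (agn ak 32 isT) n32 big_nat_recr //= -ik addnC.
      by rewrite (aga b 4 isT) (agv b 4 isT) (agv b 7 isT).
    move=> s4 a4 d4 _; have b4 := agree_trans a3 a4.
    apply: (t_conseq (Q := fun s' => forall i, rarr s' 8 i =
       rarr sj 8 i - dt s v * ev s v i) (K := (cnt * (7 + 3) + 2)%N)) => //.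
      have -> : ev s v = (fun i => \sum_(0 <= l < cnt)
         (if narr s 4 (l + narr s 5 v) == i then rarr s 4 (l + narr s 5 v) else 0)).
        apply/funext => i; rewrite /ev -{1}[narr s 5 v]add0n.
        rewrite (_ : narr s 5 v.+1 = cnt + narr s 5 v)%N; last by rewrite subnK ?r4.
        by rewrite big_addn addnK.
      apply: (t_forc (inv := fun k s' => forall i, rarr s' 8 i = rarr sj 8 i - dt s v *
         \sum_(0 <= l < k)
         (if narr s 4 (l + narr s 5 v) == i then rarr s 4 (l + narr s 5 v) else 0))) => //.
      - by rewrite (agn a4).
      - by move=> i; rewrite big_nil mulr0 subr0 /= (agv a4) // (agv c3).
      move=> j sk jc x21 ak ik; have b := agree_trans b4 ak; apply: t_blocks => i /=.
      rewrite x21 (agn ak 32 isT) (agn a4 32 isT) n32 big_nat_recr //= addnC mulrDr opprD addrA -ik.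
      rewrite (aga b 4 isT) (agv b 4 isT) (agr ak 12 isT) d4 eq_sym.
      by case: eqP => [->|_]; rewrite ?mulr0 ?subr0 // mulrC.
    move=> s5 a5 y5 i.
    by rewrite /= y5 ij big_nat_recr //= opprD addrA.
  + by rewrite leq_add2r leq_sum // => v _; lia.
  move=> s3 a3 y3 i; rewrite y3; case: ifP => // /negbT iS.
  by rewrite off0.
(* The offsets telescope, so the inner loops over all updates together run over the n_5 stored
   entries. *)
- have -> : (\sum_(0 <= v < nreg s 4) ((narr s 5 v.+1 - narr s 5 v) * 19 + 13) =
    nreg s 5 * 19 + nreg s 4 * 13)%N.
    rewrite big_split /= sum_nat_const_nat subn0 -big_distrl /=.
    congr (_ * _ + _)%N; rewrite telescope_sumn_in // ?r5 ?r3 ?subn0 //.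
  by rewrite /mv_cost; lia.
move=> s' _ y'; split=> i; first by rewrite y' => /negPf ->.
have -> : rarr s' 8 i = ent s i - \sum_(0 <= v < nreg s 4) dt s v * ev s v i.
  by rewrite y'; case: (boolP (nat_of_ord i \in S)) => // /off0 ->.
rewrite /mem_mx mulmxBl mxE (entry_mx_mul _ _ _ _ _ vX) mxE; congr (_ - _).
rewrite mulmx_suml summxE; apply: eq_bigr => v _.
by rewrite -mulmxA mxE big_ord1 (entry_vec_dot _ _ _ _ vX) mxE mulrC.
Qed.

End Sparse.

(** * Recomputation of the eigenvector *)

Definition PowerIter : cmd := For 22 8 (Seq MatVec (SuppMap 7 [:: RLoad 10 8 30])).

Definition TryStart : cmd :=
  Seq (SuppMap 7 [:: NAdd 36 35 30; RLoad 10 5 36])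
  (Seq PowerIter
  (block [:: RSub 13 13 13]
  (Seq (SuppSum 13 [:: RLoad 10 7 30; RMul 10 10 10])
  (Seq (If (RLt 6 13) (Seq (SuppMap 1 [:: RLoad 10 7 30])
                           (block [:: RSub 14 14 14; RAdd 6 13 14] Skip)) Skip)
       (Do (NAdd 35 35 1)))))).

Definition Recompute : cmd :=
  block [:: RSub 6 6 6; NConst 35 0]
  (Seq (For 23 9 TryStart)
  (block [:: RSqrt 6 6]
  (Seq (SuppMap 1 [:: RLoad 10 1 30; RDiv 10 10 6])
  (Seq (SuppMap 7 [:: RLoad 10 1 30])
  (Seq MatVec
  (block [:: RSub 1 1 1]
    (SuppSum 1 [:: RLoad 10 7 30; RLoad 11 8 30; RMul 10 10 11]))))))).

Section Recomputation.
Variables (R : realType) (n : nat) (S : seq nat).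
Hypotheses (Suniq : uniq S) (Sltn : forall i, i \in S -> (i < n)%N).
Implicit Types s : memory R.

Local Notation isvec := (@isvec R n S).
Local Notation repr := (@repr R S).
Local Notation geom := (@geom R n S).
Local Notation mem_mx := (@mem_mx R n).

Definition msize s := (size S + nreg s 2 + nreg s 4 + nreg s 5 + 1)%N.

Lemma isvec_map f g h X : isvec g X -> (forall i, i \notin S -> h i = 0) ->
  (forall i, f i = if i \in S then g i else h i) -> isvec f X.
Proof.
move=> [g0 gX] h0 fE; split=> i; first by move=> iS; rewrite fE (negPf iS) h0.
by rewrite fE -gX; case: ifP => // /negbT iS; rewrite h0 // g0.
Qed.

Lemma isvec_dot f g X Y : isvec f X -> isvec g Y ->
  \sum_(i <- S) f i * g i = dotv X Y.
Proof.
move=> [f0 fX] [g0 gY]; rewrite (sum_supp Suniq Sltn (F := fun i => f i * g i)).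
  by rewrite dotvE; apply: eq_bigr => i _; rewrite fX gY.
by move=> i iS; rewrite f0 ?mul0r.
Qed.

Lemma isvecZ a f X : isvec f X -> isvec (fun i => a * f i) (a *: X).
Proof.
move=> [f0 fX]; split=> i; first by move=> iS; rewrite f0 ?mulr0.
by rewrite mxE fX.
Qed.

Lemma t_power s X Y : geom s -> repr s -> isvec (rarr s 7) X -> isvec (rarr s 8) Y ->
  triple PowerIter s [::] (nreg s 8 * (51 * msize s + 5) + 2)
    (fun s' => isvec (rarr s' 7) (mem_mx s ^+ nreg s 8 *m X) /\
       exists Y', isvec (rarr s' 8) Y').
Proof.
move=> g rp vX vY.
rewrite (_ : (51 * msize s + 5 = (51 * msize s + 2) + 3)%N); last by rewrite -addnA.
apply: (t_forc (inv := fun j s' => isvec (rarr s' 7) (mem_mx s ^+ j *m X) /\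
       exists Y', isvec (rarr s' 8) Y')) => //.
  by split; [rewrite expr0 -idmxE mul1mx|exists Y].
move=> j sj jk _ aj [v7 [Y' v8]].
have gj : geom sj by apply: (geom_agree aj).
have [rj mj] := repr_agree n aj isT rp.
have cj : mv_cost S sj = (45 * msize s)%N.
  by rewrite /mv_cost /msize (agn aj 2 isT) (agn aj 4 isT) (agn aj 5 isT).
apply: (t_le (K := (45 * msize s + (size S * (1 + 5) + 2))%N)); last by rewrite /msize; lia.
apply: t_seq; rewrite -cj.
apply: t_conseq (t_matvec Suniq Sltn gj rj v7 v8) (leqnn _) _ => s1 a1 y1 _.
have g1 : geom s1 by apply: (geom_agree a1).
apply: t_conseq (t_suppmap Suniq (F := rarr s1 8) g1 _ _) _ _ => //.
  move=> sk i iS ak n30 _; by rewrite /= n30 (agv ak 8 isT).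
move=> s2 a2 y2; split.
  rewrite exprS -mulmxE -mulmxA; rewrite mj in y1; apply: (isvec_map y1 _ y2).
  by move=> i iS; rewrite (agv a1 7 isT) (proj1 v7).
by exists (mem_mx sj *m (mem_mx s ^+ j *m X)); rewrite /= (agv a2 8 isT).
Qed.

Definition starts s (U : nat -> 'cV[R]_n) N := forall i, (i < N)%N ->
  isvec (fun j => if j \in S then rarr s 5 (i * n + j)%N else 0) (U i).

Definition vectors s := (exists X, isvec (rarr s 7) X) /\ (exists Y, isvec (rarr s 8) Y).

(** r_6 is the largest squared length so far and R_1 the iterate attaining it, not yet normalized.
    The first alternative is the initial state, which persists if all iterates vanish. *)
Definition best_so_far s (z : nat -> 'cV[R]_n) i :=
  [/\ 0 <= rreg s 6,
      forall j, (j < i)%N -> dotv (z j) (z j) <= rreg s 6,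
      exists W, isvec (rarr s 1) W
    & rreg s 6 = 0 \/ exists j, [/\ (j < i)%N, rreg s 6 = dotv (z j) (z j)
        & isvec (rarr s 1) (z j)]].

Lemma t_trystart s U i (z := fun j => mem_mx s ^+ nreg s 8 *m U j) :
  geom s -> repr s -> vectors s -> nreg s 35 = (i * n)%N ->
  isvec (fun j => if j \in S then rarr s 5 (i * n + j)%N else 0) (U i) ->
  best_so_far s z i ->
  triple TryStart s [::] (nreg s 8 * (56 * msize s) + 25 * msize s)
   (fun s' => [/\ vectors s', nreg s' 35 = (i.+1 * n)%N & best_so_far s' z i.+1]).
Proof.
move=> g rp [[X vX] [Y vY]] n35 vU [b0 bj [W vW] bz].
apply: (t_le (K := ((size S * (2 + 5) + 2) + ((nreg s 8 * (51 * msize s + 5) + 2) +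
   (1 + ((size S * (2 + 5) + 2) + ((((size S * (1 + 5) + 2) + 2).+1) + 1)))))%N));
  last by rewrite /msize; lia.
apply: t_seq; apply: t_conseq (t_suppmap Suniq
    (F := fun j => rarr s 5 (i * n + j)%N) g _ _) (leqnn _) _ => //.
  by move=> sk j jS ak n30 _; rewrite /= (agn ak 35 isT) n30 n35 (agv ak 5 isT).
move=> s1 a1 y1 _.
have g1 : geom s1 by apply: (geom_agree a1).
have [r1 m1] := repr_agree n a1 isT rp.
have v1 : isvec (rarr s1 7) (U i).
  apply: (isvec_map vU _ (h := rarr s 7)); first by case: vX.
  by move=> j; rewrite y1; case: ifP.
have v1' : isvec (rarr s1 8) Y by rewrite (agv a1 8 isT).
apply: t_seq; apply: t_conseq (t_power g1 r1 v1 v1') _ _ => [|s2 a2 [v2 [Y' v2']] _].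
  by rewrite /msize (agn a1 8 isT) (agn a1 2 isT) (agn a1 4 isT) (agn a1 5 isT).
rewrite m1 (agn a1 8 isT) -/(z i) in v2.
have a12 := agree_trans a1 a2.
apply: t_block => /=; set s3 := set_rreg s2 13 _.
have a3 : agree [:: (2, 13)%N] s2 s3 by exact: agree_instr (RSub 13 13 13) s2.
have a13 := agree_trans a12 a3.
have g3 : geom s3 by apply: (geom_agree a13).
apply: t_seq; apply: t_conseq (t_suppsum Suniq (F := fun j => rarr s2 7 j * rarr s2 7 j) g3 _ _)
    (leqnn _) _ => //.
  by move=> sk j jS ak n30; rewrite /= n30 (agv ak 7 isT).
move=> s4 a4; rewrite (isvec_dot v2 v2) [rreg s3 13]/= subrr add0r => r13 _.
have a14 := agree_trans a13 a4.
have g4 : geom s4 by apply: (geom_agree a14).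
have v4 : isvec (rarr s4 7) (z i) by rewrite (agv a4 7 isT).
have r6 : rreg s4 6 = rreg s 6 by rewrite (agr a14 6 isT).
have v41 : rarr s4 1 = rarr s 1 by rewrite (agv a14 1 isT).
apply: t_seq; apply: (t_conseq (Q := fun s' => best_so_far s' z i.+1)
   (K := (((size S * (1 + 5) + 2) + 2).+1)%N)) => //.
  apply: t_if => /= [lt|nlt].
    apply: t_seq; apply: t_conseq (t_suppmap Suniq (F := rarr s4 7) g4 _ _) (leqnn _) _ => //.
      by move=> sk j jS ak n30 _; rewrite /= n30 (agv ak 7 isT).
    move=> s5 a5 y5 _; apply: t_blocks.
    have v5 : isvec (rarr s5 1) (z i).
      by apply: (isvec_map v4 _ y5) => j jS; rewrite v41 (proj1 vW).
    rewrite r6 r13 in lt.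
    rewrite /best_so_far /= subrr addr0 (agr a5 13 isT) r13; split.
    - exact: dotv_ge0.
    - move=> j; rewrite ltnS leq_eqVlt => /orP[/eqP -> //|ji].
      by apply: le_trans (bj j ji) (ltW lt).
    - by exists (z i).
    - by right; exists i.
  apply: t_le; first apply: t_skip; last by [].
  rewrite /best_so_far v41 r6; split=> //.
  - move=> j; rewrite ltnS leq_eqVlt => /orP[/eqP ->|/bj //].
    by rewrite -r13 -r6 leNgt.
  - by exists W.
  case: bz => [->|[j [ji e v]]]; [by left|right; exists j; split=> //].
  by rewrite ltnS ltnW.
move=> s5 a5 b5 _; apply: t_do; split=> //.
- split; [exists (z i)|exists Y']; rewrite /= ?(agv a5 7 isT) //.
  by rewrite (agv a5 8 isT) (agv a4 8 isT).
- have a15 := agree_trans a14 a5; rewrite /= (agn a15 35 isT) (agn a15 1 isT) n35.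
  by case: g => -> _ _; rewrite mulSn addnC.
Qed.

Definition rc_cost s := (nreg s 9 * (60 * (nreg s 8 + 1) * msize s) + 80 * msize s)%N.

(** If all iterates vanish, the division by zero returns the zero vector and the guarantee is void.
    The value in r_1 matches the returned vector in any case, so time and bookkeeping do not depend
    on good coins. *)
Lemma t_recompute s U (z := fun j => mem_mx s ^+ nreg s 8 *m U j) :
  geom s -> repr s -> vectors s -> (exists W, isvec (rarr s 1) W) ->
  starts s U (nreg s 9) -> psd (mem_mx s) ->
  triple Recompute s [::] (rc_cost s) (fun s' => vectors s' /\ exists w,
    [/\ isvec (rarr s' 1) w, rreg s' 1 = qform (mem_mx s) w
      & (exists2 j, (j < nreg s 9)%N & 0 < dotv (z j) (z j)) ->
        power_best (mem_mx s) (nreg s 8) U (nreg s 9) w]).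
Proof.
move=> g rp vv [W vW] st pA.
pose K1 := (nreg s 8 * (56 * msize s) + 25 * msize s)%N.
apply: (t_le (K := (2 + ((nreg s 9 * (K1 + 3) + 2) + (1 + ((size S * (2 + 5) + 2) +
  ((size S * (1 + 5) + 2) + (45 * msize s + (1 + (size S * (3 + 5) + 2))))))))%N)).
  apply: t_block => /=; set s0 := set_nreg _ 35 _.
  have a0 : agree [:: (2, 6); (0, 35)]%N s s0.
    by split=> x; rewrite !inE !xpair_eqE /=; do ?case: (x == _) => //=.
  have g0 : geom s0 by apply: (geom_agree a0).
  apply: t_seq; apply: (t_conseq (K := (nreg s 9 * (K1 + 3) + 2)%N)
    (Q := fun s' => vectors s' /\ best_so_far s' z (nreg s 9))) => //.
    apply: (t_conseq (K := (nreg s 9 * (K1 + 3) + 2)%N) (Q := fun s' => [/\ vectors s',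
      nreg s' 35 = (nreg s 9 * n)%N & best_so_far s' z (nreg s 9)])) => //; last by move=> s' _ [].
    apply: (t_forc (inv := fun i s' => [/\ vectors s', nreg s' 35 = (i * n)%N
      & best_so_far s' z i])) => //.
      split=> //; split; rewrite /= ?subrr //; first by exists W.
      by left.
    move=> i sj iN _ aj [vj n35 bj]; have a0j := agree_trans a0 aj.
    have gj : geom sj by apply: (geom_agree aj).
    have [rj mj] := repr_agree n a0j isT rp.
    have k8 : nreg sj 8 = nreg s 8 by rewrite (agn a0j 8 isT).
    have zj : (fun j => mem_mx sj ^+ nreg sj 8 *m U j) = z by rewrite mj k8.
    have vU : isvec (fun j => if j \in S then rarr sj 5 (i * n + j)%N else 0) (U i).
      by rewrite (agv a0j 5 isT); apply: st.
    have := @t_trystart sj U i gj rj vj n35 vU; rewrite zj => /(_ bj).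
    rewrite k8 /msize (agn a0j 2 isT) (agn a0j 4 isT) (agn a0j 5 isT).
    by move/t_conseq; apply=> // s' _ [].
  move=> s1 a1 [[[X1 v17] [Y1 v18]] [b0 bj [W1 vW1] bz]] _.
  have a01 := agree_trans a0 a1.
  apply: t_block => /=; set s2 := set_rreg s1 6 _.
  have a2 : agree [:: (2, 6)]%N s1 s2 by exact: agree_instr (RSqrt 6 6) s1.
  have a02 := agree_trans a01 a2.
  have g2 : geom s2 by apply: (geom_agree a02).
  apply: t_seq; apply: t_conseq (t_suppmap Suniq
    (F := fun j => (Num.sqrt (rreg s1 6))^-1 * rarr s1 1 j) g2 _ _) (leqnn _) _ => //.
    by move=> sk j jS ak n30 dj; rewrite /= n30 dj (agr ak 6 isT) mulrC.
  move=> s3 a3 y3 _; have a03 := agree_trans a02 a3.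
  pose w := (Num.sqrt (rreg s1 6))^-1 *: W1.
  have vw : isvec (rarr s3 1) w.
    by apply: (isvec_map (isvecZ _ vW1) _ y3) => j jS; rewrite /= (proj1 vW1).
  have g3 : geom s3 by apply: (geom_agree a03).
  apply: t_seq; apply: t_conseq (t_suppmap Suniq (F := rarr s3 1) g3 _ _) (leqnn _) _ => //.
    by move=> sk j jS ak n30 _; rewrite /= n30 (agv ak 1 isT).
  move=> s4 a4 y4 _; have a04 := agree_trans a03 a4.
  have g4 : geom s4 by apply: (geom_agree a04).
  have [r4 m4] := repr_agree n a04 isT rp.
  have v47 : isvec (rarr s4 7) w.
    by apply: (isvec_map vw _ y4) => j jS; rewrite (agv a3 7 isT) /= (proj1 v17).
  have v48 : isvec (rarr s4 8) Y1 by rewrite (agv a4 8 isT) (agv a3 8 isT).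
  apply: t_seq; apply: t_conseq (t_matvec Suniq Sltn g4 r4 v47 v48) _ _ => [|s5 a5 v58 _].
    by rewrite /mv_cost /msize (agn a04 2 isT) (agn a04 4 isT) (agn a04 5 isT).
  have a05 := agree_trans a04 a5; rewrite m4 in v58.
  have v57 : isvec (rarr s5 7) w by rewrite (agv a5 7 isT).
  apply: t_block => /=; set s6 := set_rreg s5 1 _.
  have a6 : agree [:: (2, 1)]%N s5 s6 by exact: agree_instr (RSub 1 1 1) s5.
  have a06 := agree_trans a05 a6.
  have g6 : geom s6 by apply: (geom_agree a06).
  apply: t_conseq (t_suppsum Suniq (F := fun j => rarr s5 7 j * rarr s5 8 j) g6 _ _) (leqnn _) _ => //.
    by move=> sk j jS ak n30; rewrite /= n30 (agv ak 7 isT) (agv ak 8 isT).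
  move=> s7 a7; rewrite (isvec_dot v57 v58) [rreg s6 1]/= subrr add0r -qformE => r1.
  split; first by split; [exists w; rewrite (agv a7 7 isT)|exists (mem_mx s *m w);
    rewrite (agv a7 8 isT)].
  exists w; split=> //.
    by rewrite (agv a7 1 isT) /= (agv a5 1 isT) (agv a4 1 isT).
  case=> j jN zj0; have rpos : 0 < rreg s1 6 by apply: lt_le_trans zj0 (bj j jN).
  case: bz => [r0|[i [iN ri vi]]]; first by rewrite r0 ltxx in rpos.
  exists i; rewrite -dotv_powX // -/(z i) -ri; split=> //.
  - by move=> j' /bj; rewrite -dotv_powX.
  - by rewrite /w (isvec_inj vW1 vi).
rewrite /rc_cost /K1.
have : (0 < msize s)%N by rewrite /msize addn1.
have : (size S <= msize s)%N by rewrite /msize; lia.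
move: (msize s) (nreg s 9) (nreg s 8) (size S) => M N k m mM M0.
have : (N * (k * (56 * M) + 25 * M + 3) <= N * (60 * (k + 1) * M))%N.
  by rewrite leq_mul2l; apply/orP; right; nia.
move: (N * _)%N (N * _)%N => a b; lia.
Qed.

End Recomputation.

(* The columns A e_b of the stored matrix are written out one by one. *)
Definition DenseCol : cmd :=
  block [:: NLoad 37 6 23]
  (Seq (SuppMap 7 [:: RSub 10 10 10])
  (block [:: NConst 38 1; ROfNat 10 38; RStore 7 37 10]
  (Seq MatVec
  (For 20 3 (block [:: NLoad 30 6 20; RLoad 10 8 30; NStore 7 36 30; NStore 8 36 37;
     RStore 9 36 10; NConst 38 1; NAdd 36 36 38] Skip))))).

Definition Densify : cmd :=
  block [:: NConst 36 0]
  (Seq (For 23 3 DenseCol)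
  (Seq (For 20 36 (block [:: NLoad 30 7 20; NStore 2 20 30; NLoad 30 8 20; NStore 3 20 30;
     RLoad 10 9 20; RStore 2 20 10] Skip))
  (block [:: NConst 38 0; NAdd 2 36 38; NConst 4 0; NConst 5 0] Skip))).

(* Appends the vector in N_0, R_0 to the list of updates, and maintains the
   trace r_2 and the value r_1 of the quadratic form at the output vector. *)
Definition Append : cmd :=
  block [:: RSub 12 12 12]
  (Seq (For 20 0 (block [:: NLoad 30 0 20; RLoad 10 0 20; NStore 4 5 30; RStore 4 5 10;
     NConst 38 1; NAdd 5 5 38; RLoad 11 1 30; RMul 11 11 10; RAdd 12 12 11;
     RMul 10 10 10; RSub 2 2 10] Skip))
  (block [:: NConst 38 1; NAdd 4 4 38; NStore 5 4 5; RMul 12 12 12; RSub 1 1 12] Skip)).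

(** * Replacing the list of updates by a dense matrix, and appending an update *)

Section Densification.
Variables (R : realType) (n : nat) (S : seq nat).
Hypotheses (Suniq : uniq S) (Sltn : forall i, i \in S -> (i < n)%N).
Implicit Types s : memory R.

Local Notation isvec := (@isvec R n S).
Local Notation repr := (@repr R S).
Local Notation geom := (@geom R n S).
Local Notation mem_mx := (@mem_mx R n).
Local Notation msize := (@msize R S).
Local Notation vectors := (@vectors R n S).

Lemma mem_mx_off s (i j : 'I_n) : repr s -> val j \notin S -> mem_mx s i j = 0.
Proof.
move=> rp jS; have [r1 r2 _ r4 _] := rp.
rewrite /mem_mx !mxE summxE big_nat_cond big1; last first.
  move=> l /andP[/andP[_ /r1[_ cS]] _]; case: (_ == _) => //=.
  by case: eqP => // E; case/negP: jS; rewrite -[val j]/(nat_of_ord j) -E.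
rewrite sub0r big_nat_cond big1 ?oppr0 // => v /andP[/andP[_ vV] _].
rewrite mxE big_ord1 !mxE [X in _ * X]big_nat_cond [X in _ * X]big1 ?mulr0 //.
move=> l /andP[/andP[_ lv] _]; case: eqP => // E; case/negP: jS; rewrite -[val j]/(nat_of_ord j) -E r2 //.
exact: leq_trans lv (repr_le_off Suniq rp vV).
Qed.

Lemma entry_mxS L rows cols vals (i j : 'I_n) :
  (@entry_mx R n L.+1 rows cols vals) i j =
  (@entry_mx R n L rows cols vals) i j +
  (if (rows L == i) && (cols L == j) then vals L else 0).
Proof. by rewrite !mxE big_nat_recr. Qed.

Lemma eq_entry_mx L rows cols vals rows' cols' vals' :
  (forall l, (l < L)%N -> [/\ rows' l = rows l, cols' l = cols l & vals' l = vals l]) ->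
  @entry_mx R n L rows' cols' vals' = entry_mx n L rows cols vals.
Proof.
move=> E; apply/matrixP => i j; rewrite !mxE; apply: eq_big_nat => l /andP[_ /E[]].
by move=> -> -> ->.
Qed.

Definition dense_upto s (A : 'M[R]_n) b :=
  [/\ nreg s 36 = (b * size S)%N,
      forall l, (l < b * size S)%N -> narr s 7 l \in S /\ narr s 8 l \in S
    & forall i j : 'I_n, (@entry_mx R n (b * size S)
        (narr s 7) (narr s 8) (rarr s 9)) i j = if val j \in take b S then A i j else 0].

Lemma take_nth_mem (b : nat) : (b < size S)%N -> nth 0%N S b \notin take b S.
Proof.
move=> bS; have := Suniq; rewrite -{1}(cat_take_drop b S) (drop_nth 0%N bS) cat_uniq /=.
by case/and3P => _; rewrite negb_or => /andP[].
Qed.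

Lemma t_densecol s b : geom s -> repr s -> vectors s -> (b < size S)%N ->
  nreg s 23 = b -> dense_upto s (mem_mx s) b ->
  triple DenseCol s [::] (62 * msize s)
    (fun s' => vectors s' /\ dense_upto s' (mem_mx s) b.+1).
Proof.
move=> g rp [[X vX] [Y vY]] bS n23 [n36 inS ent]; have [g1 g2 g3] := g.
set sb := nth 0%N S b; have sbS : sb \in S by rewrite mem_nth.
have sbn : (sb < n)%N by exact: Sltn.
pose J := Ordinal sbn.
apply: (t_le (K := (1 + ((size S * (1 + 5) + 2) + (3 + (45 * msize s +
   (size S * (7 + 3) + 2)))))%N)); last by rewrite /msize; lia.
apply: t_block; rewrite /= n23 g3 // -/sb; set s0 := set_nreg s 37 sb.
have a0 : agree [:: (0, 37)%N] s s0 by exact: agree_instr (NConst 37 sb) s.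
have g0 : geom s0 by apply: (geom_agree a0).
apply: t_seq; apply: t_conseq (t_suppmap Suniq (F := fun=> 0) g0 _ _) (leqnn _) _ => //.
  by move=> sj i iS aj _ _; rewrite /= subrr.
move=> s1 a1 y1 _; have a01 := agree_trans a0 a1.
apply: t_block; rewrite /= (agn a1 37 isT) /=; set s2 := set_rarr _ 7 _.
have a2 : agree [:: (0, 38); (2, 10); (3, 7)]%N s1 s2.
  by split=> x; rewrite !inE !xpair_eqE /=; do ?case: (x == _) => //=.
have a02 := agree_trans a01 a2.
have g' : geom s2 by apply: (geom_agree a02).
have [rp2 m2] := repr_agree n a02 isT rp.
have v27 : isvec (rarr s2 7) (delta_mx J 0).
  split=> [i iS|i] /=.
    rewrite y1 (negPf iS); case: eqP => [E|_]; first by rewrite E sbS in iS.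
    exact: (proj1 vX).
  rewrite !mxE eqxx andbT -val_eqE /=; case: eqP => //= _; rewrite y1.
  by case: ifP => // /negbT/(proj1 vX) ->.
have v28 : isvec (rarr s2 8) Y by rewrite (agv a02 8 isT).
apply: t_seq; apply: t_conseq (t_matvec Suniq Sltn g' rp2 v27 v28) _ _ => [|s3 a3 v38 _].
  by rewrite /mv_cost /msize (agn a02 2 isT) (agn a02 4 isT) (agn a02 5 isT).
rewrite m2 -colE in v38; have a03 := agree_trans a02 a3.
have g'3 : geom s3 by apply: (geom_agree a03).
apply: (t_conseq (K := (size S * (7 + 3) + 2)%N) (Q := fun s' =>
   [/\ nreg s' 36 = (b * size S + size S)%N,
      forall l, (l < b * size S + size S)%N -> narr s' 7 l \in S /\ narr s' 8 l \in S
    & forall i j : 'I_n, (@entry_mx R n (b * size S + size S)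
        (narr s' 7) (narr s' 8) (rarr s' 9)) i j = (if val j \in take b S then mem_mx s i j else 0)
        + (if (j == J) && (val i \in take (size S) S) then mem_mx s i j else 0)])) => //; last first.
  move=> s4 a4 [h1 h2 h3]; split.
    split; [exists (delta_mx J 0); rewrite (agv a4 7 isT) (agv a3 7 isT) //|].
    by exists (col J (mem_mx s)); rewrite (agv a4 8 isT).
  rewrite /dense_upto mulSn addnC; split=> // i j.
  rewrite h3 take_size (take_nth 0%N bS) mem_rcons inE -/sb -[j == J]val_eqE /=.
  have [jb|jb] := eqVneq (val j) sb => /=; last by rewrite addr0.
  rewrite jb (negPf (take_nth_mem bS)) add0r.
  case: ifP => // /negbT iS; have := v38.2 i; rewrite (v38.1 _ iS) mxE.
  by have -> : j = J by exact: val_inj.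
apply: (t_forc (inv := fun a s' =>
   [/\ nreg s' 36 = (b * size S + a)%N,
      forall l, (l < b * size S + a)%N -> narr s' 7 l \in S /\ narr s' 8 l \in S
    & forall i j : 'I_n, (@entry_mx R n (b * size S + a)
        (narr s' 7) (narr s' 8) (rarr s' 9)) i j = (if val j \in take b S then mem_mx s i j else 0)
        + (if (j == J) && (val i \in take a S) then mem_mx s i j else 0)])) => //.
- by case: g'3.
- rewrite addn0 /= (agn a03 36 isT) (aga a03 7 isT) (aga a03 8 isT) (agv a03 9 isT).
  by split=> // i j; rewrite ent take0 andbF addr0.
move=> a sj aS n20 aj [h1 h2 h3]; apply: t_blocks.
have a0j := agree_trans a03 aj.
rewrite /= n20 (aga a0j 6 isT) g3 // (agn aj 37 isT) (agn a3 37 isT) /=.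
rewrite (agn a1 37 isT) /= h1 addn1 addnS (agv aj 8 isT).
set sa := nth 0%N S a; have saS : sa \in S by rewrite mem_nth.
split=> //.
  move=> l; rewrite ltnS leq_eqVlt => /orP[/eqP ->|lb]; first by rewrite !eqxx.
  by rewrite !(ltn_eqF lb); exact: h2.
move=> i j; rewrite entry_mxS.
rewrite (@eq_entry_mx _ (narr sj 7) (narr sj 8) (rarr sj 9)); last first.
  by move=> l lb /=; rewrite !(ltn_eqF lb).
rewrite h3 /= !eqxx -addrA; congr (_ + _).
rewrite (take_nth 0%N aS) mem_rcons inE -/sa -val_eqE /= [sb == _]eq_sym.
have [ja|ja] := eqVneq (val j) sb => /=; last by rewrite andbF addr0.
rewrite andbT [sa == _]eq_sym; have [ia|ia] := eqVneq (val i) sa => /=; last by rewrite addr0.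
rewrite ia (negPf (take_nth_mem aS)) add0r -ia (v38.2 i) mxE.
by have -> : j = J by exact: val_inj.
Qed.

(** One matrix product per support element collapses the accumulated updates. From then on the
    stored matrix has |S|^2 entries, so an update in the deterministic mode costs a polynomial in n
    whatever the length of the history. *)
Lemma t_densify s : geom s -> repr s -> vectors s ->
  triple Densify s [::] (100 * (size S + 1) * msize s)
    (fun s' => [/\ vectors s', repr s', mem_mx s' = mem_mx s,
       nreg s' 2 = (size S * size S)%N & nreg s' 4 = 0%N /\ nreg s' 5 = 0%N]).
Proof.
move=> g rp vv; have [g1 g2 g3] := g.
apply: (t_le (K := (1 + ((size S * (62 * msize s + 3) + 2) +
   ((size S * size S * (6 + 3) + 2) + 4)))%N)).
  apply: t_block => /=; set s0 := set_nreg s 36 0.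
  have a0 : agree [:: (0, 36)%N] s s0 by exact: agree_instr (NConst 36 0) s.
  have g0 : geom s0 by apply: (geom_agree a0).
  apply: t_seq; apply: (t_conseq (K := (size S * (62 * msize s + 3) + 2)%N)
    (Q := fun s' => vectors s' /\ dense_upto s' (mem_mx s) (size S))) => //.
    apply: (t_forc (inv := fun b s' => vectors s' /\ dense_upto s' (mem_mx s) b)) => //.
      split=> //; split; rewrite ?mul0n //= => i j.
      by rewrite take0 mxE big_nil.
    move=> b sj bS n23 aj [vj dj]; have a0j := agree_trans a0 aj.
    have gj : geom sj by apply: (geom_agree a0j).
    have [rj mj] := repr_agree n a0j isT rp.
    rewrite -mj in dj *.
    apply: t_conseq (t_densecol gj rj vj bS n23 dj) _ _ => //.
    by rewrite /msize (agn a0j 2 isT) (agn a0j 4 isT) (agn a0j 5 isT).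
  move=> s1 a1 [v1 [n36 inS ent]] _; have a01 := agree_trans a0 a1.
  set M := (size S * size S)%N in n36 inS ent *.
  apply: t_seq; apply: (t_conseq (K := (M * (6 + 3) + 2)%N)
    (Q := fun s' => forall l, (l < M)%N -> [/\ narr s' 2 l = narr s1 7 l,
       narr s' 3 l = narr s1 8 l & rarr s' 2 l = rarr s1 9 l])) => //.
    apply: (t_forc (inv := fun j s' => forall l, (l < j)%N -> [/\ narr s' 2 l = narr s1 7 l,
       narr s' 3 l = narr s1 8 l & rarr s' 2 l = rarr s1 9 l])) => //.
    move=> j sj jM n20 aj ij; apply: t_blocks => l.
    rewrite /= n20 (aga aj 7 isT) (aga aj 8 isT) (agv aj 9 isT).
    rewrite ltnS leq_eqVlt => /orP[/eqP ->|lj]; first by rewrite !eqxx.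
    by rewrite !(ltn_eqF lj); exact: ij.
  move=> s2 a2 h2 _; have a02 := agree_trans a01 a2; apply: t_blocks.
  have n36' : nreg s2 36 = M by rewrite (agn a2 36 isT).
  rewrite /= addn0 n36'; split=> //.
  - case: v1 => -[X vX] [Y vY]; split; [exists X|exists Y];
      by rewrite /= ?(agv a2 7 isT) ?(agv a2 8 isT).
  - split; rewrite //= ?n36' ?addn0.
    + by move=> l lM; have [-> -> _] := h2 l lM; exact: inS.
    + by rewrite (aga a02 5 isT); case: rp.
    + by rewrite (aga a02 5 isT); case: rp.
  rewrite {1}/mem_mx /= big_nil subr0.
  rewrite (@eq_entry_mx _ (narr s1 7) (narr s1 8) (rarr s1 9)); last first.
    by move=> l lM; have [] := h2 l lM.
  apply/matrixP => i j; rewrite ent take_size; case: ifP => // /negbT jS.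
  by rewrite mem_mx_off.
rewrite /msize; nia.
Qed.

Lemma t_append s u w : geom s -> repr s -> vectors s -> isvec (rarr s 1) w ->
  (forall l, (l < nreg s 0)%N -> narr s 0 l \in S) ->
  @entry_vec R n 0 (nreg s 0) (narr s 0) (rarr s 0) = u ->
  \sum_(0 <= l < nreg s 0) rarr s 0 l ^+ 2 = dotv u u ->
  triple Append s [::] (14 * nreg s 0 + 8)
    (fun s' => [/\ repr s', mem_mx s' = mem_mx s - u *m u^T,
       rreg s' 2 = rreg s 2 - dotv u u, rreg s' 1 = rreg s 1 - dotv u w ^+ 2
     & nreg s' 4 = (nreg s 4).+1 /\ nreg s' 5 = (nreg s 5 + nreg s 0)%N]).
Proof.
move=> g rp vv vw inS uE u2; have [r1 r2 r3 r4 r5] := rp.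
set p := nreg s 0 in inS uE u2 *.
apply: (t_le (K := (1 + ((p * (11 + 3) + 2) + 5))%N)); last by lia.
apply: t_block => /=; set s0 := set_rreg s 12 _.
have a0 : agree [:: (2, 12)%N] s s0 by exact: agree_instr (RSub 12 12 12) s.
apply: t_seq; apply: (t_conseq (K := (p * (11 + 3) + 2)%N) (Q := fun s' =>
   [/\ nreg s' 5 = (nreg s 5 + p)%N,
     forall l, narr s' 4 l = if (nreg s 5 <= l < nreg s 5 + p)%N then narr s 0 (l - nreg s 5) else narr s 4 l,
     forall l, rarr s' 4 l = if (nreg s 5 <= l < nreg s 5 + p)%N then rarr s 0 (l - nreg s 5) else rarr s 4 l,
     rreg s' 12 = \sum_(0 <= l < p) rarr s 0 l * rarr s 1 (narr s 0 l)
   & rreg s' 2 = rreg s 2 - \sum_(0 <= l < p) rarr s 0 l ^+ 2])) => //.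
  apply: (t_forc (inv := fun q s' =>
   [/\ nreg s' 5 = (nreg s 5 + q)%N,
     forall l, narr s' 4 l = if (nreg s 5 <= l < nreg s 5 + q)%N then narr s 0 (l - nreg s 5) else narr s 4 l,
     forall l, rarr s' 4 l = if (nreg s 5 <= l < nreg s 5 + q)%N then rarr s 0 (l - nreg s 5) else rarr s 4 l,
     rreg s' 12 = \sum_(0 <= l < q) rarr s 0 l * rarr s 1 (narr s 0 l)
   & rreg s' 2 = rreg s 2 - \sum_(0 <= l < q) rarr s 0 l ^+ 2])) => //.
    rewrite /= addn0 !big_nil subrr subr0; split=> // l;
      by case: (leqP (nreg s 5) l) => //= h; rewrite ltnNge h.
  move=> q sj qp n20 aj [h1 h2 h3 h4 h5]; have a0j := agree_trans a0 aj; apply: t_blocks.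
  rewrite /= n20 (aga a0j 0%N isT) (agv a0j 0%N isT) (agv a0j 1 isT) h1 addn1 addnS.
  rewrite h4 h5 !big_nat_recr //= opprD addrA [X in _ + X]mulrC expr2; split=> //.
  - move=> l; case: eqP => [->|/eqP ne]; first by rewrite leq_addr ltnSn /= addKn.
    by rewrite h2 ltnS [(l <= _)%N]leq_eqVlt (negPf ne).
  - move=> l; case: eqP => [->|/eqP ne]; first by rewrite leq_addr ltnSn /= addKn.
    by rewrite h3 ltnS [(l <= _)%N]leq_eqVlt (negPf ne).
move=> s1 a1 [h1 h2 h3 h4 h5] _; have a01 := agree_trans a0 a1; apply: t_blocks.
have n4 : nreg s1 4 = nreg s 4 by rewrite (agn a01 4 isT).
have n2 : nreg s1 2 = nreg s 2 by rewrite (agn a01 2 isT).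
have N5 : narr s1 5 = narr s 5 by rewrite (aga a01 5 isT).
have dE : rreg s1 12 = dotv u w.
  rewrite h4 -(entry_vec_dot Sltn 0 p (narr s 0) (rarr s 0) vw) uE //.
have offS v : (v <= nreg s 4)%N -> (v == (nreg s 4).+1) = false.
  by move=> h; rewrite ltn_eqF.
rewrite /= n4 addn1; split=> //.
- split=> /=; rewrite ?n4 ?n2 ?addn1.
  + by rewrite (aga a01 2 isT) (aga a01 3 isT).
  + move=> l; rewrite h1 h2 => lE; case: ifP => [/andP[le _]|/negbT].
      by apply: inS; rewrite ltn_subLR.
    by rewrite lE andbT -ltnNge => /r2.
  + by rewrite N5.
  + move=> v; rewrite ltnS => vV; rewrite [v == _]offS // eqSS N5.
    case: eqP => [->|/eqP ne]; first by rewrite h1 r5 leq_addr.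
    by apply: r4; rewrite ltn_neqAle ne.
  + by rewrite eqxx.
- rewrite /mem_mx /= n2 (aga a01 2 isT) (aga a01 3 isT) (agv a01 2 isT).
  rewrite big_nat_recr //= opprD addrA; congr (_ - _ - _).
    apply: eq_big_nat => v /andP[_ vV]; rewrite [v == _]offS ?(ltnW vV) // eqSS (ltn_eqF vV) N5.
    have E : @entry_vec R n (narr s 5 v) (narr s 5 v.+1) (narr s1 4) (rarr s1 4) =
      entry_vec n (narr s 5 v) (narr s 5 v.+1) (narr s 4) (rarr s 4).
      apply/matrixP => i j; rewrite !mxE; apply: eq_big_nat => l /andP[_ lv].
      have lt : (l < nreg s 5)%N by apply: leq_trans lv (repr_le_off Suniq rp vV).
      by rewrite h2 h3 leqNgt lt.
    by rewrite E.
  rewrite [nreg s 4 == _]offS // eqxx N5 r5 h1.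
  have -> : @entry_vec R n (nreg s 5) (nreg s 5 + p) (narr s1 4) (rarr s1 4) = u.
    rewrite -uE; apply/matrixP => i j; rewrite !mxE.
    rewrite -{1}[nreg s 5]add0n [X in \sum_(_ <= _ < X) _]addnC big_addn addnK.
    apply: eq_big_nat => l /andP[_ lp].
    by rewrite h2 h3 leq_addl addnC ltn_add2l lp /= addKn.
  by [].
- by rewrite h5 u2.
- by rewrite (agr a01 1 isT) dE expr2.
Qed.

End Densification.

(** * Parameters *)

(* [lg] is the binary logarithm of the dimension and [Ei] the inverse of the
   accuracy, both rounded up. *)
Record params (R : realType) (n : nat) (eps : R) (lg Ei : nat) : Prop := Params {
  par_n : (1 < n)%N;
  par_eps : 0 < eps < 1;
  par_neps : 1 < n%:R * eps;
  par_lg : (0 < lg)%N /\ (n <= 2 ^ lg)%N;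
  par_lg2 : (2 ^ lg <= 2 * n)%N;
  par_E : 1 <= Ei%:R * eps;
  par_E2 : Ei.-1%:R * eps < 1 }.

Definition iters lg Ei : nat := (12 * (Ei * lg))%N.
(** As (8/9)^6 <= 1/2, all of 6 * 26 lg independent starts fail with probability at most 2^(-26 lg),
    against at most 2^(11 lg) checkpoints. *)
Definition nstarts lg : nat := (156 * lg)%N.
(** 2^15 lg^2 Ei, split into small factors because numerals are unary. [eta_tail] needs (72 lg)^2 <=
    (7/32) 2^15 lg^2, that is, 5184 <= 7168. *)
Definition inv_eta lg Ei : nat := (32 * (32 * (32 * (lg * (lg * Ei)))))%N.
(** As (1 - eta)^(1/eta) <= 1/2, this many recomputations lower the potential by the factor
    2^(2k+1), the effect of one halving of the trace on its (2k+1)-st power. *)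
Definition quota lg Ei : nat := ((2 * iters lg Ei).+1 * inv_eta lg Ei)%N.
(** At least n^6; by [det_bound] it pays for one deterministic update. *)
Definition det_threshold lg : nat := (2 ^ (6 * lg))%N.

(** (1 - x)^M (1 + x)^M <= 1, and Bernoulli's inequality makes the second factor at least 2. *)
Lemma pow_half (R : realType) (x : R) M : 0 <= x <= 1 -> 1 <= M%:R * x ->
  (1 - x) ^+ M <= 1 / 2.
Proof.
move=> /andP[x0 x1] Mx.
have bern : 1 + M%:R * x <= (1 + x) ^+ M.
  elim: M {Mx} => [|M IHM]; first by rewrite expr0 mul0r addr0.
  rewrite exprS -natr1; apply: (@le_trans _ _ ((1 + x) * (1 + M%:R * x))).
    have : 0 <= M%:R * x * x by rewrite !mulr_ge0.
    lra.
  by rewrite ler_wpM2l //; lra.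
have p0 : 0 <= (1 - x) ^+ M by rewrite exprn_ge0 //; lra.
have : (1 - x) ^+ M * (1 + x) ^+ M <= 1.
  by rewrite -exprMn exprn_ile1 //; nra.
have : (1 - x) ^+ M * 2 <= (1 - x) ^+ M * (1 + x) ^+ M.
  by rewrite ler_wpM2l //; lra.
lra.
Qed.

Section Constants.
Variables (R : realType) (n : nat) (eps : R) (lg Ei : nat).
Hypothesis par : params n eps lg Ei.

Let n1 := par_n par.
Let E1 := par_E par.

Lemma eps_gt0 : 0 < eps. Proof. by have /andP[] := par_eps par. Qed.
Lemma eps_lt1 : eps < 1. Proof. by have /andP[] := par_eps par. Qed.
Lemma lg_gt0 : (0 < lg)%N. Proof. by have [] := par_lg par. Qed.
Lemma n_le_lg : (n <= 2 ^ lg)%N. Proof. by have [] := par_lg par. Qed.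

Lemma Ei_gt0 : (0 < Ei)%N.
Proof. by case: (Ei) E1 => [|//]; rewrite mul0r ler10. Qed.

Lemma Ei_le : (Ei <= n)%N.
Proof.
have e0 := eps_gt0; have := par_E2 par; have := par_neps par => h1 h2.
have : Ei.-1%:R * eps < n%:R * eps by lra.
by rewrite ltr_pM2r // ltr_nat; have := Ei_gt0; case: (Ei).
Qed.

Lemma iters_gt0 : (0 < iters lg Ei)%N.
Proof. by rewrite /iters; have := Ei_gt0; have := lg_gt0; nia. Qed.

Lemma inv_eta_gt0 : (0 < inv_eta lg Ei)%N.
Proof. by rewrite /inv_eta !muln_gt0 Ei_gt0 lg_gt0. Qed.

(** The exponent is 8 Ei times 3 lg, and every 8 Ei factors halve the product, so 3 lg halvings beat
    2 n^2. One factor n covers the squared norm of a start, the other a start that catches only a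
    share 1/(2n) of the trace. *)
Lemma rayleigh_decay :
  (1 - eps / 8) ^+ (2 * iters lg Ei) * n%:R <= (2 * n%:R)^-1.
Proof.
have e0 := eps_gt0; have e1 := eps_lt1.
have -> : (2 * iters lg Ei = (8 * Ei) * (3 * lg))%N by rewrite /iters; lia.
have n0 : 0 < n%:R :> R by rewrite ltr0n (ltn_trans _ n1).
have h : (1 - eps / 8) ^+ (8 * Ei) <= 1 / 2.
  apply: pow_half; first by lra.
  by rewrite natrM; move: E1; nra.
rewrite exprM -[leRHS]mul1r ler_pdivlMr; last by lra.
have n2 : 0 < 2 * n%:R :> R by lra.
have hb : (1 - eps / 8) ^+ (8 * Ei) ^+ (3 * lg) <= (1 / 2) ^+ (3 * lg).
  by rewrite lerXn2r ?nnegrE ?exprn_ge0 //; lra.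
apply: (@le_trans _ _ ((1 / 2) ^+ (3 * lg) * n%:R * (2 * n%:R))).
  by rewrite (ler_wpM2r (ltW n2)) // (ler_wpM2r (ltW n0)).
rewrite expr_div_n expr1n mul1r -mulrA mulrC ler_pdivrMr ?exprn_gt0 // mul1r.
rewrite -!natrM -natrX ler_nat.
have -> : (2 ^ (3 * lg) = 2 ^ lg * (2 ^ lg * 2 ^ lg))%N by rewrite -!expnD; congr (_ ^ _)%N; lia.
have h2 : (2 <= 2 ^ lg)%N by rewrite -[X in (X <= _)%N](expn1 2) leq_exp2l ?lg_gt0.
have := n_le_lg; move: (2 ^ lg)%N h2 => p h2 h3.
apply: leq_mul => //; exact: leq_mul.
Qed.

Definition eta : R := (inv_eta lg Ei)%:R^-1.

Lemma eta_gt0 : 0 < eta.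
Proof. by rewrite invr_gt0 ltr0n inv_eta_gt0. Qed.

Lemma eta_le1 : eta <= 1.
Proof. by rewrite invf_le1 ?ltr0n ?inv_eta_gt0 // ler1n inv_eta_gt0. Qed.

(** In [signed_sum_upper] this gives exp(-36 lg) <= 2^(-36 lg), which beats 2^(22 lg) pairs of
    checkpoints times the starts and the n terms of a decomposition. *)
Definition tail : R := (72 * lg)%:R.

Lemma tail_gt0 : 0 < tail.
Proof. by rewrite ltr0n muln_gt0 lg_gt0. Qed.

Lemma eta_tail : eta * tail ^+ 2 <= eps * (7 / 32).
Proof.
rewrite mulrC ler_pdivrMr ?ltr0n ?inv_eta_gt0 // /tail /inv_eta !natrM.
have l0 : 0 < lg%:R :> R by rewrite ltr0n lg_gt0.
set l := lg%:R in l0 *; have := E1; set e := Ei%:R => h.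
rewrite (_ : eps * (7 / 32) * _ = (7 * 1024) * l ^+ 2 * (e * eps)); last by field.
apply: (@le_trans _ _ ((7 * 1024) * l ^+ 2)); last first.
  have l2 : 0 <= l ^+ 2 by exact: sqr_ge0.
  by rewrite -[leLHS]mulr1 ler_wpM2l //; lra.
rewrite exprMn ler_wpM2r ?sqr_ge0 //; lra.
Qed.

Lemma eta_pow M : (1 - eta) ^+ (inv_eta lg Ei * M) <= (1 / 2) ^+ M.
Proof.
have := eta_gt0; have := eta_le1 => h1 h0.
rewrite exprM lerXn2r ?nnegrE ?exprn_ge0 //; [lra|lra|].
apply: pow_half; first by lra.
by rewrite /eta mulfV // pnatr_eq0 -lt0n inv_eta_gt0.
Qed.

End Constants.

(** * Trajectories *)

Section Trajectory.
Variables (R : realType) (n T : nat) (eps : R) (lg Ei : nat).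
Variables (A0 : 'M[R]_n) (v : seq 'cV[R]_n) (U : nat -> 'cV[R]_n).
Hypothesis par : params n eps lg Ei.
Hypotheses (vT : size v = T) (psdA : forall t, (t <= T)%N -> psd (decr A0 v t)).

Local Notation A := (decr A0 v).
Local Notation k := (iters lg Ei).
Local Notation eta := (eta R lg Ei).
Local Notation tail := (tail R lg).

Let n1 := par_n par.
Let n0 : (0 < n)%N. Proof. exact: ltnW n1. Qed.
Let e0 := eps_gt0 par.
Let e1 := eps_lt1 par.
Let k0 := iters_gt0 par.

Lemma decrS t : (t < T)%N -> A t.+1 = A t - nth 0 v t *m (nth 0 v t)^T.
Proof. by rewrite -vT => tv; rewrite /decr (take_nth 0 tv) foldl_rcons. Qed.

Lemma decr0 : A 0 = A0.
Proof. by rewrite /decr take0. Qed.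

Lemma psd_decrB s t : (s <= t)%N -> (t <= T)%N -> psd (A s - A t).
Proof.
move=> /subnKC <-; elim: (t - s)%N => [|d IHd] h; first by rewrite addn0 subrr; exact: psd0.
rewrite addnS decrS; last by rewrite -addnS.
rewrite opprB addrCA addrC; apply: psdD; last exact: psd_outer.
by apply: IHd; apply: ltnW; rewrite -addnS.
Qed.

Definition trc t := \tr (A t).

Lemma trc_ge0 t : (t <= T)%N -> 0 <= trc t.
Proof. by move=> tT; exact/mxtrace_psd_ge0/psdA. Qed.

Lemma trc_mono s t : (s <= t)%N -> (t <= T)%N -> trc t <= trc s.
Proof.
move=> st tT; rewrite -subr_ge0 -[_ - _]/(\tr _ - \tr _) -linearB.
exact/mxtrace_psd_ge0/psd_decrB.
Qed.

Lemma trcS t : (t < T)%N -> trc t.+1 = trc t - dotv (nth 0 v t) (nth 0 v t).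
Proof. by move=> tT; rewrite /trc decrS // linearB /= mxtrace_outer. Qed.

(* The time of the last checkpoint; the trace is nearly constant between
   checkpoints. *)
Fixpoint ckpt t := if t is t'.+1 then
    if trc t < trc (ckpt t') - eps / (n%:R * 4) * trc (ckpt t') then t else ckpt t'
  else 0%N.

Lemma ckpt_le t : (ckpt t <= t)%N.
Proof. by elim: t => //= t IHt; case: ifP => // _; exact: leqW. Qed.

Lemma ckpt_near t : (t <= T)%N ->
  trc (ckpt t) - trc t <= eps / (n%:R * 4) * trc (ckpt t).
Proof.
have pos s : (s <= T)%N -> 0 <= eps / (n%:R * 4) * trc s.
  by move=> sT; rewrite mulr_ge0 ?divr_ge0 ?mulr_ge0 ?trc_ge0 // ltW.
case: t => [|t] tT /=; first by rewrite subrr pos.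
by case: ifP => [_|/negbT]; [rewrite subrr pos|rewrite -leNgt; lra].
Qed.

Definition checkpoint t := [/\ (t <= T)%N, ckpt t = t, 0 < trc t &
  trc 0 <= 2 ^+ det_threshold lg * trc t].

Definition good_starts :=
  (forall s, checkpoint s -> exists2 i, (i < nstarts lg)%N &
     \tr (A s ^+ (2 * k)) <= 2 * moment (A s) (U i) (2 * k)) /\
  (forall s t, checkpoint s -> checkpoint t -> (s <= t)%N ->
     forall i, (i < nstarts lg)%N ->
     qform (A s - A t) (A s ^+ k *m U i) <=
       tail ^+ 2 * \tr (A s ^+ (2 * k) *m (A s - A t))).

Hypothesis Un : forall i, dotv (U i) (U i) <= n%:R.

Lemma max_gt0 t : (t <= T)%N -> 0 < trc t -> 0 < max_qform (A t).
Proof.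
move=> tT t0; have := mxtrace_le_max (psdA tT); rewrite -/(trc t) => h.
by rewrite -(pmulr_rgt0 _ (_ : 0 < n%:R)) ?ltr0n //; apply: lt_le_trans h.
Qed.

(** The factor n is slack for good random starts. It admits unit vectors as well, so that the lemma
    covers both modes. *)
Lemma lower_good t N w j : (t <= T)%N -> 0 < trc t -> (j < N)%N ->
  \tr (A t ^+ (2 * k)) <= 2 * n%:R * moment (A t) (U j) (2 * k) ->
  power_best (A t) k U N w -> (1 - eps / 8) * max_qform (A t) <= qform (A t) w.
Proof.
move=> tT t0 jN h; have m0 := max_gt0 tT t0; have nR : 0 < n%:R :> R by rewrite ltr0n.
apply: (power_best_good (a := (2 * n%:R)^-1)) => //.
- exact: psdA.
- have := e1; lra.
- by rewrite invr_gt0; lra.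
- exact: rayleigh_decay.
exists j => //; rewrite mulrC ler_pdivrMr; last by lra.
rewrite mulrC; apply: le_trans h; exact: max_qformX_le (psdA tT).
Qed.

Lemma lower_pos t N j : (t <= T)%N -> 0 < trc t -> (j < N)%N ->
  \tr (A t ^+ (2 * k)) <= 2 * n%:R * moment (A t) (U j) (2 * k) ->
  exists2 j, (j < N)%N & 0 < dotv (A t ^+ k *m U j) (A t ^+ k *m U j).
Proof.
move=> tT t0 jN h; exists j => //; rewrite dotv_powX; last exact: psdA.
have m0 := max_gt0 tT t0; have nR : 0 < n%:R :> R by rewrite ltr0n.
have : 0 < 2 * n%:R * moment (A t) (U j) (2 * k).
  apply: lt_le_trans h; apply: lt_le_trans (max_qformX_le _ n0 (psdA tT)).
  exact: exprn_gt0.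
by rewrite pmulr_rgt0 //; lra.
Qed.

Lemma accurate_weaken t w : (t <= T)%N ->
  (1 - eps / 8) * max_qform (A t) <= qform (A t) w ->
  (1 - eps) * max_qform (A t) <= qform (A t) w.
Proof.
move=> tT; apply: le_trans; apply: ler_wpM2r; first exact: max_qform_ge0 (psdA tT).
have := e0; lra.
Qed.

Definition potential t := \tr (A t ^+ (2 * k).+1).

(* State of the algorithm after Rc recomputations, the last one at time s. *)
Definition tracking t w rho Rc := exists s,
  [/\ checkpoint s /\ (s <= ckpt t)%N, power_best (A s) k U (nstarts lg) w,
      rho = qform (A s) w, potential s <= (1 - eta) ^+ Rc * potential 0
    & (1 - eps / 2) * rho <= qform (A (ckpt t)) w].

Hypothesis good : good_starts.

Lemma good_lower s : checkpoint s -> exists2 i, (i < nstarts lg)%N &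
     \tr (A s ^+ (2 * k)) <= 2 * n%:R * moment (A s) (U i) (2 * k).
Proof.
move=> cs; have [i iN h] := good.1 s cs; exists i => //; apply: le_trans h _.
apply: ler_wpM2r; first by apply: moment_ge0; apply: psdA; case: cs.
by rewrite -[leLHS]mulr1 ler_wpM2l // ler1n.
Qed.

Lemma good_pos s : checkpoint s -> exists2 j, (j < nstarts lg)%N &
  0 < dotv (A s ^+ k *m U j) (A s ^+ k *m U j).
Proof.
move=> cs; have [i iN h] := good_lower cs; have [sT _ s0 _] := cs.
exact: lower_pos h.
Qed.

Lemma good_best s w : checkpoint s -> power_best (A s) k U (nstarts lg) w ->
  (1 - eps / 8) * max_qform (A s) <= qform (A s) w.
Proof.
move=> cs pb; have [i iN h] := good_lower cs; have [sT _ s0 _] := cs.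
exact: lower_good h pb.
Qed.

Lemma tracking0 w : checkpoint 0 -> power_best (A 0) k U (nstarts lg) w ->
  tracking 0 w (qform (A 0) w) 0.
Proof.
move=> c0 pb; exists 0%N; split=> //=; first by rewrite expr0 mul1r.
have [h0 _ _ _] := c0.
have : 0 <= qform (A 0) w by apply: psd_ge0; apply: psdA.
have := e0; nra.
Qed.

Lemma tracking_keep t w rho Rc : ckpt t.+1 = ckpt t -> tracking t w rho Rc ->
  tracking t.+1 w rho Rc.
Proof. by move=> E [s h]; exists s; rewrite E. Qed.

Lemma tracking_pass t w rho Rc : ckpt t.+1 = t.+1 ->
  (1 - eps / 2) * rho <= qform (A t.+1) w -> tracking t w rho Rc ->
  tracking t.+1 w rho Rc.
Proof.
move=> E h [s [[cs st] pb rE pE _]]; exists s; rewrite E; split=> //; split=> //.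
by apply: leq_trans st _; apply: leq_trans (ckpt_le t) _.
Qed.

Lemma tracking_decay t w rho Rc : checkpoint t.+1 ->
  qform (A t.+1) w < (1 - eps / 2) * rho -> tracking t w rho Rc ->
  potential t.+1 <= (1 - eta) ^+ Rc.+1 * potential 0.
Proof.
move=> ct h [s [[cs st] pb rE pE _]]; have [tT _ _ _] := ct; have [sT _ _ _] := cs.
have st1 : (s <= t.+1)%N by apply: leq_trans st _; apply: leq_trans (ckpt_le t) _.
have := eta_le1 par => eta1.
have gb := good_best cs pb.
apply: (@le_trans _ _ ((1 - eta) * potential s)).
  apply: (power_best_drop (c := tail ^+ 2) (U := U) (N := nstarts lg) (w := w) (eps := eps)) => //.
  - exact: psdA.
  - exact: psdA.
  - exact: psd_decrB.
  - by rewrite exprn_gt0 // (tail_gt0 par).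
  - exact/ltW/(eta_gt0 par).
  - exact: (eta_tail par).
  - exact: good.1.
  - by move=> i; exact: (good.2 s t.+1).
  - apply: le_trans gb; apply: ler_wpM2r; last by have := e1; lra.
    exact: max_qform_ge0 (psdA sT).
  - by rewrite -rE ltW.
by rewrite exprS -mulrA ler_wpM2l //; lra.
Qed.

Lemma tracking_restart t w w' rho Rc : checkpoint t.+1 ->
  qform (A t.+1) w < (1 - eps / 2) * rho -> tracking t w rho Rc ->
  power_best (A t.+1) k U (nstarts lg) w' ->
  tracking t.+1 w' (qform (A t.+1) w') Rc.+1.
Proof.
move=> ct h tr pb; have [tT E _ _] := ct; exists t.+1; rewrite E; split=> //.
  exact: tracking_decay h tr.
have : 0 <= qform (A t.+1) w' by apply: psd_ge0; apply: psdA.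
have := e0; nra.
Qed.

(** With Rc at the quota, the potential would be below (tr A_(t+1) / 2^lg)^(2k+1), although it is at
    least (tr A_(t+1) / n)^(2k+1). Hence a recomputation that is due always finds credit. *)
Lemma tracking_quota t w rho Rc J : checkpoint t.+1 ->
  qform (A t.+1) w < (1 - eps / 2) * rho -> tracking t w rho Rc ->
  trc 0 <= 2 ^+ J * trc t.+1 -> (Rc < quota lg Ei * (lg + J))%N.
Proof.
move=> ct h tr trJ; have := tracking_decay ct h tr.
have [tT _ t0 _] := ct; have pA := psdA tT.
set K := (2 * k).+1.
have p0 : potential 0 <= (2 ^+ J * trc t.+1) ^+ K.
  apply: le_trans (mxtraceX_ub _ n0 (psdA (leq0n T))) _.
  by rewrite lerXn2r ?nnegrE ?mulr_ge0 ?exprn_ge0 ?trc_ge0.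
have pt : (trc t.+1 / 2 ^+ lg) ^+ K <= potential t.+1.
  apply: le_trans (max_qformX_le _ n0 pA).
  rewrite lerXn2r ?nnegrE ?max_qform_ge0 ?divr_ge0 ?exprn_ge0 ?trc_ge0 //.
  rewrite ler_pdivrMr ?exprn_gt0 // mulrC; apply: le_trans (mxtrace_le_max pA) _.
  apply: ler_wpM2r; first exact: max_qform_ge0.
  by rewrite -natrX ler_nat; exact: (n_le_lg par).
rewrite ltnNge => hp; apply/negP => qR.
have h0 := eta_gt0 par; have h1 := eta_le1 par.
have dec : (1 - eta) ^+ Rc <= (1 / 2) ^+ (K * (lg + J)).
  apply: le_trans (eta_pow par _).
  have -> : (inv_eta lg Ei * (K * (lg + J)) = quota lg Ei * (lg + J))%N.
    by rewrite /quota -/K; lia.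
  by rewrite ler_wiXn2l //; lra.
have X0 : 0 < (2 ^+ J * trc t.+1) ^+ K by rewrite exprn_gt0 // mulr_gt0 ?exprn_gt0.
have : potential t.+1 < (1 / 2) ^+ (K * (lg + J)) * (2 ^+ J * trc t.+1) ^+ K.
  apply: le_lt_trans hp _; rewrite exprS -mulrA.
  (* The decay for the recomputation that is now due makes the inequality strict. *)
  apply: (@le_lt_trans _ _ ((1 - eta) * ((1 / 2) ^+ (K * (lg + J)) * (2 ^+ J * trc t.+1) ^+ K))).
    apply: ler_wpM2l; first lra.
    apply: ler_pM => //; first by rewrite exprn_ge0 //; lra.
    by apply: mxtrace_psd_ge0; apply: psdX; exact: psdA.
  have Y0 : 0 < (1 / 2) ^+ (K * (lg + J)) * (2 ^+ J * trc t.+1) ^+ K.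
    by rewrite mulr_gt0 // exprn_gt0 //; lra.
  by rewrite -[ltRHS]mul1r ltr_pM2r //; lra.
rewrite ltNge => /negP; apply; apply: le_trans pt.
rewrite mulnC exprM -exprMn.
rewrite (_ : (1 / 2) ^+ (lg + J) * (2 ^+ J * trc t.+1) = trc t.+1 / 2 ^+ lg) //.
rewrite exprD mulrA -[_ * _ * 2 ^+ J]mulrA -exprMn.
have -> : 1 / 2 * 2 = 1 :> R by lra.
by rewrite expr1n mulr1 mulrC expr_div_n expr1n mul1r.
Qed.

(** Relative to the maximum at the last recomputation, which dominates the current one, at most
    eps/8 is lost by the power method, eps/2 before a drop is noticed, and eps/4 since the last
    checkpoint: 7 eps/8 in total. *)
Lemma tracking_correct t w rho Rc : (t <= T)%N -> tracking t w rho Rc ->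
  dotv w w = 1 /\ (1 - eps) * max_qform (A t) <= qform (A t) w.
Proof.
move=> tT [s [[cs st] pb rE _ h]]; have [sT _ s0 _] := cs.
have w1 := power_best_unit (psdA sT) pb; split=> //.
have cT : (ckpt t <= T)%N by apply: leq_trans (ckpt_le t) tT.
have gb := good_best cs pb; rewrite -rE in gb.
have mono1 : max_qform (A t) <= max_qform (A s).
  by apply: max_qform_mono => //; [exact: psdA|apply: psd_decrB => //; apply: leq_trans (ckpt_le t)].
have mono2 : max_qform (A (ckpt t)) <= max_qform (A s).
  by apply: max_qform_mono => //; [exact: psdA|exact: psd_decrB].
have close : qform (A (ckpt t)) w - qform (A t) w <= eps / 4 * max_qform (A s).
  rewrite -qformB; apply: le_trans (qform_le_mxtrace w (psd_decrB (ckpt_le t) tT)) _.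
  rewrite w1 mulr1 linearB /= -/(trc _) -/(trc t); apply: le_trans (ckpt_near tT) _.
  have tr : trc (ckpt t) <= n%:R * max_qform (A s).
    by apply: le_trans (mxtrace_le_max (psdA cT)) _; rewrite ler_wpM2l.
  have nR : 0 < n%:R :> R by rewrite ltr0n.
  apply: (@le_trans _ _ (eps / (n%:R * 4) * (n%:R * max_qform (A s)))).
    by rewrite ler_wpM2l // divr_ge0 ?mulr_ge0 ?ltW.
  rewrite le_eqVlt; apply/orP; left; apply/eqP; field; lra.
have m0 : 0 <= max_qform (A s) by exact: max_qform_ge0 (psdA sT).
apply: (@le_trans _ _ ((1 - eps) * max_qform (A s))).
  by rewrite ler_wpM2l //; have := e1; lra.
set m := max_qform (A s) in gb m0 close *; set q := qform (A t) w in close *.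
have : (1 - eps / 2) * ((1 - eps / 8) * m) <= (1 - eps / 2) * rho.
  by rewrite ler_wpM2l //; have := e1; lra.
have : 0 <= eps ^+ 2 * m by rewrite mulr_ge0 ?sqr_ge0.
have : 0 <= eps * m by rewrite mulr_ge0 // ltW.
have := h; rewrite -[qform (A (ckpt t)) w](subrK q) => h' a b c.
have -> : (1 - eps) * m = m - eps * m by ring.
have : (1 - eps / 2) * ((1 - eps / 8) * m) = m - 5 / 8 * (eps * m) + 1 / 16 * (eps ^+ 2 * m) by field.
have : eps / 4 * m = 1 / 4 * (eps * m) by field.
lra.
Qed.

End Trajectory.

(** * One update *)

Definition Halve : cmd := While (RLt 2 4)
  (block [:: NConst 38 2; ROfNat 10 38; RDiv 4 4 10; NConst 38 1; NAdd 13 13 38;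
     NAdd 12 12 11] Skip).

Definition Refresh : cmd := block [:: NConst 38 1; NSub 12 12 38]
  (Seq Recompute (block [:: NConst 38 0; ROfNat 10 38; RAdd 5 1 10] Skip)).

(* A checkpoint is reached when the trace has dropped by the factor
   1 - eps / (4 n).  The credit bounds the running time for unlucky coins. *)
Definition RandomUpdate : cmd :=
  block [:: NConst 38 4; ROfNat 10 38; ROfNat 14 1; RMul 10 14 10; RDiv 10 0 10;
     RMul 10 10 3; RSub 10 3 10]
  (If (RLt 2 10)
    (block [:: NConst 38 0; ROfNat 10 38; RAdd 3 2 10; NConst 38 2; ROfNat 10 38;
       RDiv 10 0 10; RMul 10 10 5; RSub 10 5 10; NConst 39 0]
     (If (RLt 1 10) (If (NLt 39 12) Refresh Skip) Skip))
    Skip).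

(* The trace has been halved so often that the time bound allows a power
   iteration from all unit vectors of the support at every update. *)
Definition DetUpdate : cmd :=
  block [:: NConst 38 0; NAdd 9 10 38] (Seq Densify Recompute).

Definition Update : cmd :=
  Seq Append (block [:: RSub 10 10 10]
    (If (RLt 10 2) (Seq Halve (If (NLt 13 14) RandomUpdate DetUpdate)) Skip)).

Section Costs.
Variable R : realType.
Implicit Types s : memory R.

(** Unlike in [triple], Q sees the number of steps: the amortized bound compares it with the
    halvings and recomputations of the final state. *)
Definition yields c s w (Q : memory R -> nat -> Prop) :=
  exists s' k, exec c s w s' k /\ Q s' k.

Lemma y_triple c s w K Q (Q' : memory R -> nat -> Prop) : triple c s w K Q ->
  (forall s' k, (k <= K)%N -> agree (mods c) s s' -> Q s' -> Q' s' k) -> yields c s w Q'.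
Proof.
case=> s' [k [ex kK q]] QQ'; exists s', k; split=> //.
by apply: QQ' => //; exact: exec_mods ex.
Qed.

Lemma y_conseq c s w (Q Q' : memory R -> nat -> Prop) : yields c s w Q ->
  (forall s' k, agree (mods c) s s' -> Q s' k -> Q' s' k) -> yields c s w Q'.
Proof.
case=> s' [k [ex q]] QQ'; exists s', k; split=> //.
by apply: QQ' => //; exact: exec_mods ex.
Qed.

Lemma y_seq c d s w1 w2 (Q : memory R -> nat -> Prop) :
  yields c s w1 (fun s1 k1 => yields d s1 w2 (fun s2 k2 => Q s2 (k1 + k2)%N)) ->
  yields (Seq c d) s (w1 ++ w2) Q.
Proof.
case=> s1 [k1 [ex1 [s2 [k2 [ex2 q]]]]]; exists s2, (k1 + k2)%N; split=> //.
by econstructor; eassumption.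
Qed.

Lemma y_seq0 c d s (Q : memory R -> nat -> Prop) :
  yields c s [::] (fun s1 k1 => yields d s1 [::] (fun s2 k2 => Q s2 (k1 + k2)%N)) ->
  yields (Seq c d) s [::] Q.
Proof. exact: y_seq. Qed.

Lemma y_block l c s w (Q : memory R -> nat -> Prop) :
  yields c (foldl (fun s i => do_instr i s) s l) w (fun s' k => Q s' (size l + k)%N) ->
  yields (block l c) s w Q.
Proof.
elim: l s Q => [|i l IHl] s Q //= h; rewrite /block -/block -[w]cat0s.
apply: y_seq; exists (do_instr i s), 1%N; split; first by constructor.
by apply: IHl; apply: y_conseq h _ => s' k _; rewrite addSn add1n.
Qed.

Lemma agree_block l s :
  agree [seq instr_loc i | i <- l] s (foldl (fun s i => do_instr i s) s l).
Proof.
elim: l s => [|i l IHl] s; first exact: agree_refl.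
exact: (agree_trans (agree_instr i s) (IHl (do_instr i s))).
Qed.

Lemma y_if b c d s w (Q : memory R -> nat -> Prop) :
  (eval_test b s -> yields c s w (fun s' k => Q s' k.+1)) ->
  (~~ eval_test b s -> yields d s w (fun s' k => Q s' k.+1)) -> yields (If b c d) s w Q.
Proof.
move=> hc hd; case E : (eval_test b s); [have := hc E|have := hd (negbT E)];
  by case=> s' [k [ex q]]; exists s', k.+1; split=> //; constructor; rewrite E.
Qed.

Lemma y_skip s (Q : memory R -> nat -> Prop) : Q s 0%N -> yields Skip s [::] Q.
Proof. by move=> q; exists s, 0%N; split=> //; constructor. Qed.

Lemma agree_load m n s (M : 'M[R]_(m, n)) :
  agree [:: (0, 0); (1, 0); (1, 1); (3, 0)]%N s (load s M).
Proof. by split=> x; rewrite !inE !xpair_eqE /=; do ?case: (x == _) => //=. Qed.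

Lemma size_nz m n (M : 'M[R]_(m, n)) : size (nz_positions M) = nnz M.
Proof. by rewrite /nnz cardE /enum_mem -enumT /nz_positions; congr (size _). Qed.

Lemma load_nth m n s (M : 'M[R]_(m, n)) x0 l : (l < nnz M)%N ->
  let p := nth x0 (nz_positions M) l in
  [/\ narr (load s M) 0 l = val p.1, narr (load s M) 1 l = val p.2
    & rarr (load s M) 0 l = M p.1 p.2].
Proof. by rewrite -size_nz => lM; rewrite /= !(nth_map x0). Qed.

End Costs.

(** * Halvings of the trace bound *)

Section Halving.
Variables (R : realType) (tau : R).
Implicit Types s : memory R.

(** The loop stops as early as possible, so after a halving the trace is less than twice the bound.
    This later shows that no more halvings are counted than the trace has really undergone. *)
Lemma t_halve s : 0 < rreg s 2 -> 0 < rreg s 4 ->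
  exists d, triple Halve s [::] (d * 7).+1 (fun s' =>
    [/\ nreg s' 13 = (nreg s 13 + d)%N, nreg s' 12 = (nreg s 12 + nreg s 11 * d)%N,
        rreg s' 4 = rreg s 4 / 2 ^+ d, rreg s' 4 <= rreg s' 2
      & d = 0%N \/ rreg s 2 < 2 * rreg s' 4]).
Proof.
move=> t0 h0; set t := rreg s 2; set h := rreg s 4.
have ex : exists d, h / 2 ^+ d <= t.
  have [d hd] : exists d : nat, h / t < d%:R.
    by exists (Num.truncn (h / t)).+1; rewrite truncnS_gt.
  exists d; rewrite ler_pdivrMr ?exprn_gt0 // mulrC -ler_pdivrMr //.
  apply: (le_trans (ltW hd)); rewrite -natrX ler_nat; apply: ltnW; exact: ltn_expl.
pose d := ex_minn ex; exists d.
have [dP dmin] : h / 2 ^+ d <= t /\ forall j, (j < d)%N -> t < h / 2 ^+ j.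
  rewrite /d; case: ex_minnP => d' h1 h2; split=> // j jd; rewrite ltNge.
  by apply/negP => /h2; rewrite leqNgt jd.
apply: (t_conseq (Q := fun s' => [/\ nreg s' 13 = (nreg s 13 + d)%N,
    nreg s' 12 = (nreg s 12 + nreg s 11 * d)%N & rreg s' 4 = h / 2 ^+ d])
    (K := (d * 6.+1).+1)) => //.
  apply: (t_while (inv := fun j s' => [/\ nreg s' 13 = (nreg s 13 + j)%N,
    nreg s' 12 = (nreg s 12 + nreg s 11 * j)%N & rreg s' 4 = h / 2 ^+ j])).
  - by rewrite addn0 muln0 addn0 expr0 divr1.
  - move=> j sj [_ _ hj] aj; rewrite /= hj (agr aj 2 isT); apply/idP/idP => [lt|/dmin //].
    rewrite ltnNge; apply/negP => dj; move: lt; apply/negP; rewrite -leNgt.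
    apply: le_trans dP; rewrite ler_pM2l // lef_pV2 ?posrE ?exprn_gt0 //.
    by rewrite ler_weXn2l // ler1n.
  - move=> j sj jd [h1 h2 h3] aj; apply: t_blocks => /=.
    rewrite h1 h2 h3 (agn aj 11 isT) exprSr invfM mulrA.
    by split=> //; lia.
move=> s' a' [h1 h2 h3]; split=> //; first by rewrite h3 (agr a' 2 isT).
case E : d => [|j]; [by left|right].
have := dmin j; rewrite E => /(_ (ltnSn j)); rewrite h3 E exprS invfM -/t.
by rewrite (mulrCA 2 h) mulVKf ?pnatr_eq0.
Qed.

End Halving.

(** N is the input size so far, P that of the update, y the iterations per recomputation, dJ and dR
    the new halvings and recomputations. The product of size and count grows by enough to pay for
    each kind of step. *)
Lemma potential_arith (D M N P J dJ y Rc dR a b c x : nat) : (0 < N)%N -> (0 < P)%N ->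
  (c <= M * P + M * dJ + M * ((N + P) * (y * dR)) + x)%N ->
  (x + a <= D * (1 + (J + dJ)) + b)%N ->
  (c + ((D + M) * (N * (1 + J + y * Rc)) + a) <=
   (D + M) * ((N + P) * (1 + (J + dJ) + y * (Rc + dR))) + b)%N.
Proof.
move=> N0 P0 cle xle.
have key : (N * (1 + J + y * Rc) + P * (1 + (J + dJ)) + dJ + (N + P) * (y * dR) <=
  (N + P) * (1 + (J + dJ) + y * (Rc + dR)))%N by nia.
have keyD : (D * (N * (1 + J + y * Rc)) + D * (1 + (J + dJ)) <=
  D * ((N + P) * (1 + (J + dJ) + y * (Rc + dR))))%N.
  rewrite -mulnDr leq_mul2l; apply/orP; right; apply: leq_trans key.
  rewrite -!addnA leq_add2l; apply: leq_trans (leq_addr _ _).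
  by rewrite leq_pmull.
have keyE := leq_mul (leqnn M) key.
rewrite 2!mulnDl.
move: xle cle keyD keyE.
move: (N * (1 + J + y * Rc))%N => X1.
move: ((N + P) * (1 + (J + dJ) + y * (Rc + dR)))%N => X2 xle cle keyD.
rewrite !mulnDr; lia.
Qed.

(** * Invariant and amortized cost of one update *)

Section OneUpdate.
Variables (R : realType) (n T : nat) (eps : R) (lg Ei : nat).
Variables (A0 : 'M[R]_n) (v : seq 'cV[R]_n) (U : nat -> 'cV[R]_n) (S : seq nat).
Hypothesis par : params n eps lg Ei.
Hypotheses (vT : size v = T) (psdA : forall t, (t <= T)%N -> psd (decr A0 v t)).
Hypotheses (Suniq : uniq S) (Sltn : forall i, i \in S -> (i < n)%N).
Hypothesis vS : forall t (i : 'I_n), (t < T)%N -> nth 0 v t i 0 != 0 -> val i \in S.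
Hypothesis Snnz : (size S <= (nnz A0).+1)%N.
Hypothesis Un : forall i, dotv (U i) (U i) <= n%:R.
Implicit Types s : memory R.

Local Notation A := (decr A0 v).
Local Notation k := (iters lg Ei).
Local Notation r := (nstarts lg).
Local Notation isvec := (@isvec R n S).
Local Notation repr := (@repr R S).
Local Notation geom := (@geom R n S).
Local Notation mem_mx := (@mem_mx R n).
Local Notation msize := (@msize R S).
Local Notation vectors := (@vectors R n S).
Local Notation trc := (trc A0 v).
Local Notation ckpt := (ckpt eps A0 v).
Local Notation checkpoint := (checkpoint T eps lg A0 v).
Local Notation tracking := (tracking T eps lg Ei A0 v U).
Local Notation good_starts := (good_starts T eps lg Ei A0 v U).
Local Notation thr := (det_threshold lg).

Hypothesis det_lower : forall t, (t <= T)%N -> 0 < trc t ->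
  exists2 j, (j < r + size S)%N &
    \tr (A t ^+ (2 * k)) <= 2 * n%:R * moment (A t) (U j) (2 * k).

(** The successor counts the offset stored with every update; the 2 absorbs the support {0} of a
    zero matrix and keeps the size positive. *)
Definition insize t := (nnz A0 + \sum_(u <- take t v) (nnz u).+1 + 2)%N.

(** Only this part of the invariant is conditional on good starting vectors; the rest, and with it
    the running time, holds for all coins. *)
Definition semantics t s w Rc := good_starts ->
  [/\ dotv w w = 1, (1 - eps) * max_qform (A t) <= qform (A t) w
    & 0 < trc t -> (nreg s 13 < thr)%N -> tracking t w (rreg s 5) Rc].

Record consts s : Prop := Consts {
  c_geom : geom s;
  c_iters : nreg s 8 = k;
  c_hi : nreg s 10 = (r + size S)%N;
  c_quota : nreg s 11 = quota lg Ei;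
  c_thr : nreg s 14 = thr;
  c_eps : rreg s 0 = eps;
  c_starts : starts S s U (r + size S) }.

Definition const_locs : seq loc :=
  [:: (0, 1); (0, 3); (0, 8); (0, 10); (0, 11); (0, 14); (1, 6); (2, 0); (3, 5)]%N.

Lemma consts_agree l s s' : agree l s s' -> all (fun x => x \notin l) const_locs ->
  consts s -> consts s'.
Proof.
move=> ag /= /and5P[h1 h2 h3 h4 /and5P[h5 h6 h7 h8 /andP[h9 _]]] [g c1 c2 c3 c4 c5 c6].
split; rewrite ?(agn ag) ?(agr ag) //.
  by apply: (geom_agree ag) => //; rewrite h1 h2 h7.
by move=> i iN; rewrite (agv ag 5) //; exact: c6.
Qed.

Record core t s : Prop := Core {
  i_consts : consts s;
  i_repr : repr s;
  i_mx : mem_mx s = A t;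
  i_tr : rreg s 2 = trc t;
  i_h : rreg s 4 = trc 0 / 2 ^+ nreg s 13;
  i_hle : 0 < trc t -> rreg s 4 <= trc t;
  i_J : nreg s 13 = 0%N \/ exists t', [/\ (t' <= t)%N, 0 < trc t' & trc t' < 2 * rreg s 4] }.

Definition core_locs : seq loc := [:: (2, 2); (2, 4); (0, 13)]%N ++ const_locs ++ repr_locs.

Lemma core_agree l t s s' : agree l s s' -> all (fun x => x \notin l) core_locs ->
  core t s -> core t s'.
Proof.
move=> ag; rewrite /core_locs 2!all_cat => /and3P[/and4P[h1 h2 h3 _] hc hr].
case=> i1 i2 i3 i4 i5 i6 i7; have [r' m'] := repr_agree n ag hr i2.
by split; rewrite ?(agn ag) ?(agr ag) ?m' //; exact: (consts_agree ag).
Qed.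

(** Rc is a ghost counter of the recomputations in the random mode after the initialization.
    [i_credit] bounds it by the quota for the halvings so far, whatever the coins. *)
Record inv t s Rc : Prop := Inv {
  i_core : core t s;
  i_vec : vectors s;
  i_sem : exists w, [/\ isvec (rarr s 1) w, rreg s 1 = qform (A t) w
     & semantics t s w Rc];
  i_credit : (nreg s 12 + Rc = quota lg Ei * (lg + nreg s 13))%N;
  i_random : 0 < trc t -> (nreg s 13 < thr)%N ->
     nreg s 9 = r /\ rreg s 3 = trc (ckpt t);
  i_det : 0 < trc t -> (thr <= nreg s 13)%N ->
     [/\ nreg s 2 = (size S * size S)%N, nreg s 4 = 0%N & nreg s 5 = 0%N];
  i_size : (nreg s 13 < thr)%N -> (nreg s 2 + nreg s 4 + nreg s 5 <= insize t)%N }.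

Lemma nz_vec (u : 'cV[R]_n) (F : nat -> R -> R) : (forall i, F i 0 = 0) ->
  \sum_(p <- nz_positions u) F p.1 (u p.1 p.2) = \sum_(i < n) F i (u i 0).
Proof.
move=> F0; rewrite /nz_positions big_filter big_enum_cond /=.
transitivity (\sum_(p : 'I_n * 'I_1) F p.1 (u p.1 p.2)).
  rewrite big_mkcond /=; apply: eq_bigr => p _.
  by case: eqP => //= ->; rewrite F0.
rewrite -(pair_bigA _ (fun i j => F (nat_of_ord i) (u i j))) /=.
by apply: eq_bigr => i _; rewrite big_ord1.
Qed.

Lemma load_vec s (u : 'cV[R]_n) (F : nat -> R -> R) : (forall i, F i 0 = 0) ->
  \sum_(0 <= l < nreg (load s u) 0) F (narr (load s u) 0 l) (rarr (load s u) 0 l) =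
  \sum_(i < n) F i (u i 0).
Proof.
move=> F0; rewrite -nz_vec // (_ : nreg (load s u) 0 = size (nz_positions u)) //.
case E : (nz_positions u) => [|p0 ps]; first by rewrite !big_nil.
rewrite [RHS](big_nth p0) -E; apply: eq_big_nat => l /andP[_].
rewrite size_nz => lt.
by have [-> _ ->] := load_nth s p0 lt.
Qed.

Lemma t_append_load t s Rc : (t < T)%N -> inv t s Rc ->
  triple Append (load s (nth 0 v t)) [::] (14 * nnz (nth 0%R v t) + 8)
   (fun s' => [/\ repr s', mem_mx s' = A t.+1, rreg s' 2 = trc t.+1,
      forall w, isvec (rarr s 1) w -> rreg s 1 = qform (A t) w ->
         rreg s' 1 = qform (A t.+1) w
    & nreg s' 4 = (nreg s 4).+1 /\ nreg s' 5 = (nreg s 5 + nnz (nth 0%R v t))%N]).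
Proof.
move=> tT [[co rp mx tr _ _ _] vec [w [vw qE _]] _ _ _ _].
set u := nth 0 v t; have al := agree_load s u.
have gl : geom (load s u) by apply: (geom_agree al); case: co.
have [rl ml] := repr_agree n al isT rp.
have n0 : nreg (load s u) 0 = nnz u by exact: size_nz.
have [] := @t_append R n S Suniq Sltn (load s u) u w gl rl _ _ _ _ _.
- by case: vec => -[X vX] [Y vY]; split; [exists X|exists Y].
- by rewrite (agv al 1 isT).
- rewrite n0 => l lu.
  case E : (nz_positions u) => [|p0 ps]; first by rewrite -size_nz E in lu.
  have [-> _ _] := load_nth s p0 lu; apply: (vS tT).
  have : nth p0 (nz_positions u) l \in nz_positions u by rewrite mem_nth ?size_nz.
  by rewrite mem_filter ord1 => /andP[].
- apply/matrixP => i j; rewrite mxE ord1.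
  rewrite (@load_vec s u (fun a x => if a == i then x else 0)); last by move=> a; case: ifP.
  rewrite (bigD1 i) //= eqxx big1 ?addr0 // => a ai.
  by rewrite ifN //; apply: contraNneq ai => E; exact/eqP/val_inj.
- rewrite (@load_vec s u (fun a x => x ^+ 2)); last by move=> _; rewrite expr0n.
  by rewrite dotvE; apply: eq_bigr => i _; rewrite expr2.
move=> s' [c [ex cK [r' m' t' q' n']]]; exists s', c; split=> //; first by rewrite -n0.
split=> //.
- by rewrite m' ml mx (decrS A0 vT tT).
- by rewrite t' (agr al 2 isT) tr (trcS A0 vT tT).
- move=> w' vw' qw'; rewrite q' (agr al 1 isT) qw' (decrS A0 vT tT) // qformB qform_outer.
  by rewrite (isvec_inj vw vw').
- by rewrite (agn al 4 isT) (agn al 5 isT) n0 in n'.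
Qed.

Definition det_const : nat := (157 * (60 * (13 * 3)) + 240 + 1000)%N.

(** With p = 2^lg, which is at least n, Ei and lg, there are O(p) starts, O(p^2) iterations and
    O(p^2) stored entries, so the cost is O(p^5), hence O(p^6). *)
Lemma det_bound m : (m <= n)%N ->
  ((r + m) * (60 * (k + 1) * (m + m * m + 1)) + 80 * (m + m * m + 1) +
   100 * (m + 1) * (m + m * m + n + 2) <= det_const * thr)%N.
Proof.
move=> mn; rewrite /det_threshold /nstarts /iters.
have p2 : (2 <= 2 ^ lg)%N by rewrite -[X in (X <= _)%N](expn1 2) leq_exp2l ?(lg_gt0 par).
have lp : (lg <= 2 ^ lg)%N by apply: ltnW; exact: ltn_expl.
have np := n_le_lg par; have En := Ei_le par.
rewrite [(6 * lg)%N]mulnC expnM; set p := (2 ^ lg)%N in p2 lp np *.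
have mp := leq_trans mn np; have Ep := leq_trans En np.
have a1 : (156 * lg + m <= 157 * p)%N by lia.
have Elg : (Ei * lg <= p * p)%N by exact: leq_mul.
have pp : (2 * p <= p * p)%N by rewrite leq_mul2r p2 orbT.
have a2 : (12 * (Ei * lg) + 1 <= 13 * (p * p))%N by lia.
have mm : (m * m <= p * p)%N by exact: leq_mul.
have a3 : (m + m * m + 1 <= 3 * (p * p))%N by lia.
have a4 : (m + m * m + n + 2 <= 5 * (p * p))%N by lia.
have b1 := leq_mul a1 (leq_mul (leq_mul (leqnn 60) a2) a3).
have b3 : (100 * (m + 1) * (m + m * m + n + 2) <= 100 * (2 * p) * (5 * (p * p)))%N.
  by apply: leq_mul => //; lia.
rewrite (_ : (p ^ 6 = p * (p * p) * (p * (p * p)))%N); last by rewrite !expnS expn0; lia.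
have c1 : (p * (p * p) * (p * p) <= p * (p * p) * (p * (p * p)))%N.
  by rewrite leq_mul2l; apply/orP; right; rewrite leq_pmull //; lia.
have c2 : (p * (p * p) <= p * (p * p) * (p * (p * p)))%N.
  by rewrite leq_pmulr // !muln_gt0; lia.
have c3 : (p * p <= p * (p * p) * (p * (p * p)))%N.
  by apply: leq_trans c2; rewrite leq_pmull //; lia.
have e1 : (157 * p * (60 * (13 * (p * p)) * (3 * (p * p))) =
  157 * (60 * (13 * 3)) * (p * (p * p) * (p * p)))%N by lia.
have e3 : (100 * (2 * p) * (5 * (p * p)) = 1000 * (p * (p * p)))%N by lia.
rewrite e1 in b1; rewrite e3 in b3.
move: c1 c2 c3 b1 b3; move: (p * (p * p) * (p * (p * p)))%N => X.
move: (p * (p * p) * (p * p))%N => Y; move: (p * (p * p))%N => Z c1 c2 c3 b1 b3.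
have d1 := leq_mul (leqnn (157 * (60 * (13 * 3)))%N) c1.
have -> : (det_const * X = 157 * (60 * (13 * 3)) * X + 240 * X + 1000 * X)%N.
  by rewrite /det_const; lia.
move: (157 * (60 * (13 * 3)) * X)%N d1 b1 => W d1 b1; lia.
Qed.

(* Amortized bound on the number of steps up to time t, after J halvings of the
   trace and Rc recomputations. *)
Definition phi t J Rc : nat := ((det_const + 1000) * (insize t * (1 + J + r * k * Rc)) +
  (if (thr <= J)%N then 400 * n * insize t else 0))%N.

(** x is the deterministic work: beyond the threshold the growing term [det_const] (1 + J') pays for
    each update, and the conditional summand of [phi] pays once for densifying the whole history. *)
Lemma phi_step t J J' Rc Rc' c x : (t < T)%N -> (J <= J')%N -> (Rc <= Rc')%N ->
  (c <= 1000 * (nnz (nth 0%R v t) + 1) + 1000 * (J' - J) +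
     1000 * (insize t.+1 * (r * k * (Rc' - Rc))) + x)%N ->
  (x + (if (thr <= J)%N then 400 * n * insize t else 0) <=
     det_const * (1 + J') + (if (thr <= J')%N then 400 * n * insize t.+1 else 0))%N ->
  (c + phi t J Rc <= phi t.+1 J' Rc')%N.
Proof.
move=> tT JJ RR cle xle; rewrite /phi.
have nS : insize t.+1 = (insize t + (nnz (nth 0%R v t) + 1))%N.
  by rewrite /insize (take_nth 0) ?vT // -cats1 big_cat big_seq1 /=; lia.
have n0 : (0 < insize t)%N by rewrite /insize addn2.
rewrite nS in cle xle *; move: (insize t) n0 cle xle => N N0 cle xle.
set P := (nnz _ + 1)%N in cle xle *; have P0 : (0 < P)%N by rewrite /P addn1.
move: (if (thr <= J)%N then _ else _) (if (thr <= J')%N then _ else _) xle => a b xle.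
move: P P0 cle => P P0 cle; move: (r * k)%N cle => y cle.
have [dJ JE] : exists d, J' = (J + d)%N by exists (J' - J)%N; lia.
have [dR RE] : exists d, Rc' = (Rc + d)%N by exists (Rc' - Rc)%N; lia.
rewrite JE RE !addKn in cle xle *.
exact: potential_arith cle xle.
Qed.

Lemma S_le_n : (size S <= n)%N.
Proof.
have sub : {subset S <= iota 0 n} by move=> i /Sltn iS; rewrite mem_iota.
by have := uniq_leq_size Suniq sub; rewrite size_iota.
Qed.

Lemma msize_insize t s : (nreg s 2 + nreg s 4 + nreg s 5 <= insize t)%N ->
  (msize s <= 2 * insize t)%N.
Proof. by move=> h; rewrite /msize; move: h Snnz; rewrite /insize; lia. Qed.

Lemma insizeS t : (t < T)%N -> insize t.+1 = (insize t + (nnz (nth 0%R v t) + 1))%N.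
Proof.
by move=> tT; rewrite /insize (take_nth 0) ?vT // -cats1 big_cat big_seq1 /=; lia.
Qed.

(** At trace zero the maximum is zero as well, so any unit vector is accurate and the old one can be
    kept from then on. *)
Lemma semantics_zero t s w Rc : (t <= T)%N -> ~ 0 < trc t ->
  dotv w w = 1 -> semantics t s w Rc.
Proof.
move=> tT t0 w1 _; have pA := psdA tT; have n0 := ltnW (par_n par).
have tz : trc t = 0.
  by apply/eqP; rewrite eq_le (trc_ge0 psdA tT) andbT leNgt; apply/negP.
split=> //; have h := max_le_mxtrace n0 pA; rewrite -/(trc t) tz in h.
apply: (@le_trans _ _ 0); last exact: psd_ge0.
by apply: mulr_ge0_le0 => //; rewrite subr_ge0 ltW // (eps_lt1 par).
Qed.

(* The state after the halvings of the trace bound in the t-th update. *)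
Record ready t s Rc (w : 'cV[R]_n) : Prop := Ready {
  d_core : core t.+1 s;
  d_vec : vectors s;
  d_w : isvec (rarr s 1) w /\ rreg s 1 = qform (A t.+1) w;
  d_credit : (nreg s 12 + Rc = quota lg Ei * (lg + nreg s 13))%N;
  d_sem : (nreg s 13 < thr)%N -> good_starts -> tracking t w (rreg s 5) Rc;
  d_random : (nreg s 13 < thr)%N -> nreg s 9 = r /\ rreg s 3 = trc (ckpt t);
  d_size : (nreg s 13 < thr)%N -> (nreg s 2 + nreg s 4 + nreg s 5 <= insize t.+1)%N }.

Lemma core_starts t s N : core t s -> (N <= r + size S)%N -> starts S s U N.
Proof. by move=> c le i iN; apply: (c_starts (i_consts c)); apply: leq_trans iN le. Qed.

Lemma y_refresh t s : (t < T)%N -> core t.+1 s -> vectors s ->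
  (exists w, isvec (rarr s 1) w) -> nreg s 9 = r ->
  (nreg s 2 + nreg s 4 + nreg s 5 <= insize t.+1)%N ->
  yields Refresh s [::] (fun s' c =>
    [/\ core t.+1 s', vectors s', exists w', [/\ isvec (rarr s' 1) w',
         rreg s' 1 = qform (A t.+1) w', rreg s' 5 = qform (A t.+1) w'
       & good_starts -> checkpoint t.+1 -> power_best (A t.+1) k U r w'],
       nreg s' 12 = (nreg s 12 - 1)%N
     & (c <= 500 * (insize t.+1 * (r * k)) + 20)%N]).
Proof.
move=> tT co vec w0 n9 sz; rewrite /Refresh; apply: y_block => /=; set s3 := set_nreg _ 12 _.
have a3 : agree [:: (0, 38); (0, 12)]%N s s3.
  by split=> x; rewrite !inE !xpair_eqE /=; do ?case: (x == _) => //=.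
have n12 : nreg s3 12 = (nreg s 12 - 1)%N by [].
have co3 : core t.+1 s3 by exact: (core_agree a3).
have cc3 := i_consts co3.
have [k8 k9] : nreg s3 8 = k /\ nreg s3 9 = r.
  by rewrite (agn a3 9 isT) n9 (c_iters cc3).
have w3 : exists W, isvec (rarr s3 1) W by rewrite (agv a3 1 isT).
have vec3 : vectors s3 by [].
have sz3 : (nreg s3 2 + nreg s3 4 + nreg s3 5)%N = (nreg s 2 + nreg s 4 + nreg s 5)%N by [].
clearbody s3.
have st3 : starts S s3 U (nreg s3 9) by rewrite k9; exact: core_starts co3 (leq_addr _ _).
have pA : psd (mem_mx s3) by rewrite (i_mx co3); exact: psdA.
have := t_recompute Suniq Sltn (c_geom cc3) (i_repr co3) vec3 w3 st3 pA.
rewrite k8 k9 (i_mx co3) => t3.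
apply: y_seq0; apply: (y_triple t3) => s4 c4 cK a4 [vec4 [w4 [vw4 q4 pb]]].
have co4 : core t.+1 s4 by exact: (core_agree a4).
apply: y_block => /=; set s5 := set_rreg _ 5 _; apply: y_skip.
have a5 : agree [:: (0, 38); (2, 10); (2, 5)]%N s4 s5.
  by split=> x; rewrite !inE !xpair_eqE /=; do ?case: (x == _) => //=.
split=> //; first exact: (core_agree a5).
- exists w4; split=> //; first by rewrite /= addr0.
  by move=> g ct; apply: pb; exact: good_pos par psdA g _ ct.
- by rewrite (agn a5 12 isT) (agn a4 12 isT).
have M : (msize s3 <= 2 * insize t.+1)%N by apply: msize_insize; rewrite sz3.
rewrite /rc_cost k8 k9 in cK.
have i0 : (0 < insize t.+1)%N by rewrite /insize addn2.
have kk := iters_gt0 par; have lp := lg_gt0 par.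
have rr : (0 < r)%N by rewrite /nstarts muln_gt0.
suff h : (c4 <= 400 * (insize t.+1 * (r * k)))%N.
  by move: (insize t.+1 * (r * k))%N h => Z; lia.
apply: leq_trans cK _.
have b1 : (r * (60 * (k + 1) * msize s3) <= r * (60 * (2 * k) * (2 * insize t.+1)))%N.
  rewrite leq_mul2l; apply/orP; right; apply: leq_mul => //; lia.
have b2 : (r * (60 * (2 * k) * (2 * insize t.+1)) = 240 * (insize t.+1 * (r * k)))%N by lia.
have b3 : (insize t.+1 <= insize t.+1 * (r * k))%N by rewrite leq_pmulr // (muln_gt0 r k) rr.
move: b1; rewrite b2; move: (insize t.+1 * (r * k))%N b3 (r * _)%N => Z; lia.
Qed.

Lemma y_random t s Rc w : (t < T)%N -> 0 < trc t.+1 -> ready t s Rc w ->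
  (nreg s 13 < thr)%N ->
  yields RandomUpdate s [::] (fun s' c => exists Rc',
    [/\ inv t.+1 s' Rc', (Rc <= Rc')%N, nreg s' 13 = nreg s 13
      & (c <= 40 + 1000 * (insize t.+1 * (r * k * (Rc' - Rc))))%N]).
Proof.
move=> tT t0 [co vec [vw qE] cr sem rnd sz] J.
have {}sem := sem J; have [hi r3] := rnd J; have {}sz := sz J.
have cc := i_consts co.
(* The last condition of a checkpoint comes from r_4: it is at most the trace and results from fewer
   than [thr] halvings. *)
have cE (h : trc t.+1 < trc (ckpt t) - eps / (n%:R * 4) * trc (ckpt t)) : checkpoint t.+1.
  split=> //; first by rewrite /= h.
  have := i_hle co t0; rewrite (i_h co) ler_pdivrMr ?exprn_gt0 // mulrC => /le_trans; apply.
  by rewrite ler_wpM2r ?(ltW t0) // ler_weXn2l ?ler1n // ltnW.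
have fin s' w' Rc' : agree (mods RandomUpdate) s s' -> core t.+1 s' -> vectors s' ->
    isvec (rarr s' 1) w' -> rreg s' 1 = qform (A t.+1) w' ->
    (nreg s' 12 + Rc' = quota lg Ei * (lg + nreg s' 13))%N ->
    (good_starts -> tracking t.+1 w' (rreg s' 5) Rc') ->
    rreg s' 3 = trc (ckpt t.+1) -> inv t.+1 s' Rc'.
  move=> ag co' vec' vw' q' cr' sem' r3'; split=> //.
  - exists w'; split=> // g; have tr := sem' g.
    by have [] := tracking_correct par vT psdA Un g tT tr.
  - by move=> _ _; rewrite (agn ag 9 isT).
  - by move=> _; rewrite (agn ag 13 isT) leqNgt J.
  - by rewrite (agn ag 2 isT) (agn ag 4 isT) (agn ag 5 isT).
apply: y_block => /=; set s1 := set_rreg _ 10 _.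
have a1 : agree [:: (0, 38); (2, 10); (2, 14)]%N s s1.
  by split=> x; rewrite !inE !xpair_eqE /=; do ?case: (x == _) => //=.
have n1E : nreg s 1 = n by case: (c_geom cc).
have r10 : rreg s1 10 = trc (ckpt t) - eps / (n%:R * 4) * trc (ckpt t).
  by rewrite /= n1E (c_eps cc) r3.
apply: y_if; rewrite /eval_test r10 [rreg s1 2]/= (i_tr co) => ck; last first.
  apply: y_skip; exists Rc.
  have E : ckpt t.+1 = ckpt t by rewrite /= (negPf ck).
  split=> //.
  apply: (fin _ w) => //.
  - by apply: agree_sub a1; exact/allP.
  - exact: (core_agree a1).
  - by move=> g; apply: tracking_keep; [exact: E|exact: sem].
  - by rewrite E.
have ct := cE ck; have E : ckpt t.+1 = t.+1 by case: ct.
clearbody s1; apply: y_block; set s2 := foldl _ _ _.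
have a12 : agree [:: (0, 38); (2, 10); (2, 3); (0, 38); (2, 10); (2, 10); (2, 10); (2, 10); (0, 39)]%N
  s1 s2 by exact: (agree_block [:: NConst 38 0; ROfNat 10 38; RAdd 3 2 10; NConst 38 2; ROfNat 10 38;
       RDiv 10 0 10; RMul 10 10 5; RSub 10 5 10; NConst 39 0] s1).
have r3' : rreg s2 3 = trc t.+1 by rewrite /s2 /= addr0 (agr a1 2 isT) (i_tr co).
have r10' : rreg s2 10 = (1 - eps / 2) * rreg s 5.
  by rewrite /s2 /= (agr a1 0 isT) (agr a1 5 isT) (c_eps cc) mulrBl mul1r.
have n39 : nreg s2 39 = 0%N by [].
clearbody s2.
have a2 := agree_trans a1 a12.
have co2 : core t.+1 s2 by exact: (core_agree a2).
have hi2 : nreg s2 9 = r by rewrite (agn a2 9 isT).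
have j2 : nreg s2 13 = nreg s 13 by rewrite (agn a2 13 isT).
have n12 : nreg s2 12 = nreg s 12 by rewrite (agn a2 12 isT).
have vw2 : isvec (rarr s2 1) w by rewrite (agv a2 1 isT).
have q2 : rreg s2 1 = qform (A t.+1) w by rewrite (agr a2 1 isT).
have r5 : rreg s2 5 = rreg s 5 by rewrite (agr a2 5 isT).
have vec2 : vectors s2.
  by case: vec => -[X vX] [Y vY]; split; [exists X; rewrite (agv a2 7 isT)|
    exists Y; rewrite (agv a2 8 isT)].
apply: y_if; rewrite /eval_test r10' q2 => pass; last first.
  apply: y_skip; exists Rc; split=> //.
  apply: (fin _ w) => //; [by apply: agree_sub a2; exact/allP|by rewrite n12 j2| |by rewrite r3' E].
  by rewrite r5 => g; apply: tracking_pass => //; [rewrite leNgt|exact: sem].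
apply: y_if; rewrite /eval_test n39 n12 => credit; last first.
  apply: y_skip; exists Rc; split=> //.
  apply: (fin _ w) => //; [by apply: agree_sub a2; exact/allP|by rewrite n12 j2| |by rewrite r3' E].
  (* Without credit, Rc equals the whole quota, which [tracking_quota] excludes for good starting
     vectors. *)
  move=> g; exfalso.
  have := tracking_quota par vT psdA Un g ct pass (sem g) (J := nreg s 13).
  have := i_hle co t0; rewrite (i_h co) ler_pdivrMr ?exprn_gt0 // mulrC => h /(_ h).
  by rewrite -cr; move: credit; rewrite -leqNgt leqn0 => /eqP ->; rewrite ltnn.
have w2 : exists w, isvec (rarr s2 1) w by exists w.
have sz2 : (nreg s2 2 + nreg s2 4 + nreg s2 5 <= insize t.+1)%N.
  by rewrite (agn a2 2 isT) (agn a2 4 isT) (agn a2 5 isT).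
apply: y_conseq (y_refresh tT co2 vec2 w2 hi2 sz2) _ => s5 c5 a5.
case=> co5 vec5 [w5 [vw5 q5 rho5 pb]] n5 c5K.
have a := agree_trans a2 a5.
have n13 : nreg s5 13 = nreg s 13 by rewrite (agn a5 13 isT).
exists Rc.+1; split=> //.
  apply: (fin _ w5) => //; [by apply: agree_sub a; exact/allP| | |].
  - rewrite n13 n5 n12; rewrite -cr; lia.
  - move=> g; rewrite rho5; apply: (tracking_restart par vT psdA Un g ct pass (sem g)).
    exact: pb.
  - by rewrite (agr a5 3 isT) r3' E.
rewrite subSn // subnn muln1.
rewrite [size _]/=; move: (insize t.+1 * (r * k))%N c5K => Z c5K; lia.
Qed.

(** J0 counts the halvings before this update. If it is below the threshold, the deterministic mode
    starts now and the whole history is densified; otherwise a single update is pending on top of a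
    dense matrix. *)
Lemma y_det t s Rc w J0 : (t < T)%N -> 0 < trc t.+1 -> ready t s Rc w ->
  (thr <= nreg s 13)%N ->
  ((thr <= J0)%N -> (msize s <= size S + size S * size S + n + 2)%N) ->
  ((J0 < thr)%N -> (msize s <= 2 * insize t.+1)%N) ->
  yields DetUpdate s [::] (fun s' c =>
    [/\ inv t.+1 s' Rc, nreg s' 13 = nreg s 13
      & (c <= 4 + det_const * thr + (if (thr <= J0)%N then 0 else 400 * n * insize t.+1))%N]).
Proof.
move=> tT t0 [co vec [vw qE] cr sem rnd sz] J M1 M2.
have cc := i_consts co; have mn := S_le_n.
rewrite /DetUpdate; apply: y_block => /=; set s1 := set_nreg _ 9 _.
have a1 : agree [:: (0, 38); (0, 9)]%N s s1.
  by split=> x; rewrite !inE !xpair_eqE /=; do ?case: (x == _) => //=.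
have co1 : core t.+1 s1 by exact: (core_agree a1).
have h9 : nreg s1 9 = (r + size S)%N by rewrite /= addn0 (c_hi cc).
have M : msize s1 = msize s by [].
apply: y_seq0; apply: (y_triple (t_densify Suniq Sltn (c_geom (i_consts co1)) (i_repr co1) vec)).
move=> s2 c2 c2K a2 [vec2 rp2 m2 n2 [n4 n5]].
have a12 := agree_trans a1 a2.
have co2 : core t.+1 s2.
  case: co1 => i1 i2 i3 i4 i5 i6 i7; split.
  - exact: (consts_agree a2).
  - exact: rp2.
  - by rewrite m2.
  - by rewrite (agr a2 2 isT).
  - by rewrite (agr a2 4 isT) (agn a2 13 isT).
  - by rewrite (agr a2 4 isT).
  - by rewrite (agr a2 4 isT) (agn a2 13 isT).
have k8 : nreg s2 8 = k by rewrite (c_iters (i_consts co2)).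
have k9 : nreg s2 9 = (r + size S)%N by rewrite (agn a2 9 isT).
have st2 : starts S s2 U (nreg s2 9) by rewrite k9; exact: core_starts co2 (leqnn _).
have pA : psd (mem_mx s2) by rewrite (i_mx co2); exact: psdA.
have w2 : exists W, isvec (rarr s2 1) W by exists w; rewrite (agv a2 1 isT).
have := t_recompute Suniq Sltn (c_geom (i_consts co2)) rp2 vec2 w2 st2 pA.
rewrite k8 k9 (i_mx co2) => t3; apply: (y_triple t3) => s3 c3 c3K a3 [vec3 [w3 [vw3 q3 pb]]].
have co3 : core t.+1 s3 by exact: (core_agree a3).
have a13 := agree_trans a12 a3.
have J3 : nreg s3 13 = nreg s 13 by rewrite (agn a13 13 isT).
split=> //.
  split=> //.
  - exists w3; split=> // g; have [j jN low] := det_lower tT t0.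
    have {}pb : power_best (A t.+1) k U (r + size S) w3.
      by apply: pb; exact: (lower_pos par psdA tT t0 jN low).
    split; first exact: power_best_unit (psdA tT) pb.
      apply: (accurate_weaken par psdA tT).
      exact: (lower_good par psdA Un tT t0 jN low pb).
    by move=> _; rewrite J3 ltnNge J.
  - by rewrite (agn a13 12 isT) J3.
  - by move=> _; rewrite J3 ltnNge J.
  - by move=> _ _; rewrite (agn a3 2 isT) (agn a3 4 isT) (agn a3 5 isT).
  - by rewrite J3 ltnNge J.
have M3 : msize s2 = (size S + size S * size S + 1)%N by rewrite /msize n2 n4 n5; lia.
have := det_bound mn; rewrite /rc_cost k8 k9 M3 in c3K; rewrite M in c2K.
have [JJ|JJ] := leqP thr J0.
  have := leq_mul (leqnn (100 * (size S + 1))%N) (M1 JJ).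
  move: (100 * (size S + 1) * msize s)%N (100 * (size S + 1) * _)%N c2K => X Y c2K.
  move: (det_const * _)%N (_ * (60 * (k + 1) * _))%N c3K => Z W; lia.
have h1 := leq_mul (leqnn (100 * (size S + 1))%N) (M2 JJ).
have n1 := par_n par.
have h2 : (100 * (size S + 1) * (2 * insize t.+1) <= 400 * n * insize t.+1)%N.
  rewrite (_ : (400 * n * insize t.+1 = 100 * (2 * n) * (2 * insize t.+1))%N); last lia.
  by apply: leq_mul => //; lia.
move: (100 * (size S + 1) * msize s)%N (100 * (size S + 1) * (2 * _))%N (400 * n * _)%N c2K h1 h2
  => X Y V c2K h1 h2.
move: (100 * (size S + 1) * _)%N (det_const * _)%N (_ * (60 * (k + 1) * _))%N c3K => V2 Z W; lia.
Qed.

Lemma y_update t s Rc : (t < T)%N -> inv t s Rc ->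
  yields Update (load s (nth 0 v t)) [::] (fun s' c => exists2 Rc', inv t.+1 s' Rc' &
    (c + phi t (nreg s 13) Rc <= phi t.+1 (nreg s' 13) Rc')%N).
Proof.
move=> tT iv; have [co vec [w [vw qE sem]] cr rnd det sz] := iv.
set u := nth 0 v t; have al := agree_load s u.
rewrite /Update; apply: y_seq0.
apply: (y_triple (t_append_load tT iv)) => s1 c1 c1K a1 [rp1 m1 tr1 q1 [n4 n5]].
have a01 := agree_trans al a1.
have {}q1 := q1 w vw qE.
have vec1 : vectors s1.
  by case: vec => -[X vX] [Y vY]; split; [exists X; rewrite (agv a01 7 isT)|
    exists Y; rewrite (agv a01 8 isT)].
have vw1 : isvec (rarr s1 1) w by rewrite (agv a01 1 isT).
have J1 : nreg s1 13 = nreg s 13 by rewrite (agn a01 13 isT).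
have size1 : (nreg s 13 < thr)%N -> (nreg s1 2 + nreg s1 4 + nreg s1 5 <= insize t.+1)%N.
  by move=> /sz h; rewrite n4 n5 (agn a01 2 isT) (insizeS tT); lia.
have mono := trc_mono A0 vT.
have trt : trc t.+1 <= trc t by apply: mono.
apply: y_block => /=; set s2 := set_rreg _ 10 _.
have a2 : agree [:: (2, 10)]%N s1 s2 by exact: agree_instr (RSub 10 10 10) s1.
have a02 := agree_trans a01 a2.
have cc2 : consts s2 by exact: (consts_agree a02 isT (i_consts co)).
apply: y_if; rewrite /eval_test [rreg s2 10]/= subrr [rreg s2 2]/= tr1 => t0; last first.
  apply: y_skip; exists Rc; last first.
    apply: (phi_step (x := 0%N)) => //; rewrite ?subnn ?muln0 /= ?J1 //.
      by rewrite subnn; apply: leq_trans (leq_add c1K (leqnn 2)) _; move: (nnz _) => p; lia.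
    rewrite add0n; apply: leq_trans (leq_addl _ _); case: ifP => // _.
    by rewrite leq_mul2l (insizeS tT) leq_addr orbT.
  have [rp2 m2] := repr_agree n a2 isT rp1.
  split.
  - split=> //; rewrite ?m2 //=.
    + by rewrite J1 (agr a01 4 isT) (i_h co).
    + by move=> h; rewrite h in t0.
    + case: (i_J co) => [j0|[t' [tt' h1 h2]]]; first by rewrite J1 j0; left.
      by right; exists t'; rewrite (agr a01 4 isT) leqW.
  - exact: vec1.
  - exists w; split=> //= g; have [w1 _ _] := sem g.
    exact: (@semantics_zero t.+1 s2 w Rc tT (negP t0) w1 g).
  - by rewrite /= (agn a01 12 isT) J1.
  - by move=> h; rewrite h in t0.
  - by move=> h; rewrite h in t0.
  - by rewrite /= J1.
have t0' : 0 < trc t by apply: lt_le_trans trt.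
have h4 : rreg s2 4 = trc 0 / 2 ^+ nreg s 13 by rewrite /= (agr a01 4 isT) (i_h co).
have h40 : 0 < rreg s2 4.
  by rewrite h4 divr_gt0 ?exprn_gt0 //; apply: lt_le_trans t0' _; apply: mono => //; exact: ltnW.
have t20 : 0 < rreg s2 2 by rewrite /= tr1.
have [d td] := t_halve t20 h40.
apply: y_seq0; apply: (y_triple td) => s3 c3 c3K a3 [n13 n12 r4 r4le dJ].
have a13 := agree_trans a2 a3; have a03 := agree_trans a02 a3.
have n13' : nreg s3 13 = (nreg s 13 + d)%N by rewrite n13 /= J1.
have JJ : (nreg s 13 <= nreg s3 13)%N by rewrite n13' leq_addr.
have [rp3 m3] := repr_agree n a13 isT rp1.
have tr3 : rreg s3 2 = trc t.+1 by rewrite (agr a3 2 isT).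
have rd : ready t s3 Rc w.
  split.
  - split=> //.
    + exact: (consts_agree a03 isT (i_consts co)).
    + by rewrite m3.
    + by rewrite r4 h4 n13' exprD invfM mulrA.
    + by rewrite -tr3.
    + case: dJ => [d0|lt]; last first.
        by right; exists t.+1; split=> //; rewrite /= tr1 in lt.
      rewrite n13' d0 addn0 r4 d0 expr0 divr1 /= (agr a01 4 isT).
      case: (i_J co) => [j0|[t' [tt' h1 h2]]]; [by left; rewrite j0|right].
      by exists t'; rewrite leqW.
  - by case: vec1 => -[X vX] [Y vY]; split; [exists X; rewrite (agv a13 7 isT)|
      exists Y; rewrite (agv a13 8 isT)].
  - by rewrite (agv a13 1 isT) (agr a13 1 isT).
  - rewrite n12 n13' (c_quota cc2) /= (agn a01 12 isT).
    by rewrite addnA mulnDr -cr; lia.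
  - move=> J3 g; rewrite (agr a03 5 isT); have [_ _] := sem g; apply=> //.
    exact: leq_ltn_trans JJ J3.
  - move=> J3; rewrite (agn a03 9 isT) (agr a03 3 isT); apply: rnd => //.
    exact: leq_ltn_trans JJ J3.
  - move=> J3; rewrite (agn a13 2 isT) (agn a13 4 isT) (agn a13 5 isT); apply: size1.
    exact: leq_ltn_trans JJ J3.
apply: y_if; rewrite /eval_test (c_thr (i_consts (d_core rd))) => J3.
  apply: y_conseq (y_random tT t0 rd J3) _ => s4 c4 a4 [Rc' [iv4 RR J4 c4K]].
  exists Rc' => //; rewrite J4; apply: (phi_step (x := 0%N)) => //.
    rewrite addn0; move: c4K c3K c1K; rewrite n13' addKn -/u.
    move: (insize t.+1 * _)%N (nnz u) => Z p; rewrite /=; lia.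
  by rewrite add0n (leqNgt thr (nreg s 13)) (leq_ltn_trans JJ J3).
rewrite -leqNgt in J3.
have M1 : (thr <= nreg s 13)%N -> (msize s3 <= size S + size S * size S + n + 2)%N.
  move=> J0; have [e1 e2 e3] := det t0' J0.
  rewrite /msize (agn a03 2 isT) (agn a13 4 isT) (agn a13 5 isT) n4 n5 e1 e2 e3.
  have : (nnz (nth 0%R v t) <= n)%N.
    by rewrite /nnz; apply: leq_trans (max_card _) _; rewrite card_prod !card_ord muln1.
  lia.
have M2 : (nreg s 13 < thr)%N -> (msize s3 <= 2 * insize t.+1)%N.
  move=> J0; apply: msize_insize; rewrite (agn a13 2 isT) (agn a13 4 isT) (agn a13 5 isT).
  exact: size1.
apply: y_conseq (y_det tT t0 rd J3 M1 M2) _ => s4 c4 a4 [iv4 J4 c4K].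
exists Rc => //; rewrite J4.
apply: (phi_step (x := (det_const * thr +
   (if (thr <= nreg s 13)%N then 0 else 400 * n * insize t.+1))%N)) => //.
  rewrite subnn !muln0 addn0; move: c4K c3K c1K; rewrite n13' addKn -/u.
  move: (det_const * thr)%N (if _ then _ else _) (nnz u) => Z Y p; rewrite /=; lia.
rewrite J3 -addnA; apply: leq_add.
  by rewrite leq_mul2l; apply/orP; right; lia.
by case: ifP => _; rewrite ?addn0 // add0n leq_mul2l (insizeS tT) leq_addr orbT.
Qed.

End OneUpdate.

(** * Random starting vectors *)

Section Blocks.
Variable R : realType.

Definition chunk m i (b : seq bool) := take m (drop (i * m) b).

Lemma pr_chunk m r i (P : seq bool -> Prop) : (i < r)%N ->
  pr R (r * m) (fun b => P (chunk m i b)) = pr R m P.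
Proof.
move=> ir; have -> : (r * m = i * m + (m + (r - i.+1) * m))%N.
  by rewrite addnA -mulSnr -mulnDl; congr (_ * _)%N; lia.
rewrite /pr /chunk (mean_drop _ _ (fun b => indic R (P (take m b)))).
exact: (mean_take m _ (fun b => indic R (P b))).
Qed.

Lemma pr_chunks m r (P : seq bool -> Prop) p : 0 <= p -> pr R m P <= p ->
  pr R (r * m) (fun b => forall i, (i < r)%N -> P (chunk m i b)) <= p ^+ r.
Proof.
move=> p0 Pp; elim: r => [|r IHr]; first by rewrite expr0; exact: indic_le1.
apply: (@le_trans _ _ (mean (m + r * m) (fun b => indic R (P (take m b)) *
   indic R (forall i, (i < r)%N -> P (chunk m i (drop m b)))))).
  rewrite mulSn; apply: mean_le => b _; apply: indic_le.
    by rewrite mulr_ge0 ?indic_ge0.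
  move=> h; rewrite !indicT ?mulr1 //.
    by move=> i ir; have := h i.+1 ir; rewrite /chunk drop_drop mulSnr.
  by have := h 0%N isT; rewrite /chunk mul0n drop0.
rewrite (mean_cat m (r * m) (fun b => indic R (P b))
  (fun b => indic R (forall i, (i < r)%N -> P (chunk m i b)))) exprS; apply: ler_pM => //; exact: pr_ge0.
Qed.

End Blocks.

Lemma ratio_le1 (R : realType) n (eps : R) : 0 < eps < 1 -> (0 < n)%N ->
  0 <= eps / (n%:R * 4) <= 1.
Proof.
move=> /andP[e0 e1] n0; have x1 : 1 <= n%:R :> R by rewrite ler1n.
rewrite divr_ge0 ?ler_pdivrMr ?mulr_ge0 ?mulr_gt0 ?ltr0n ?ltW //; lra.
Qed.

Lemma not_le_half (R : realType) (x : R) : 0 < x -> x <= 1 / 2 * x -> False.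
Proof. lra. Qed.

Lemma expR1_ge2 (R : realType) : 2 <= expR 1 :> R.
Proof. by apply: le_trans (expR_ge1Dx 1); rewrite (_ : 1 + 1 = 2). Qed.

Lemma expR_half_le2 (R : realType) : expR (1 / 2) <= 2 :> R.
Proof.
have h : 0 <= 1 / 2 :> R by lra.
apply: (le_trans (expR_le_quadratic _)); first by rewrite ger0_norm.
lra.
Qed.

(** With p = 2^lg the count is O(p^8), and the remaining factor p^3 >= 8 absorbs the constants. *)
Lemma checkpoint_arith n Ei lg c : (0 < lg)%N -> (n <= 2 ^ lg)%N -> (Ei <= 2 ^ lg)%N ->
  (c <= 4 * (n * Ei) * (2 ^ (6 * lg)).+1)%N -> (1 + c <= 2 ^ (11 * lg))%N.
Proof.
move=> l0 np Ep cle.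
apply: (@leq_trans (1 + 4 * (n * Ei) * (2 ^ (6 * lg)).+1)); first by rewrite leq_add2l.
rewrite (_ : (11 * lg = lg + lg + (9 * lg))%N); last lia.
rewrite 2!expnD; set p := (2 ^ lg)%N in np Ep *.
have p2 : (2 <= p)%N by rewrite -[X in (X <= _)%N](expn1 2) leq_exp2l.
have -> : (2 ^ (9 * lg) = p ^ 3 * 2 ^ (6 * lg))%N.
  by rewrite -expnM -expnD; congr (_ ^ _)%N; lia.
have p3 : (8 <= p ^ 3)%N by rewrite (_ : 8 = 2 ^ 3)%N // leq_exp2r.
have nE : (n * Ei <= p * p)%N by exact: leq_mul.
have X2 : (2 <= 2 ^ (6 * lg))%N by rewrite -[X in (X <= _)%N](expn1 2) leq_exp2l //; lia.
move: (p ^ 3)%N p3 (2 ^ (6 * lg))%N X2 => q q8 X X2.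
have pp : (4 <= p * p)%N by rewrite (_ : 4 = 2 * 2)%N // leq_mul.
move: (p * p)%N (n * Ei)%N nE pp => P N NP P4.
have h1 : (4 * N * X.+1 <= 4 * P * X.+1)%N by rewrite leq_mul2r leq_mul2l NP !orbT.
apply: (@leq_trans (1 + 4 * P * X.+1)); first by rewrite leq_add2l.
apply: (@leq_trans (P * (8 * X))).
  have : (1 <= P)%N by lia.
  nia.
by rewrite leq_mul2l leq_mul2r q8 !orbT.
Qed.

(** * Failure probability of the starting vectors *)

Section Starts.
Variables (R : realType) (n T : nat) (eps : R) (lg Ei : nat).
Variables (A0 : 'M[R]_n) (v : seq 'cV[R]_n) (S : seq nat).
Hypothesis par : params n eps lg Ei.
Hypotheses (vT : size v = T) (psdA : forall t, (t <= T)%N -> psd (decr A0 v t)).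
Hypotheses (Suniq : uniq S) (Sltn : forall i, i \in S -> (i < n)%N).
Hypothesis Ssupp : forall i : 'I_n, A0 i i != 0 -> val i \in S.

Local Notation A := (decr A0 v).
Local Notation k := (iters lg Ei).
Local Notation r := (nstarts lg).
Local Notation m := (size S).
Local Notation trc := (trc A0 v).
Local Notation ckpt := (ckpt eps A0 v).
Local Notation checkpoint := (checkpoint T eps lg A0 v).
Local Notation thr := (det_threshold lg).
Local Notation tail := (tail R lg).

Let n0 : (0 < n)%N. Proof. exact: ltnW (par_n par). Qed.

Definition std i : 'cV[R]_n := \col_j (val j == i)%:R.
Definition basis : seq 'cV[R]_n := [seq std i | i <- S].

(* Random sign vectors on the support, followed by its unit vectors. *)
Definition start_vectors (b : seq bool) i : 'cV[R]_n :=
  if (i < r)%N then signed_sum basis (chunk m i b)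
  else if (i < r + m)%N then std (nth 0%N S (i - r)) else 0.

Lemma std_delta (i : 'I_n) : std i = delta_mx i 0.
Proof. by apply/colP => j; rewrite !mxE eqxx andbT. Qed.

Lemma decr_diag t (i : 'I_n) : (t <= T)%N -> val i \notin S -> A t i i = 0.
Proof.
move=> tT iS; apply/eqP; rewrite eq_le; apply/andP; split; last first.
  by rewrite -qform_delta; exact/psd_ge0/psdA.
have := psd_ge0 (delta_mx i 0) (psd_decrB A0 vT (leq0n t) tT).
rewrite qformB !qform_delta decr0 subr_ge0 => /le_trans; apply.
by have [->|/Ssupp h] := eqVneq (A0 i i) 0; last by rewrite h in iS.
Qed.

(** A psd matrix with a zero diagonal entry has a zero column there, by Cauchy-Schwarz; diagonal
    entries only decrease. So the support read off the diagonal of A_0 serves all later matrices. *)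
Lemma decr_off t (i : 'I_n) : (t <= T)%N -> val i \notin S -> A t *m delta_mx i 0 = 0 :> 'cV[R]_n.
Proof.
move=> tT iS; set e : 'cV[R]_n := delta_mx i 0; have pA := psdA tT.
have := psd_CauchySchwarz (A t *m e) e pA.
rewrite [qform _ e]qform_delta decr_diag // mulr0 => h; apply/eqP.
by rewrite -dotv_eq0 -sqrf_eq0 eq_le h sqr_ge0.
Qed.

Lemma decrX_diag t (i : 'I_n) j : (t <= T)%N -> val i \notin S -> (A t ^+ j.+1) i i = 0.
Proof.
move=> tT iS; rewrite -qform_delta qformE exprSr -mulmxE -mulmxA decr_off //.
by rewrite /dotv !mulmx0 mxE.
Qed.

Lemma sum_basis (F : 'cV[R]_n -> R) : F 0 = 0 ->
  (forall i : 'I_n, val i \notin S -> F (delta_mx i 0) = 0) ->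
  \sum_(f <- basis) F f = \sum_(i < n) F (delta_mx i 0).
Proof.
move=> F0 FS; rewrite /basis big_map (sum_supp Suniq Sltn (F := fun i => F (std i))).
  by apply: eq_bigr => i _; rewrite std_delta.
move=> i iS; have [iN|iN] := ltnP i n.
  by have := std_delta (Ordinal iN) => /= ->; rewrite FS.
rewrite (_ : std i = 0) //; apply/colP => j; rewrite !mxE.
by case: eqP => // E; move: (ltn_ord j); rewrite E ltnNge iN.
Qed.

Lemma sum_basis_power s j : (s <= T)%N ->
  \sum_(f <- basis) qform (A s ^+ j.+1) f = \tr (A s ^+ j.+1).
Proof.
move=> sT; rewrite sum_basis.
- by apply: eq_bigr => i _; rewrite qform_delta.
- by rewrite qformE mulmx0 /dotv mulmx0 mxE.
- by move=> i iS; rewrite qform_delta decrX_diag.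
Qed.

Lemma pr_no_lower s : (s <= T)%N ->
  pr R (r * m) (fun b => ~ exists2 i, (i < r)%N &
     \tr (A s ^+ (2 * k)) <= 2 * moment (A s) (start_vectors b i) (2 * k)) <= (8 / 9) ^+ r.
Proof.
move=> sT; pose P b := ~ (\tr (A s ^+ (2 * k)) <= 2 * moment (A s) (signed_sum basis b) (2 * k)).
apply: (@le_trans _ _ (pr R (r * m) (fun b => forall i, (i < r)%N -> P (chunk m i b)))).
  apply: pr_le => b _ h i ir low; apply: h; exists i => //.
  by rewrite /start_vectors ir.
apply: pr_chunks; first lra.
have [K KE] : exists K, (2 * k = K.+1)%N.
  by exists (2 * k).-1; rewrite prednK // muln_gt0 (iters_gt0 par).
have := signed_sum_lower basis (psdX (2 * k) (psdA sT)); rewrite size_map.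
by rewrite KE sum_basis_power // /P KE.
Qed.

(** The psd difference is a sum of at most n outer products b b^T, and [signed_sum_upper] treats
    each functional A_s^k b. Decomposing the difference instead of summing over the updates between
    s and t keeps the number of terms independent of T. *)
Lemma pr_no_upper s t i : (s <= t)%N -> (t <= T)%N -> (i < r)%N ->
  pr R (r * m) (fun b => ~ (qform (A s - A t) (A s ^+ k *m start_vectors b i) <=
       tail ^+ 2 * \tr (A s ^+ (2 * k) *m (A s - A t)))) <=
  n%:R * (2 * expR (1 / 2 - tail / 2)).
Proof.
move=> st tT ir; have pA := psdA (leq_trans st tT); case: (pA) => As _.
have pV := psd_decrB A0 vT st tT; set V := A s - A t in pV *.
have [bs [szb VE]] := psd_decomp pV.
pose a b := A s ^+ k *m b : 'cV[R]_n.
have e0 : 0 <= 2 * expR (1 / 2 - tail / 2) by rewrite mulr_ge0 ?expR_ge0.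
pose P b c := ~ (dotv (a b) (signed_sum basis c) ^+ 2 <= tail ^+ 2 * \sum_(f <- basis) dotv (a b) f ^+ 2).
apply: (@le_trans _ _ ((size bs)%:R * (2 * expR (1 / 2 - tail / 2)))); last first.
  by rewrite ler_wpM2r // ler_nat.
apply: (le_trans _ (_ : pr R m (fun c => exists2 b, b \in bs & P b c) <= _)); last first.
  apply: (pr_bigU (s := bs) (P := P)) => [c _ [b bs_b pb]|b _]; first by exists b.
  by have := signed_sum_upper (a b) basis (ltW (tail_gt0 par)); rewrite size_map.
rewrite -(pr_chunk R m (fun c => exists2 b, b \in bs & P b c) ir).
apply: pr_le => c _ h; apply: contrapT => hn; apply: h.
rewrite /start_vectors ir; set x := signed_sum _ _.
rewrite {1 2}VE qform_sum mulmx_sumr linear_sum mulr_sumr big_seq [leRHS]big_seq.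
apply: ler_sum => b bs_b; rewrite qform_outer /= mxtrace_mul_outer.
have -> : dotv b (A s ^+ k *m x) = dotv (a b) x.
  by rewrite /a dotv_mull trmxX As.
apply: (@le_trans _ _ (tail ^+ 2 * \sum_(f <- basis) dotv (a b) f ^+ 2)).
  by apply: contrapT => nb; apply: hn; exists b.
rewrite ler_wpM2l ?sqr_ge0 // -[qform _ _]/(moment _ _ _) -dotv_powX // -/(a b).
rewrite sum_basis; last 2 first.
- by rewrite /dotv mulmx0 mxE expr0n.
- move=> j jS; rewrite /a dotv_mull trmxX As.
  have [K ->] : exists K, k = K.+1 by exists k.-1; rewrite prednK // (iters_gt0 par).
  rewrite [_ ^+ K.+1]exprSr -mulmxE -mulmxA (decr_off (leq_trans st tT)) //.
  by rewrite mulmx0 /dotv mulmx0 mxE expr0n.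
rewrite dotvE; apply: ler_sum => j _; rewrite -expr2 dotvE (bigD1 j) //= big1.
  by rewrite !mxE !eqxx mulr1 addr0.
by move=> j' jj; rewrite !mxE (negPf jj) mulr0.
Qed.

Let drop_rate : 0 <= eps / (n%:R * 4) <= 1.
Proof. exact: ratio_le1 (par_eps par) n0. Qed.

Lemma ckpt_count t : (t <= T)%N ->
  trc (ckpt t) <= (1 - eps / (n%:R * 4)) ^+ (count (fun s => ckpt s == s) (iota 1 t)) * trc 0.
Proof.
elim: t => [|t IHt] tT; first by rewrite expr0 mul1r.
rewrite -addn1 iotaD count_cat /= add1n addn1 [ckpt t.+1]/=.
have := IHt (ltnW tT); set c := count _ _ => h.
have e1 := eps_lt1 par; have e0 := eps_gt0 par.
have nR : 0 < n%:R :> R by rewrite ltr0n.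
have /andP[_ d1] := drop_rate.
case: ifP => ck; rewrite addn0.
  rewrite eqxx addn1 exprS -mulrA; apply: le_trans (ltW ck) _.
  by rewrite -[X in X - _]mul1r -mulrBl ler_wpM2l // subr_ge0.
rewrite (_ : (ckpt t == t.+1) = false) ?addn0 //.
by apply/eqP => E; have := ckpt_le eps A0 v t; rewrite E ltnn.
Qed.

(** 4 n Ei checkpoints halve the trace, and up to a checkpoint it has been halved at most [thr]
    times. *)
Lemma checkpoint_count t : checkpoint t ->
  (count (fun s => ckpt s == s) (iota 0 t.+1) <= 2 ^ (11 * lg))%N.
Proof.
case=> tT E t0 thrt; have := ckpt_count tT; rewrite E /=.
set c := count _ _ => h; have e1 := eps_lt1 par; have e0 := eps_gt0 par.
have nR : 0 < n%:R :> R by rewrite ltr0n.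
set d := eps / (n%:R * 4) in h.
have /andP[d0 d1] : 0 <= d <= 1 by exact: drop_rate.
have Md : 1 <= (4 * (n * Ei))%N%:R * d.
  rewrite /d !natrM (_ : _ * _ = Ei%:R * eps); first exact: par_E par.
  by field; rewrite gt_eqF.
have tr0 : 0 < trc 0 by apply: lt_le_trans t0 _; apply: (trc_mono A0 vT).
have cle : (c <= 4 * (n * Ei) * thr.+1)%N.
  rewrite leqNgt; apply/negP => lt.
  have : (1 - d) ^+ c <= (1 / 2) ^+ thr.+1.
    apply: (@le_trans _ _ ((1 - d) ^+ (4 * (n * Ei) * thr.+1))).
      by apply: ler_wiXn2l; [rewrite subr_ge0|rewrite gerBl|exact: ltnW].
    have h2 : 0 <= 1 / 2 :> R by rewrite divr_ge0.
    rewrite exprM; apply: lerXn2r; rewrite ?nnegrE ?exprn_ge0 ?subr_ge0 //.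
    by apply: pow_half => //; rewrite d0 d1.
  move=> hc; have : trc 0 <= 1 / 2 * trc 0.
    apply: (le_trans thrt).
    apply: (@le_trans _ _ (2 ^+ thr * ((1 / 2) ^+ thr.+1 * trc 0))).
      rewrite ler_wpM2l ?exprn_ge0 //; apply: le_trans h _.
      exact: (ler_wpM2r (ltW tr0) hc).
    rewrite mulrA exprSr mulrA -exprMn (_ : 2 * (1 / 2) = 1 :> R); last by rewrite mul1r mulfV ?pnatr_eq0.
    by rewrite expr1n !mul1r.
  exact: not_le_half.
exact: checkpoint_arith (lg_gt0 par) (n_le_lg par) (leq_trans (Ei_le par) (n_le_lg par)) cle.
Qed.

(** The last checkpoint below N already bounds the number of all earlier ones, hence a bound uniform
    in N. *)
Lemma checkpoints_few N :
  (size [seq t <- iota 0 N | `[< checkpoint t >]] <= 2 ^ (11 * lg))%N.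
Proof.
elim: N => [|N IHN]; first exact: leq0n.
rewrite -addn1 iotaD filter_cat size_cat /= add0n.
case: asboolP => [cN|_]; last by rewrite addn0.
apply: leq_trans (checkpoint_count cN); rewrite -addn1 iotaD count_cat /= add0n.
apply: leq_add; last by case: cN => _ -> _ _; rewrite eqxx.
rewrite size_filter; apply: sub_count => t /asboolP[_ -> _ _]; exact: eqxx.
Qed.

Lemma pr_not_good_le (Q : nat) (cs : seq nat) : (size cs <= Q)%N ->
  (forall t, checkpoint t -> t \in cs) ->
  pr R (r * m) (fun b => ~ good_starts T eps lg Ei A0 v (start_vectors b)) <=
  Q%:R * (8 / 9) ^+ r + Q%:R ^+ 2 * (r%:R * (n%:R * (2 * expR (1 / 2 - tail / 2)))).
Proof.
move=> szQ csP; set u := n%:R * _.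
have u0 : 0 <= u by rewrite mulr_ge0 ?mulr_ge0 ?expR_ge0.
pose lower s b := checkpoint s -> exists2 i, (i < r)%N &
     \tr (A s ^+ (2 * k)) <= 2 * moment (A s) (start_vectors b i) (2 * k).
pose upper (p : nat * nat * nat) b := let: (s, t, i) := p in
  checkpoint s -> checkpoint t -> (s <= t)%N -> (i < r)%N ->
     qform (A s - A t) (A s ^+ k *m start_vectors b i) <=
       tail ^+ 2 * \tr (A s ^+ (2 * k) *m (A s - A t)).
pose ps := [seq (p, i) | p <- [seq (s, t) | s <- cs, t <- cs], i <- iota 0 r].
have szps : size ps = (size cs * size cs * r)%N by rewrite !size_allpairs size_iota.
apply: (@le_trans _ _ (pr R (r * m) (fun b => exists2 s, s \in cs & ~ lower s b) +
   pr R (r * m) (fun b => exists2 p, p \in ps & ~ upper p b))).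
  apply: prU => b _ ng; have [l|nl] := pselect (forall s, s \in cs -> lower s b); last first.
    left; apply: contrapT => h; apply: nl => s s_cs; apply: contrapT => h'.
    by apply: h; exists s.
  right; apply: contrapT => h; apply: ng; split=> [s cs_s|s t cs_s cs_t st i ir].
    by apply: l => //; exact: csP.
  apply: contrapT => h'; apply: h; exists (s, t, i); last by move/(_ cs_s cs_t st ir).
  by rewrite allpairs_f ?allpairs_f ?csP ?mem_iota.
apply: lerD.
  apply: (@le_trans _ _ ((size cs)%:R * (8 / 9) ^+ r)); last first.
    by rewrite ler_wpM2r ?ler_nat // exprn_ge0 // divr_ge0.
  apply: (pr_bigU (s := cs) (P := fun s b => ~ lower s b)) => // s _.
  have [[sT _ _ _]|nc] := pselect (checkpoint s); last first.
    rewrite /pr (@mean_eq _ _ _ (fun=> 0)) ?mean_const ?exprn_ge0 ?divr_ge0 // => b _.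
    by apply: indicF; apply=> /nc.
  apply: le_trans (pr_no_lower sT); apply: pr_le => b _ h h'; exact: h.
apply: (@le_trans _ _ ((size ps)%:R * u)); last first.
  rewrite mulrA ler_wpM2r // szps natrM natrM -expr2 ler_wpM2r //.
  by rewrite lerXn2r ?nnegrE ?ler_nat.
apply: (pr_bigU (s := ps) (P := fun p b => ~ upper p b)) => // -[[s t] i] _.
have [[[tT _ _ _] [st ir]]|nc] := pselect (checkpoint t /\ (s <= t)%N /\ (i < r)%N); last first.
  rewrite /pr (@mean_eq _ _ _ (fun=> 0)) ?mean_const // => b _.
  by apply: indicF; apply=> c1 c2 st ir; exfalso; apply: nc.
apply: le_trans (pr_no_upper st tT ir); apply: pr_le => b _ h h'; exact: h.
Qed.

(** With p = 2^lg the two kinds of failure have probability at most p^(11 - 26) and 624 p^(22 + 2 -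
    36). For p >= 2 the sum is at most 1/p, and 1/p <= 1/n. *)
Lemma pr_good :
  1 - n%:R^-1 <= pr R (r * m) (fun b => good_starts T eps lg Ei A0 v (start_vectors b)).
Proof.
rewrite prC lerD2l lerN2.
have csP t : checkpoint t -> t \in [seq t <- iota 0 T.+1 | `[< checkpoint t >]].
  by move=> ct; case: (ct) => tT _ _ _; rewrite mem_filter mem_iota add0n ltnS tT !andbT; exact/asboolP.
apply: le_trans (pr_not_good_le (checkpoints_few T.+1) csP) _.
have l0 := lg_gt0 par; have np := n_le_lg par.
set p : R := 2 ^+ lg.
have p0 : 0 < p by rewrite exprn_gt0.
have p2 : 2 <= p by rewrite -[X in X <= _]expr1 ler_weXn2l ?ler1n.
have nlep : n%:R <= p by rewrite /p -natrX ler_nat.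
have nR : 0 < n%:R :> R by rewrite ltr0n.
have QE : (2 ^ (11 * lg))%N%:R = p ^+ 11 :> R by rewrite natrX mulnC exprM.
rewrite QE.
apply: (@le_trans _ _ (p^-1)); last by rewrite lef_pV2 ?posrE.
have h1 : (8 / 9) ^+ r <= (p ^+ 26)^-1.
  rewrite /nstarts (_ : (156 * lg = 6 * (26 * lg))%N); last lia.
  have -> : (p ^+ 26)^-1 = (1 / 2) ^+ (26 * lg).
    by rewrite div1r exprVn mulnC exprM.
  rewrite exprM.
  by apply: lerXn2r; rewrite ?nnegrE ?exprn_ge0 ?divr_ge0 //; lra.
have h2 : expR (1 / 2 - tail / 2) <= 2 * (p ^+ 36)^-1.
  rewrite expRD; apply: ler_pM; rewrite ?expR_ge0 //.
    exact: expR_half_le2.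
  rewrite expRN lef_pV2 ?posrE ?exprn_gt0 ?expR_gt0 //.
  rewrite /tail natrM (_ : 72%:R * lg%:R / 2 = (36 * lg)%:R * 1 :> R); last by rewrite natrM; field.
  rewrite expRM_natl -exprM [(lg * 36)%N]mulnC.
  by apply: lerXn2r; rewrite ?nnegrE ?expR_ge0 // expR1_ge2.
have lgp : lg%:R <= p by rewrite /p -natrX ler_nat ltnW // ltn_expl.
have -> : r%:R = 156 * lg%:R :> R by rewrite natrM.
have e0 := expR_ge0 (1 / 2 - tail / 2).
apply: (@le_trans _ _ (p ^+ 11 * (p ^+ 26)^-1 +
  (p ^+ 11) ^+ 2 * (156 * p * (p * (2 * (2 * (p ^+ 36)^-1)))))).
  apply: lerD; first by rewrite ler_wpM2l ?exprn_ge0 // ltW.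
  rewrite ler_wpM2l ?sqr_ge0 //; apply: ler_pM; rewrite ?mulr_ge0 // ?ler_wpM2l //.
  by apply: ler_pM; rewrite ?mulr_ge0 ?ler_wpM2l.
have -> : p ^+ 11 * (p ^+ 26)^-1 + (p ^+ 11) ^+ 2 * (156 * p * (p * (2 * (2 * (p ^+ 36)^-1)))) =
  p^-1 * (p^-1 ^+ 14 + 624 * p^-1 ^+ 11) by field; rewrite gt_eqF.
have q0 : 0 <= p^-1 by rewrite invr_ge0 ltW.
rewrite -[leRHS]mulr1 ler_wpM2l //.
have q2 : p^-1 <= 1 / 2 by rewrite div1r lef_pV2 ?posrE.
have e j : p^-1 ^+ j <= (1 / 2) ^+ j by apply: lerXn2r; rewrite ?nnegrE ?divr_ge0.
have := e 14; have := e 11; lra.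
Qed.

Lemma signed_sum_coord (S' : seq nat) c (j : 'I_n) : uniq S' ->
  signed_sum [seq std i | i <- S'] c j 0 =
  if (val j \in S') && (index (val j) S' < size c)%N then
    (if nth false c (index (val j) S') then 1 else -1) else 0.
Proof.
elim: S' c => [|i S' IHS] [|x c] //=; rewrite ?mxE //; first by rewrite ltn0 andbF.
move=> /andP[iS' /IHS IH]; rewrite IH inE eq_sym.
have [E|ne] := eqVneq i (val j).
  by rewrite -E (negPf iS') /= mulr1 addr0.
by rewrite mulr0 add0r /= ltnS.
Qed.

Lemma start_coord b i (j : 'I_n) : size b = (r * m)%N -> (i < r)%N ->
  start_vectors b i j 0 = if val j \in S then
    (if nth false b (i * m + index (val j) S) then 1 else -1) else 0.
Proof.
move=> szb ir; rewrite /start_vectors ir signed_sum_coord //.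
have im : (i * m + m <= r * m)%N by rewrite -mulSnr leq_mul2r ir orbT.
rewrite /chunk size_take size_drop szb; case: (boolP (val j \in S)) => //= jS.
have jm : (index (val j) S < m)%N by rewrite index_mem.
rewrite nth_take // nth_drop; case: ifP => // /negP h; exfalso; apply: h.
by case: ifP => _ //; apply: leq_trans jm _; rewrite leq_subRL // (leq_trans (leq_addr m _)).
Qed.

Lemma start_vectors_norm b i : dotv (start_vectors b i) (start_vectors b i) <= n%:R.
Proof.
rewrite dotvE -[X in _ <= X%:R]card_ord -sumr_const; apply: ler_sum => j _.
rewrite -expr2 /start_vectors; case: ifP => _.
  by rewrite signed_sum_coord //; case: ifP => _; [case: ifP => _|];
    rewrite ?expr1n ?sqrrN ?expr1n ?expr0n.
by case: ifP => _; rewrite mxE ?expr0n //; case: eqP => _; rewrite ?expr1n ?expr0n.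
Qed.

(** The diagonal entries of A_t^2k on the support add up to its trace, so one of these at most n
    entries exceeds a share 1/(2n). *)
Lemma unit_start_lower b t : (t <= T)%N -> 0 < trc t -> exists2 j, (j < r + m)%N &
  \tr (A t ^+ (2 * k)) <= 2 * n%:R * moment (A t) (start_vectors b j) (2 * k).
Proof.
move=> tT t0; have pA := psdA tT; have pM := psdX (2 * k) pA.
have nR : 0 < n%:R :> R by rewrite ltr0n.
apply: contrapT => no; have hi i : i \in S ->
    2 * n%:R * qform (A t ^+ (2 * k)) (std i) < \tr (A t ^+ (2 * k)).
  move=> iS; rewrite ltNge; apply/negP => h; apply: no; exists (r + index i S)%N.
    by rewrite ltn_add2l index_mem.
  rewrite /start_vectors ltnNge leq_addr /= ltn_add2l index_mem iS addKn nth_index //.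
have [K KE] : exists K, (2 * k = K.+1)%N.
  by exists (2 * k).-1; rewrite prednK // muln_gt0 (iters_gt0 par).
have trE : \tr (A t ^+ (2 * k)) = \sum_(i <- S) qform (A t ^+ (2 * k)) (std i).
  by rewrite KE -sum_basis_power // /basis big_map.
have mn : m%:R <= n%:R :> R.
  rewrite ler_nat -{1}(size_iota 0 n); apply: uniq_leq_size => // i /Sltn.
  by rewrite mem_iota.
have tr0 : 0 < \tr (A t ^+ (2 * k)).
  apply: lt_le_trans (max_qformX_le _ n0 pA); apply: exprn_gt0.
  exact: max_gt0 par psdA _ tT t0.
have : 2 * n%:R * \tr (A t ^+ (2 * k)) <= m%:R * \tr (A t ^+ (2 * k)).
  rewrite {1}trE mulr_sumr.
  apply: (@le_trans _ _ (\sum_(i <- S) \tr (A t ^+ (2 * k)))).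
    by rewrite big_seq [leRHS]big_seq; apply: ler_sum => i /hi /ltW.
  by rewrite big_const_seq count_predT iter_addr addr0 mulr_natl.
have : m%:R * \tr (A t ^+ (2 * k)) <= n%:R * \tr (A t ^+ (2 * k)) by rewrite ler_pM2r.
have : 0 < n%:R * \tr (A t ^+ (2 * k)) by rewrite mulr_gt0.
move: (\tr _) => x; rewrite -mulrA; lra.
Qed.

End Starts.

(** * Initialization *)

(** The two comparisons emulate an equality test: diagonal entries yield the support and the
    trace. *)
Definition Copy : cmd := For 20 0
  (block [:: NLoad 30 0 20; NLoad 31 1 20; RLoad 10 0 20; NStore 2 20 30; NStore 3 20 31;
     RStore 2 20 10]
   (If (NLt 30 31) Skip (If (NLt 31 30) Skip
     (block [:: NStore 6 3 30; NConst 38 1; NAdd 3 3 38; RAdd 2 2 10] Skip)))).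

(* A zero matrix gets the support {0} and the eigenvector e_0. *)
Definition ZeroCase : cmd := If (RLt 15 2) Skip
  (block [:: NConst 30 0; NStore 6 30 30; NConst 3 1; ROfNat 10 3; RStore 1 30 10] Skip).

Definition Double z y : cmd := For 20 y (block [:: NAdd z z z] Skip).

Definition FindLg : cmd := block [:: NConst 6 0; NConst 30 1; NConst 38 1]
  (While (NLt 30 1) (block [:: NAdd 30 30 30; NAdd 6 6 38] Skip)).

(** Reals cannot be rounded to integers, so the accuracy is added up until it reaches 1; the Ei
    rounds are fewer than the power iterations of one start. *)
Definition FindE : cmd := block [:: NConst 7 0; NConst 38 1; ROfNat 11 38; RSub 10 10 10]
  (While (RLt 10 11) (block [:: NAdd 7 7 38; RAdd 10 10 0] Skip)).

(** Integers can only be added and subtracted, so products and powers of two are computed by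
    loops. *)
Definition SetParams : cmd :=
  Seq FindLg (Seq FindE
  (block [:: NAdd 31 6 6; NAdd 30 31 6; NAdd 30 30 30; NConst 14 1]
  (Seq (Double 14 30)
  (Seq (Mul 31 7 6)
  (block [:: NAdd 30 31 31; NAdd 30 30 31; NAdd 30 30 30; NAdd 8 30 30; NConst 33 15]
  (Seq (Mul 32 31 6)
  (Seq (Double 32 33)
  (block [:: NAdd 34 8 8; NConst 38 1; NAdd 34 34 38; NConst 33 156]
  (Seq (Mul 11 32 34) (Seq (Mul 12 11 6) (Seq (Mul 9 33 6) (Do (NAdd 10 9 3))))))))))))).

Definition RandomStarts : cmd :=
  block [:: NConst 35 0; NConst 38 1; ROfNat 11 38]
  (For 21 9 (Seq (For 20 3 (block [:: NLoad 30 6 20] (Seq (Flip 31)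
     (block [:: ROfNat 10 31; RAdd 10 10 10; RSub 10 10 11; NAdd 36 35 30; RStore 5 36 10]
       Skip))))
   (Do (NAdd 35 35 1)))).

Definition UnitStarts : cmd :=
  For 20 3 (block [:: NLoad 30 6 20; NAdd 36 35 30; RStore 5 36 11; NAdd 35 35 1] Skip).

Definition Prepare : cmd :=
  Seq Copy (Seq ZeroCase (Seq SetParams (Seq RandomStarts UnitStarts))).

Definition Init : cmd := Seq Prepare
  (block [:: NConst 38 0; ROfNat 10 38; NAdd 2 0 38; RAdd 3 2 10; RAdd 4 2 10]
  (Seq (If (RLt 10 2) Recompute Skip)
  (block [:: NConst 38 0; ROfNat 10 38; RAdd 5 1 10] Skip))).

(** * Computing the parameters *)

Section ComputedParams.
Variable R : realType.
Implicit Types s : memory R.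

Lemma t_double z y s : [&& z != y, z != 20%N, y != 20%N, z != 40%N & y != 40%N] ->
  triple (Double z y) s [::] (nreg s y * 4 + 2)
    (fun s' => nreg s' z = (nreg s z * 2 ^ nreg s y)%N).
Proof.
move=> /and5P[zy z20 y20 z40 y40].
apply: (t_le (K := (nreg s y * (1 + 3) + 2)%N)); last lia.
apply: (t_forc (inv := fun j s' => nreg s' z = (nreg s z * 2 ^ j)%N)) => //=.
- by rewrite eq_sym y20 y40 !inE !xpair_eqE /= !(eq_sym _ z) z20 zy.
- by rewrite (negPf z20) muln1.
- move=> j sj jN _ aj ij; apply: t_blocks => /=.
  by rewrite (negPf z20) (negPf z40) eqxx ij expnS; lia.
Qed.

Lemma t_findlg n lg s : (1 < n)%N -> nreg s 1 = n ->
  (n <= 2 ^ lg)%N -> (forall j, (j < lg)%N -> (2 ^ j < n)%N) ->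
  triple FindLg s [::] (lg * 3 + 4) (fun s' => nreg s' 6 = lg).
Proof.
move=> n1 nE np nm; apply: (t_le (K := (3 + (lg * 3).+1)%N)); last lia.
apply: t_block => /=; set s1 := set_nreg _ 38 1.
apply: (t_conseq (K := (lg * 3).+1) (Q := fun s' => [/\ nreg s' 6 = lg, nreg s' 30 = (2 ^ lg)%N
   & nreg s' 38 = 1%N])) => //; last by move=> s' _ [].
apply: (t_while (inv := fun j s' => [/\ nreg s' 6 = j, nreg s' 30 = (2 ^ j)%N
   & nreg s' 38 = 1%N])) => //.
- move=> j sj [_ h _] aj /=; rewrite h (agn aj 1 isT) /= nE.
  apply/idP/idP => [lt|/nm //]; rewrite ltnNge; apply/negP => lj.
  by move: lt; apply/negP; rewrite -leqNgt (leq_trans np) // leq_exp2l.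
- move=> j sj jl [h1 h2 h3] aj; apply: t_blocks => /=.
  by rewrite h1 h2 h3 addn1 expnS mul2n addnn.
Qed.

Lemma t_finde (eps : R) E s : 0 < eps -> rreg s 0 = eps -> 1 <= E%:R * eps ->
  (forall j, (j < E)%N -> j%:R * eps < 1) ->
  triple FindE s [::] (E * 3 + 5) (fun s' => nreg s' 7 = E).
Proof.
move=> e0 rE Eg Em; apply: (t_le (K := (4 + (E * 3).+1)%N)); last lia.
apply: t_block => /=; set s1 := set_rreg _ 10 _.
apply: (t_conseq (K := (E * 3).+1) (Q := fun s' => [/\ nreg s' 7 = E, nreg s' 38 = 1%N,
   rreg s' 10 = E%:R * eps & rreg s' 11 = 1])) => //; last by move=> s' _ [].
apply: (t_while (inv := fun j s' => [/\ nreg s' 7 = j, nreg s' 38 = 1%N,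
   rreg s' 10 = j%:R * eps & rreg s' 11 = 1])) => //.
- by rewrite /= subrr mul0r.
- move=> j sj [_ _ h1 h2] aj; rewrite /= h1 h2.
  apply/idP/idP => [lt|/Em //]; rewrite ltnNge; apply/negP => lj.
  move: lt; apply/negP; rewrite -leNgt; apply: (le_trans Eg).
  by rewrite ler_pM2r // ler_nat.
- move=> j sj jl [h1 h2 h3 h4] aj; apply: t_blocks => /=.
  by rewrite h1 h2 h3 h4 (agr aj 0 isT) /= rE addn1 -natr1 mulrDl mul1r.
Qed.

Lemma t_params n (eps : R) lg Ei m s : params n eps lg Ei ->
  (forall j, (j < lg)%N -> (2 ^ j < n)%N) -> (forall j, (j < Ei)%N -> j%:R * eps < 1) ->
  nreg s 1 = n -> rreg s 0 = eps -> nreg s 3 = m ->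
  triple SetParams s [::] (1000 * (lg + iters lg Ei)) (fun s' =>
    [/\ nreg s' 8 = iters lg Ei, nreg s' 9 = nstarts lg, nreg s' 10 = (nstarts lg + m)%N
      & [/\ nreg s' 11 = quota lg Ei, nreg s' 12 = (quota lg Ei * lg)%N
      & nreg s' 14 = det_threshold lg]]).
Proof.
move=> par lgm Em n1 r0 n3; set k := iters lg Ei.
have l0 := lg_gt0 par; have E0 := Ei_gt0 par.
have kE : (k = 12 * (Ei * lg))%N by [].
have Ek : (Ei <= k)%N by rewrite kE; nia.
apply: (t_le (K := (lg * 3 + 4 + (Ei * 3 + 5 + (4 + ((6 * lg) * 4 + 2 + (lg * 4 + 3 + (5 +
  (lg * 4 + 3 + (15 * 4 + 2 + (4 + ((2 * k).+1 * 4 + 3 + (lg * 4 + 3 + (lg * 4 + 3 + 1)))))))))))))%N).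
apply: t_seq; apply: t_conseq (t_findlg (par_n par) n1 (n_le_lg par) lgm) (leqnn _) _ => s1 a1 n6 _.
apply: t_seq; apply: t_conseq (t_finde (eps_gt0 par) _ (par_E par) Em) (leqnn _) _.
  by rewrite (agr a1 0 isT).
move=> s2 a2 n7 _; have a12 := agree_trans a1 a2.
have n62 : nreg s2 6 = lg by rewrite (agn a2 6 isT).
have n32 : nreg s2 3 = m by rewrite (agn a12 3 isT).
apply: t_block => /=; set s3 := set_nreg _ 14 1.
have h3 : [/\ nreg s3 6 = lg, nreg s3 7 = Ei, nreg s3 3 = m, nreg s3 14 = 1%N & nreg s3 30 = (6 * lg)%N].
  by rewrite /= n62; split=> //; lia.
clearbody s3; case: h3 => n63 n73 n33 n14 n30.
apply: t_seq; apply: t_conseq (t_double (z := 14) (y := 30) _ isT) _ _; first by rewrite n30.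
move=> s4 a4; rewrite n14 n30 mul1n => n144 _.
apply: t_seq; apply: t_conseq (t_mul (z := 31) (x := 7) (y := 6) _ isT) _ _; first by rewrite (agn a4 6 isT) n63.
move=> s5 a5; rewrite (agn a4 6 isT) (agn a4 7 isT) n63 n73 => n315 _.
have a45 := agree_trans a4 a5.
have h5 : [/\ nreg s5 6 = lg, nreg s5 3 = m & nreg s5 14 = det_threshold lg].
  by rewrite (agn a45 6 isT) (agn a45 3 isT) (agn a5 14 isT).
case: h5 => n65 n35 n145.
apply: t_block => /=; set s6 := set_nreg _ 33 15.
have h6 : [/\ nreg s6 6 = lg, nreg s6 3 = m, nreg s6 14 = det_threshold lg
   & [/\ nreg s6 8 = k, nreg s6 33 = 15%N & nreg s6 31 = (Ei * lg)%N]].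
  by rewrite /= n315 kE; split=> //; split=> //; lia.
clearbody s6; case: h6 => n66 n36 n146 [n86 n336 n316].
apply: t_seq; apply: t_conseq (t_mul (z := 32) (x := 31) (y := 6) _ isT) _ _; first by rewrite n66.
move=> s7 a7; rewrite n66 n316 => n327 _.
apply: t_seq; apply: t_conseq (t_double (z := 32) (y := 33) _ isT) _ _; first by rewrite (agn a7 33 isT) n336.
move=> s8 a8; rewrite (agn a7 33 isT) n336 n327 => n328 _.
have a78 := agree_trans a7 a8.
have n32e : nreg s8 32 = inv_eta lg Ei.
  rewrite n328 /inv_eta (_ : (2 ^ 15 = 32 * (32 * 32))%N) //; move: (32)%N => c; nia.
have h8 : [/\ nreg s8 6 = lg, nreg s8 3 = m, nreg s8 14 = det_threshold lg & nreg s8 8 = k].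
  by rewrite (agn a78 6 isT) (agn a78 3 isT) (agn a78 14 isT) (agn a78 8 isT).
case: h8 => n68 n38 n148 n88.
apply: t_block => /=; set s9 := set_nreg _ 33 156.
have h9 : [/\ nreg s9 6 = lg, nreg s9 3 = m, nreg s9 14 = det_threshold lg
   & [/\ nreg s9 8 = k, nreg s9 33 = 156%N, nreg s9 34 = (2 * k).+1 & nreg s9 32 = inv_eta lg Ei]].
  by rewrite /= n88; split=> //; split=> //; lia.
clearbody s9; case: h9 => n69 n39 n149 [n89 n339 n349 n329].
apply: t_seq; apply: t_conseq (t_mul (z := 11) (x := 32) (y := 34) _ isT) _ _; first by rewrite n349.
move=> t1 b1; rewrite n329 n349 mulnC -/(quota lg Ei) => n11 _.
apply: t_seq; apply: t_conseq (t_mul (z := 12) (x := 11) (y := 6) _ isT) _ _.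
  by rewrite (agn b1 6 isT) n69.
move=> t2 b2; rewrite (agn b1 6 isT) n69 n11 => n12 _; have b12 := agree_trans b1 b2.
apply: t_seq; apply: t_conseq (t_mul (z := 9) (x := 33) (y := 6) _ isT) _ _.
  by rewrite (agn b12 6 isT) n69.
move=> t3 b3; rewrite (agn b12 6 isT) (agn b12 33 isT) n69 n339 -/(nstarts lg) => n9 _.
have b13 := agree_trans b12 b3.
apply: t_do => /=; rewrite (agn b13 8 isT) n89 n9 (agn b13 3 isT) n39 (agn b13 14 isT) n149.
have c23 := agree_trans b2 b3.
by rewrite (agn c23 11 isT) n11 (agn b3 12 isT) n12.
move: Ek; move: k kE => k kE; lia.
Qed.

End ComputedParams.

Section CountedLoop.
Variable R : realType.
Implicit Types s : memory R.

Lemma t_forwc x y c s K (ws : nat -> seq bool) (inv : nat -> memory R -> Prop) N :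
  [&& x != y, x != 40%N, y != 40%N, (0, x)%N \notin mods c & (0, y)%N \notin mods c] ->
  nreg s y = N ->
  inv 0%N (set_nreg s x 0) ->
  (forall j sj, (j < N)%N -> nreg sj x = j -> agree (mods (For x y c)) s sj ->
     inv j sj -> triple c sj (ws j) K
       (fun s' => inv j.+1 (set_nreg (set_nreg s' 40 1) x j.+1))) ->
  triple (For x y c) s (flatten [seq ws j | j <- iota 0 N]) (N * (K + 3) + 2) (inv N).
Proof.
move=> h1 h2 h3 h4; have := t_forw (K := fun=> K) h1 h2 h3 h4.
by rewrite sum_nat_const_nat subn0 => t; apply: t_conseq t (leqnn _) _ => s' _ [].
Qed.

End CountedLoop.

(** * Reading the initial matrix *)

Section Loading.
Variables (R : realType) (n : nat) (eps : R) (A0 : 'M[R]_n).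
Implicit Types s : memory R.

Definition diag_positions (l : nat) := [seq p <- take l (nz_positions A0) | p.1 == p.2].
Definition diag_support l := [seq val p.1 | p <- diag_positions l].

Let s0 := init_memory eps A0.

Lemma t_copy : triple Copy s0 [::] (nnz A0 * 15 + 2) (fun s' =>
  [/\ forall l, (l < nnz A0)%N -> [/\ narr s' 2 l = narr s0 0 l, narr s' 3 l = narr s0 1 l
        & rarr s' 2 l = rarr s0 0 l],
      nreg s' 3 = size (diag_support (nnz A0)),
      forall a, (a < size (diag_support (nnz A0)))%N ->
        narr s' 6 a = nth 0%N (diag_support (nnz A0)) a
    & rreg s' 2 = \sum_(p <- diag_positions (nnz A0)) A0 p.1 p.2]).
Proof.
rewrite (_ : (nnz A0 * 15 = nnz A0 * (12 + 3))%N) //.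
apply: (t_forc (inv := fun j s' =>
  [/\ forall l, (l < j)%N -> [/\ narr s' 2 l = narr s0 0 l, narr s' 3 l = narr s0 1 l
        & rarr s' 2 l = rarr s0 0 l],
      nreg s' 3 = size (diag_support j),
      forall a, (a < size (diag_support j))%N -> narr s' 6 a = nth 0%N (diag_support j) a
    & rreg s' 2 = \sum_(p <- diag_positions j) A0 p.1 p.2])) => //.
- exact: size_nz.
- by rewrite /diag_support /diag_positions take0 /= big_nil.
move=> j sj jN x20 aj [c2 n3 n6 r2].
case E : (nz_positions A0) => [|p0 ps]; first by rewrite -size_nz E in jN.
have [h0 h1 h2] := load_nth (set_rreg (set_nreg (mem0 R) 1 n) 0 eps) p0 jN.
rewrite -/s0 in h0 h1 h2; set p := nth p0 _ j in h0 h1 h2.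
have dS : diag_positions j.+1 = if p.1 == p.2 then rcons (diag_positions j) p else diag_positions j.
  rewrite /diag_positions (take_nth p0) ?size_nz // filter_rcons.
  by rewrite -/p; case: ifP.
have v0 : narr sj 0 j = val p.1 by rewrite (aga aj 0 isT).
have v1 : narr sj 1 j = val p.2 by rewrite (aga aj 1 isT).
have v2 : rarr sj 0 j = A0 p.1 p.2 by rewrite (agv aj 0 isT).
have copy (N2 N3 : nat -> nat) (R2 : nat -> R) :
    (forall l, N2 l = if l == j then val p.1 else narr sj 2 l) ->
    (forall l, N3 l = if l == j then val p.2 else narr sj 3 l) ->
    (forall l, R2 l = if l == j then A0 p.1 p.2 else rarr sj 2 l) ->
    forall l, (l < j.+1)%N -> [/\ N2 l = narr s0 0 l, N3 l = narr s0 1 l & R2 l = rarr s0 0 l].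
  move=> e2 e3 e4 l; rewrite ltnS leq_eqVlt e2 e3 e4.
  by have [-> _|_ /c2] := eqVneq l j.
rewrite (_ : (12 = 6 + 6)%N) //; apply: t_block.
set s1 := foldl _ _ _.
have w1 : [/\ nreg s1 30 = val p.1, nreg s1 31 = val p.2, rreg s1 10 = A0 p.1 p.2,
    nreg s1 3 = nreg sj 3 & rreg s1 2 = rreg sj 2].
  by rewrite /s1 /= x20 v0 v1 v2.
have w2 : [/\ forall l, narr s1 2 l = if l == j then val p.1 else narr sj 2 l,
   forall l, narr s1 3 l = if l == j then val p.2 else narr sj 3 l,
   forall l, rarr s1 2 l = if l == j then A0 p.1 p.2 else rarr sj 2 l
   & narr s1 6 = narr sj 6].
  by rewrite /s1 /= x20 v0 v1 v2.
clearbody s1; case: w1 => n30 n31 r10 n31' r2'; case: w2 => e2 e3 e4 e6.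
have skip s' : agree [::] s1 s' -> p.1 != p.2 -> forall t, agree [:: (0, 40); (0, 20)]%N s' t ->
  [/\ forall l, (l < j.+1)%N -> [/\ narr t 2 l = narr s0 0 l, narr t 3 l = narr s0 1 l
        & rarr t 2 l = rarr s0 0 l],
      nreg t 3 = size (diag_support j.+1),
      forall a, (a < size (diag_support j.+1))%N -> narr t 6 a = nth 0%N (diag_support j.+1) a
    & rreg t 2 = \sum_(p <- diag_positions j.+1) A0 p.1 p.2].
  move=> a1 pd t a2; have a := agree_trans a1 a2.
  rewrite /diag_support dS (negPf pd) -/(diag_support j).
  rewrite (agn a 3 isT) (aga a 6 isT) (agr a 2 isT) n31' r2' e6; split=> //.
  by apply: copy => l; rewrite ?(aga a 2 isT) ?(aga a 3 isT) ?(agv a 2 isT).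
have upd s' x : agree [:: (0, 40); (0, 20)]%N s' (set_nreg (set_nreg s' 40 1) 20 x).
  exact: (agree_block [:: NConst 40 1; NConst 20 x] s').
apply: t_if; rewrite /eval_test n30 n31 => lt1.
  apply: (t_le (K := 0)) => //; apply: t_skip; apply: (skip s1 (agree_refl _ _) _ _ (upd _ _)).
  by apply: contraTneq lt1 => ->; rewrite ltnn.
apply: (t_le (K := 5)) => //; apply: t_if; rewrite /eval_test n30 n31 => lt2.
  apply: (t_le (K := 0)) => //; apply: t_skip; apply: (skip s1 (agree_refl _ _) _ _ (upd _ _)).
  by apply: contraTneq lt2 => ->; rewrite ltnn.
have pe : p.1 == p.2 by rewrite -val_eqE eqn_leq leqNgt lt2 leqNgt lt1.
apply: t_blocks; rewrite /diag_support dS pe map_rcons -/(diag_support j) size_rcons.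
split.
- by apply: copy => l /=.
- by rewrite /= n31' n3 addn1.
- move=> a; rewrite nth_rcons /= n31' n3 ltnS leq_eqVlt n30 e6.
  have [-> _|ne /= lt] := eqVneq a (size (diag_support j)); first by rewrite ltnn.
  by rewrite lt n6.
- by rewrite /= r2' r2 r10 -cats1 big_cat big_seq1.
Qed.

End Loading.

(** * Storing the starting vectors *)

Section StartLoops.
Variables (R : realType) (n : nat) (lg : nat) (S : seq nat).
Hypotheses (Suniq : uniq S) (Sltn : forall i, i \in S -> (i < n)%N).
Implicit Types s : memory R.

Local Notation m := (size S).
Local Notation r := (nstarts lg).
Local Notation geom := (@geom R n S).

Definition sgn_of (b : seq bool) q : R := if nth false b q then 1 else -1.

(** Storage has stride n so that a coordinate is addressed directly, while coins are numbered with
    stride |S|, since none is tossed off the support. *)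
Definition coins_used (b : seq bool) q (f : nat -> R) := forall i j, (j < n)%N ->
  f (i * n + j)%N = if (j \in S) && (i * m + index j S < q)%N
                    then sgn_of b (i * m + index j S) else 0.

Lemma mul_add_inj d i j i' j' : (j < d)%N -> (j' < d)%N ->
  (i * d + j == i' * d + j')%N = (i == i') && (j == j').
Proof.
move=> jd jd'; apply/eqP/andP => [E|[/eqP -> /eqP ->]] //.
have d0 : (0 < d)%N by apply: leq_ltn_trans jd.
have := congr1 (modn^~ d) E; rewrite !modnMDl !modn_small // => ->.
by have := congr1 (divn^~ d) E; rewrite !divnMDl // !divn_small // !addn0 => ->.
Qed.

Lemma coins_used_step b i a f g : (a < m)%N -> coins_used b (i * m + a) f ->
  (forall q, g q = if q == (i * n + nth 0 S a)%N then sgn_of b (i * m + a) else f q) ->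
  coins_used b (i * m + a).+1 g.
Proof.
move=> am fc gE i' j jn; have nS : nth 0%N S a \in S by rewrite mem_nth.
rewrite gE (mul_add_inj _ _ jn (Sltn nS)) fc //.
have [jS|jS] := boolP (j \in S) => /=; last first.
  by rewrite ifN //; apply: contraNN jS => /andP[_ /eqP ->].
have jm : (index j S < m)%N by rewrite index_mem.
rewrite (ltnS (i' * m + index j S)) (leq_eqVlt (i' * m + index j S)) (mul_add_inj _ _ jm am).
have -> : (j == nth 0%N S a) = (index j S == a).
  by apply/eqP/eqP => [->|<-]; rewrite ?index_uniq ?nth_index.
by case: ifP => // /andP[/eqP -> /eqP ->].
Qed.

Lemma flatten_chunks (b : seq bool) q M N : flatten [seq [seq nth false b (q + (i * M + a)) | a <- iota 0 M]
  | i <- iota 0 N] = [seq nth false b (q + i) | i <- iota 0 (N * M)].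
Proof.
elim: N => [|N IHN] //; rewrite -[in LHS]addn1 iotaD map_cat flatten_cat IHN /= cats0 add0n.
rewrite mulSnr iotaD map_cat; congr (_ ++ _).
have -> : iota (0 + N * M) M = [seq (N * M + a)%N | a <- iota 0 M].
  by rewrite add0n -iotaDl addn0.
by rewrite -map_comp.
Qed.

Lemma t_random b s : size b = (r * m)%N -> geom s -> nreg s 9 = r ->
  (forall q, rarr s 5 q = 0) ->
  triple RandomStarts s b (r * (m * 11 + 6) + 5) (fun s' =>
    [/\ coins_used b (r * m) (rarr s' 5), nreg s' 35 = (r * n)%N & rreg s' 11 = 1]).
Proof.
move=> szb g n9 z5.
rewrite (_ : (r * (m * 11 + 6) + 5 = 3 + (r * ((m * (8 + 3) + 2 + 1) + 3) + 2))%N); last lia.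
apply: t_block => /=; set s1 := set_rreg _ 11 _.
have bE : b = flatten [seq flatten [seq [:: nth false b (i * m + a)] | a <- iota 0 m] | i <- iota 0 r].
  transitivity [seq nth false b (0 + i) | i <- iota 0 (r * m)].
    by rewrite -szb; symmetry; exact: mkseq_nth.
  rewrite -flatten_chunks; congr flatten; apply: eq_map => i.
  by elim: (iota 0 m) => //= x l ->.
have a1 : agree [:: (0, 35); (0, 38); (2, 11)]%N s s1.
  by split=> x; rewrite !inE !xpair_eqE /=; do ?case: (x == _) => //=.
have w1 : [/\ nreg s1 35 = 0%N, nreg s1 9 = r, rreg s1 11 = 1 & forall q, rarr s1 5 q = 0].
  by [].
have g1 : geom s1 := geom_agree a1 isT g.
clearbody s1; case: w1 => n35 n91 r11 z51.
rewrite {1}bE.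
apply: (t_forwc (inv := fun i s' =>
  [/\ coins_used b (i * m) (rarr s' 5), nreg s' 35 = (i * n)%N & rreg s' 11 = 1])) => //.
- by split=> // i j jn; rewrite z51 andbF.
- move=> i sj ir x21 aj [cu n35j r11j].
  have gj : geom sj := geom_agree aj isT g1.
  have [nn n3 n6] := gj.
  rewrite -[flatten _]cats0; apply: t_seqw.
  apply: t_conseq (t_forwc (N := m) (K := 8) (inv := fun a s' =>
    [/\ coins_used b (i * m + a) (rarr s' 5), nreg s' 35 = (i * n)%N & rreg s' 11 = 1])
    _ _ _ _) _ _ => //.
  + by rewrite addn0.
  + move=> a sa am x20 aa [cua n35a r11a].
    apply: (t_le (K := (1 + (1 + 5))%N)) => //.
    apply: (@t_block _ [:: NLoad 30 6 20]) => /=.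
    apply: (@t_seqw _ _ _ _ [:: nth false b (i * m + a)] [::]).
    apply: t_flip => _; apply: t_blocks => /=.
    rewrite x20 (aga aa 6 isT) n6 // r11a n35a; split=> //.
    rewrite addnS; apply: (coins_used_step am cua) => q /=; case: eqP => // _.
    by rewrite /sgn_of; case: nth; rewrite /= ?mulr1n ?mulr0n; lra.
  + move=> s' as' [h1 h2 h3] _; apply: t_do => /=.
    rewrite (agn as' 1 isT) nn h2 h3 mulSnr; split=> //.
    by rewrite addnC.
Qed.

Definition units_done (b : seq bool) a (f : nat -> R) := forall i j, (j < n)%N ->
  f (i * n + j)%N = if (i < r)%N then (if j \in S then sgn_of b (i * m + index j S) else 0)
                    else if (i - r < a)%N && (j == nth 0%N S (i - r)) then 1 else 0.

Lemma t_unit b s : geom s -> nreg s 35 = (r * n)%N -> rreg s 11 = 1 ->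
  coins_used b (r * m) (rarr s 5) ->
  triple UnitStarts s [::] (m * 7 + 2) (fun s' => units_done b m (rarr s' 5)).
Proof.
move=> [g1 g2 g3] n35 r11 cu.
apply: (t_conseq (K := (m * (4 + 3) + 2)%N) (Q := fun s' =>
  units_done b m (rarr s' 5) /\ nreg s' 35 = ((r + m) * n)%N)) => //; last by move=> s' _ [].
apply: (t_forc (inv := fun a s' => units_done b a (rarr s' 5) /\ nreg s' 35 = ((r + a) * n)%N)) => //.
  split; last by rewrite addn0.
  move=> i j jn; rewrite cu // ltn0 /=; case: (boolP (j \in S)) => /= jS; last by case: ifP.
  have jm : (index j S < m)%N by rewrite index_mem.
  have [ir|ri] := ltnP i r.
    by rewrite ifT //; apply: leq_trans (_ : i.+1 * m <= r * m)%N; rewrite ?leq_mul2r ?ir ?orbT // mulSnr ltn_add2l.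
  by rewrite ifN // -leqNgt; apply: leq_trans (leq_addr _ _); rewrite leq_mul2r ri orbT.
move=> a sa am x20 aa [ud n35a]; apply: t_blocks => /=.
rewrite x20 (aga aa 6 isT) g3 // n35a (agr aa 11 isT) r11 (agn aa 1 isT) g1; split; last first.
  by rewrite addnS mulSnr.
have nS : nth 0%N S a \in S by rewrite mem_nth.
move=> i j jn /=; rewrite (mul_add_inj _ _ jn (Sltn nS)) ud //.
have [->|ne] := eqVneq i (r + a)%N.
  rewrite ltnNge leq_addr /= addKn ltnn ltnSn /=; by case: eqP.
rewrite /=; case: ifP => // /negbT; rewrite -leqNgt => ri.
by rewrite (ltnS (i - r)%N) (leq_eqVlt (i - r)%N) (_ : (i - r == a)%N = false) //; apply/eqP; lia.
Qed.

Lemma units_done_starts b s : size b = (r * m)%N ->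
  units_done b m (rarr s 5) -> starts S s (start_vectors R n lg S b) (r + m).
Proof.
move=> szb ud i irm; split=> [j /negPf -> //|j]; rewrite ud //.
have [ir|ri] := ltnP i r.
  by rewrite (start_coord R Suniq j szb ir); case: ifP => jS; rewrite ?jS.
have im : (i - r < m)%N by lia.
have nir : (i < r)%N = false by rewrite ltnNge ri.
rewrite /start_vectors nir irm mxE im /=.
have [->|ne] := eqVneq (val j) (nth 0%N S (i - r)); first by rewrite mem_nth.
by case: ifP.
Qed.

End StartLoops.

(** * The support of all matrices and updates *)

Section Support.
Variables (R : realType) (n T : nat) (A0 : 'M[R]_n) (v : seq 'cV[R]_n).
Hypotheses (vT : size v = T) (psdA : forall t, (t <= T)%N -> psd (decr A0 v t)).
Hypothesis n0 : (0 < n)%N.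

(** Taking diagonal entries bounds the size by nnz(A_0), apart from the zero matrix, so loops over
    the support are paid for by the input. *)
Definition support : seq nat :=
  if 0 < \tr A0 then diag_support A0 (nnz A0) else [:: 0%N].

Let pA : psd A0.
Proof. by have := psdA (leq0n T); rewrite decr0. Qed.

Lemma diag_positionsE : diag_positions A0 (nnz A0) =
  [seq p <- nz_positions A0 | p.1 == p.2].
Proof. by rewrite /diag_positions take_oversize // size_nz. Qed.

Lemma mem_diag_support (i : 'I_n) :
  (val i \in diag_support A0 (nnz A0)) = (A0 i i != 0).
Proof.
rewrite /diag_support diag_positionsE; apply/mapP/idP => [[[i' j']]|Ai].
  rewrite !mem_filter /= => /andP[/eqP <- /andP[h _]] E.
  by rewrite (_ : i = i') //; exact: val_inj.
exists (i, i); rewrite // !mem_filter /= eqxx Ai /=.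
by rewrite -enumT mem_enum.
Qed.

Lemma mxtrace_diag : \sum_(p <- diag_positions A0 (nnz A0)) A0 p.1 p.2 = \tr A0.
Proof.
rewrite diag_positionsE /nz_positions -filter_predI big_filter big_enum_cond /=.
rewrite (eq_bigl (fun p => (p.1 == p.2) && (A0 p.1 p.2 != 0))) //.
transitivity (\sum_(p : 'I_n * 'I_n | p.1 == p.2) A0 p.1 p.2).
  rewrite big_mkcondr /=; apply: eq_bigr => p _; by case: eqP.
rewrite -(pair_big_dep xpredT (fun i j => i == j) (fun i j => A0 i j)) /=.
by apply: eq_bigr => i _; rewrite (eq_bigl (pred1 i)) ?big_pred1_eq // => j; rewrite eq_sym.
Qed.

Lemma support_uniq : uniq support.
Proof.
rewrite /support; case: ifP => // _; rewrite /diag_support diag_positionsE map_inj_in_uniq.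
  by do 2 apply: filter_uniq; exact: enum_uniq.
move=> [i j] [i' j']; rewrite !mem_filter /= => /andP[/eqP <- _] /andP[/eqP <- _].
by move/val_inj => ->.
Qed.

Lemma support_ltn i : i \in support -> (i < n)%N.
Proof.
rewrite /support; case: ifP => _; last by rewrite inE => /eqP ->.
by case/mapP => p _ ->; exact: ltn_ord.
Qed.

Lemma support_size : (size support <= (nnz A0).+1)%N.
Proof.
rewrite /support; case: ifP => // _.
by rewrite size_map diag_positionsE (leq_trans (size_subseq (filter_subseq _ _))) // size_nz.
Qed.

Lemma support_diag (i : 'I_n) : A0 i i != 0 -> val i \in support.
Proof.
move=> Ai; rewrite /support; case: ifP => [_|/negbT]; first by rewrite mem_diag_support.
rewrite -leNgt => tr0; exfalso.
have Aii (j : 'I_n) : 0 <= A0 j j by rewrite -qform_delta; exact: psd_ge0.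
move: tr0; rewrite /mxtrace (bigD1 i) //=; apply/negP; rewrite -ltNge ltr_wpDr //.
  by rewrite sumr_ge0.
by rewrite lt_def Ai Aii.
Qed.

Lemma support_entry (i j : 'I_n) : A0 i j != 0 -> val i \in support /\ val j \in support.
Proof.
case: (pA) => As _.
suff h (i' j' : 'I_n) : A0 i' j' != 0 -> val j' \in support.
  by move=> Aij; split; [apply: (h j); rewrite -As mxE|exact: (h i)].
move=> Aij; apply: contraNT Aij => jS.
have := decr_off vT psdA support_diag (leq0n T) jS; rewrite decr0 -colE => /colP/(_ i').
by rewrite !mxE => ->.
Qed.

(** Off the support both A_t and A_(t+1) kill e_i, hence so does v v^T, and the coordinate v_i
    vanishes. *)
Lemma support_update t (i : 'I_n) : (t < T)%N -> nth 0 v t i 0 != 0 -> val i \in support.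
Proof.
move=> tT vi; apply: contraNT vi => iS.
have h := decr_off vT psdA support_diag (ltnW tT) iS.
have h' := decr_off vT psdA support_diag tT iS.
move: h'; rewrite (decrS A0 vT tT) mulmxBl h sub0r => /eqP; rewrite oppr_eq0 => /eqP h'.
have := congr1 (fun X => dotv (delta_mx i 0) X) h'.
rewrite -qformE qform_outer /dotv mulmx0 [RHS]mxE -/(dotv _ _) => /eqP; rewrite sqrf_eq0 dotvE.
rewrite (bigD1 i) //= big1 => [|j ji]; rewrite mxE.
  by rewrite eqxx mulr1 addr0.
by rewrite (negPf ji) mulr0.
Qed.

End Support.

Lemma init_arith z m N r k lg M : (m <= z.+1)%N -> (N = z + 2)%N -> (lg <= r)%N ->
  (0 < lg)%N -> (0 < k)%N -> (M <= 2 * N)%N ->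
  (z * 15 + 2 + (6 + (1000 * (lg + k) + (r * (m * 11 + 6) + 5 + (m * 7 + 2)))) +
   (5 + ((r * (60 * (k + 1) * M) + 80 * M).+1 + 3)) <= 4000 * (N * (r * k)))%N.
Proof.
move=> mz NE lr l0 k0 MN; have r0 : (0 < r)%N by apply: leq_trans lr.
have N2 : (2 <= N)%N by rewrite NE leq_addl.
have x1 : (N <= N * (r * k))%N by rewrite leq_pmulr // muln_gt0 r0.
have x2 : (r * k <= N * (r * k))%N by rewrite leq_pmull // (ltn_trans _ N2).
have x3 : (r <= r * k)%N by rewrite leq_pmulr.
have x4 : (k <= r * k)%N by rewrite leq_pmull.
have x5 : (r * N <= N * (r * k))%N by rewrite mulnCA leq_mul2l leq_pmulr ?orbT.
have x6 : (r * (60 * (k + 1) * M) <= 240 * (N * (r * k)))%N.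
  apply: (@leq_trans (r * (60 * (2 * k) * (2 * N)))).
    by rewrite leq_mul2l; apply/orP; right; apply: leq_mul => //; lia.
  by lia.
have x7 : (r * (m * 11 + 6) <= 11 * (r * N) + 6 * r)%N.
  rewrite mulnDr; apply: leq_add; last by rewrite mulnC.
  by rewrite mulnA mulnC leq_mul2l /= leq_mul2l; apply/orP; right; lia.
move: (r * (60 * (k + 1) * M))%N x6 (r * (m * 11 + 6))%N x7 => X x6 Y x7.
move: (N * (r * k))%N (r * k)%N (r * N)%N x1 x2 x3 x4 x5 x6 x7 => Z W V x1 x2 x3 x4 x5 x6 x7.
lia.
Qed.

(** * The state after the initialization *)

Section Initialize.
Variables (R : realType) (n T : nat) (eps : R) (lg Ei : nat).
Variables (A0 : 'M[R]_n) (v : seq 'cV[R]_n) (b : seq bool).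
Hypothesis par : params n eps lg Ei.
Hypothesis lgm : forall j, (j < lg)%N -> (2 ^ j < n)%N.
Hypothesis Em : forall j, (j < Ei)%N -> j%:R * eps < 1.
Hypotheses (vT : size v = T) (psdA : forall t, (t <= T)%N -> psd (decr A0 v t)).
Implicit Types s : memory R.

Let n0 : (0 < n)%N. Proof. exact: ltnW (par_n par). Qed.

Local Notation S := (support A0).
Local Notation k := (iters lg Ei).
Local Notation r := (nstarts lg).
Local Notation m := (size S).
Local Notation U := (start_vectors R n lg S b).
Local Notation thr := (det_threshold lg).
Local Notation N := (insize A0 v 0).
Hypothesis szb : size b = (r * m)%N.

Let s0 := init_memory eps A0.
Let Suniq := support_uniq A0.
Let Sltn := support_ltn n0 (A0 := A0).
Let pA : psd A0.
Proof. by have := psdA (leq0n T); rewrite decr0. Qed.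

Lemma load_mx (F : nat -> nat -> R -> R) :
  \sum_(0 <= l < nnz A0) F (narr s0 0 l) (narr s0 1 l) (rarr s0 0 l) =
  \sum_(p <- nz_positions A0) F p.1 p.2 (A0 p.1 p.2).
Proof.
case E : (nz_positions A0) => [|p0 ps]; first by rewrite -size_nz E !big_nil.
rewrite [RHS](big_nth p0) -E size_nz; apply: eq_big_nat => l /andP[_ lt].
by have [-> -> ->] := load_nth (set_rreg (set_nreg (mem0 R) 1 n) 0 eps) p0 lt.
Qed.

Lemma entry_mx_load : @entry_mx R n (nnz A0) (narr s0 0) (narr s0 1) (rarr s0 0) = A0.
Proof.
apply/matrixP => i j; rewrite mxE.
rewrite (load_mx (fun a c x => if (a == i) && (c == j) then x else 0)).
rewrite /nz_positions big_filter big_enum_cond /=.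
transitivity (\sum_(p : 'I_n * 'I_n | p == (i, j)) A0 p.1 p.2); last by rewrite big_pred1_eq.
rewrite big_mkcond [RHS]big_mkcond /=; apply: eq_bigr => -[a c] _ /=.
rewrite xpair_eqE !val_eqE; case: (_ && _); last by case: ifP.
by case: eqP.
Qed.

Lemma nz_in_support l : (l < nnz A0)%N ->
  narr s0 0 l \in S /\ narr s0 1 l \in S.
Proof.
move=> lt; case E : (nz_positions A0) => [|p0 ps]; first by rewrite -size_nz E in lt.
have [-> -> _] := load_nth (set_rreg (set_nreg (mem0 R) 1 n) 0 eps) p0 lt.
apply: (support_entry vT psdA); have : nth p0 (nz_positions A0) l \in nz_positions A0.
  by rewrite mem_nth ?size_nz.
by rewrite mem_filter => /andP[].
Qed.

(* The state before the first call of Recompute. *)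
Record prepared s : Prop := Prepared {
  p_consts : consts eps lg Ei U S s;
  p_credit : nreg s 12 = (quota lg Ei * lg)%N;
  p_hi : nreg s 9 = r;
  p_n0 : nreg s 0 = nnz A0;
  p_entries : forall l, (l < nnz A0)%N ->
     [/\ narr s 2 l = narr s0 0 l, narr s 3 l = narr s0 1 l & rarr s 2 l = rarr s0 0 l];
  p_tr : rreg s 2 = \tr A0;
  p_zero : [/\ nreg s 4 = 0%N, nreg s 5 = 0%N, nreg s 13 = 0%N, narr s 5 0 = 0%N & rreg s 1 = 0];
  p_r3 : rreg s 3 = 0 /\ rreg s 4 = 0;
  p_vec : isvec S (rarr s 7) (0 : 'cV[R]_n) /\ isvec S (rarr s 8) (0 : 'cV[R]_n);
  p_w : forall i, rarr s 1 i = if ~~ (0 < \tr A0) && (i == 0%N) then 1 else 0 }.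

Lemma t_zerocase s :
  rreg s 15 = 0 -> rreg s 2 = \tr A0 -> nreg s 1 = n ->
  nreg s 3 = size (diag_support A0 (nnz A0)) ->
  (forall a, (a < size (diag_support A0 (nnz A0)))%N ->
     narr s 6 a = nth 0%N (diag_support A0 (nnz A0)) a) ->
  (forall i, rarr s 1 i = 0) ->
  triple ZeroCase s [::] 6 (fun s' => geom n S s' /\
    forall i, rarr s' 1 i = if ~~ (0 < \tr A0) && (i == 0%N) then 1 else 0).
Proof.
move=> r15 r2 n1 n3 n6 z1; apply: t_if; rewrite /eval_test r15 r2 => tr0.
  apply: (t_le (K := 0)) => //; apply: t_skip; rewrite tr0 /=; split=> //.
  by rewrite /support tr0; split.
apply: t_blocks; rewrite tr0 /= /support (negPf tr0); split.
  by split=> // -[].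
by move=> i; case: i => //=.
Qed.

Lemma t_prepare : triple Prepare s0 b
  (nnz A0 * 15 + 2 + (6 + (1000 * (lg + k) + (r * (m * 11 + 6) + 5 + (m * 7 + 2)))))%N prepared.
Proof.
pose Q s' := [/\ consts eps lg Ei U S s', nreg s' 12 = (quota lg Ei * lg)%N, nreg s' 9 = r
  & [/\ forall l, (l < nnz A0)%N ->
     [/\ narr s' 2 l = narr s0 0 l, narr s' 3 l = narr s0 1 l & rarr s' 2 l = rarr s0 0 l],
     rreg s' 2 = \tr A0
   & forall i, rarr s' 1 i = if ~~ (0 < \tr A0) && (i == 0%N) then 1 else 0]].
apply: (t_conseq (Q := Q)) (leqnn _) _; last first.
  move=> s' a [h1 h2 h3 [h4 h5 h6]]; split=> //.
  - by rewrite (agn a 0 isT); exact: size_nz.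
  - by rewrite (agn a 4 isT) (agn a 5 isT) (agn a 13 isT) (aga a 5 isT) (agr a 1 isT).
  - by rewrite (agr a 3 isT) (agr a 4 isT).
  - by rewrite (agv a 7 isT) (agv a 8 isT); split; exact: isvec0.
apply: (@t_seqw _ _ _ _ [::] b); apply: t_conseq (t_copy eps A0) (leqnn _) _.
move=> s1 a1 [e1 n3 n6 r2] _; rewrite mxtrace_diag in r2.
have z1 i : rarr s1 1 i = 0 by rewrite (agv a1 1 isT).
have r15 : rreg s1 15 = 0 by rewrite (agr a1 15 isT).
have n1 : nreg s1 1 = n by rewrite (agn a1 1 isT).
apply: (@t_seqw _ _ _ _ [::] b); apply: t_conseq (t_zerocase r15 r2 n1 n3 n6 z1) (leqnn _) _.
move=> s2 a2 [g2 w2] _; have a12 := agree_trans a1 a2.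
have r0 : rreg s2 0 = eps by rewrite (agr a12 0 isT).
apply: (@t_seqw _ _ _ _ [::] b).
have [n12 n32 _] := g2.
apply: t_conseq (t_params par lgm Em n12 r0 n32) (leqnn _) _.
move=> s3 a3 [n8 n9 n10 [n11 n12' n14]] _; have a13 := agree_trans a12 a3.
have g3 : geom n S s3 := geom_agree a3 isT g2.
have z5 q : rarr s3 5 q = 0 by rewrite (agv a13 5 isT).
rewrite -[b]cats0; apply: t_seqw.
apply: t_conseq (t_random Suniq Sltn szb g3 n9 z5) (leqnn _) _.
move=> s4 a4 [cu n35 r11] _; have g4 : geom n S s4 := geom_agree a4 isT g3.
apply: t_conseq (t_unit Suniq Sltn g4 n35 r11 cu) (leqnn _) _.
move=> s5 a5 ud; have a35 := agree_trans a4 a5; have a25 := agree_trans a3 a35.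
have a15 := agree_trans a2 a25.
split.
- split.
  + exact: (geom_agree a25 isT g2).
  + by rewrite (agn a35 8 isT).
  + by rewrite (agn a35 10 isT).
  + by rewrite (agn a35 11 isT).
  + by rewrite (agn a35 14 isT).
  + by rewrite (agr a25 0 isT).
  + by apply: units_done_starts.
- by rewrite (agn a35 12 isT).
- by rewrite (agn a35 9 isT).
split.
- by move=> l /e1; rewrite (aga a15 2 isT) (aga a15 3 isT) (agv a15 2 isT).
- by rewrite (agr a15 2 isT).
- by move=> i; rewrite (agv a25 1 isT).
Qed.

Lemma t_init : triple Init s0 b (4000 * (N * (r * k)))%N
  (fun s' => inv T eps lg Ei A0 v U S 0 s' 0 /\ nreg s' 13 = 0%N).
Proof.
have NE : N = (nnz A0 + 2)%N by rewrite /insize take0 big_nil addn0.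
have lr : (lg <= r)%N by rewrite /nstarts leq_pmull.
apply: t_le (init_arith (support_size A0) NE lr (lg_gt0 par) (iters_gt0 par) (leqnn _)).
rewrite -{1}[b]cats0; apply: t_seqw; apply: t_conseq t_prepare (leqnn _) _.
move=> s1 a1 [cs1 n12 n9 n0' ent tr1 [n4 n5 n13 N5 q0] [r3 r4] [v7 v8] w1] _.
apply: t_block; set s2 := foldl _ _ _.
have a2 : agree [:: (0, 38); (2, 10); (0, 2); (2, 3); (2, 4)]%N s1 s2.
  exact: (agree_block [:: NConst 38 0; ROfNat 10 38; NAdd 2 0 38; RAdd 3 2 10; RAdd 4 2 10] s1).
have [n22 r32 r42 r10] : [/\ nreg s2 2 = nnz A0, rreg s2 3 = \tr A0, rreg s2 4 = \tr A0
    & rreg s2 10 = 0] by rewrite /s2 /= n0' addn0 addr0 tr1.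
clearbody s2; have A0E : decr A0 v 0 = A0 by exact: decr0.
have mx2 : @mem_mx R n s2 = A0.
  rewrite /mem_mx (agn a2 4 isT) n4 big_geq // subr0 n22 -[RHS]entry_mx_load.
  rewrite (aga a2 2 isT) (aga a2 3 isT) (agv a2 2 isT).
  apply/matrixP => i j; rewrite !mxE; apply: eq_big_nat => l /andP[_ lt].
  by have [-> -> ->] := ent l lt.
have cs2 : consts eps lg Ei U S s2 by exact: (consts_agree a2 isT cs1).
have rp2 : repr S s2.
  split.
  - move=> l; rewrite n22 (aga a2 2 isT) (aga a2 3 isT) => lt.
    by have [-> -> _] := ent l lt; exact: nz_in_support.
  - by move=> l; rewrite (agn a2 5 isT) n5.
  - by rewrite (aga a2 5 isT).
  - by move=> l; rewrite (agn a2 4 isT) n4.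
  - by rewrite (aga a2 5 isT) (agn a2 4 isT) (agn a2 5 isT) n4 n5 N5.
have co2 : core eps lg Ei A0 v U S 0 s2.
  split; rewrite ?mx2 ?A0E //.
  - by rewrite (agr a2 2 isT) tr1 /trc A0E.
  - by rewrite (agn a2 13 isT) n13 expr0 divr1 r42 /trc A0E.
  - by rewrite r42 /trc A0E.
  - by left; rewrite (agn a2 13 isT).
have msize2 : (msize S s2 <= 2 * N)%N.
  have := support_size A0; rewrite /msize n22 (agn a2 4 isT) (agn a2 5 isT) n4 n5 NE; lia.
have vec2 : vectors n S s2.
  by split; [exists 0; rewrite (agv a2 7 isT)|exists 0; rewrite (agv a2 8 isT)].
pose good := good_starts T eps lg Ei A0 v U.
have c0 : 0 < \tr A0 -> checkpoint T eps lg A0 v 0.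
  move=> tr0; split; rewrite /trc ?A0E //.
  by rewrite ler_peMl ?(ltW tr0) // exprn_ege1 // ler1n.
apply: t_seq; apply: (t_conseq (K := (r * (60 * (k + 1) * (2 * N)) + 80 * (2 * N)).+1) (Q := fun s' => vectors n S s' /\ exists w,
   [/\ isvec S (rarr s' 1) w, rreg s' 1 = qform A0 w, 0 < \tr A0 -> good -> power_best A0 k U r w
     & ~~ (0 < \tr A0) -> dotv w w = 1])) _ _ _ => //.
- apply: t_if; rewrite /eval_test r10 (agr a2 2 isT) tr1 => tr0.
    have n92 : nreg s2 9 = r by rewrite (agn a2 9 isT).
    have w2 : exists W : 'cV[R]_n, isvec S (rarr s2 1) W.
      exists 0; split=> [i _|i]; rewrite (agv a2 1 isT) w1 tr0 ?mxE //.
    have st2 : starts S s2 U (nreg s2 9).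
      by rewrite n92 => i ir; apply: (c_starts cs2); apply: leq_trans ir (leq_addr _ _).
    have p2 : psd (@mem_mx R n s2) by rewrite mx2.
    have := t_recompute Suniq Sltn (c_geom cs2) rp2 vec2 w2 st2 p2.
    rewrite (c_iters cs2) n92 mx2 => t; apply: t_conseq t _ _.
      rewrite /rc_cost n92 (c_iters cs2); have := msize2; set M := msize S s2 => M2.
      by apply: leq_add; rewrite !leq_mul2l M2 !orbT.
    move=> s3 a3 [v3 [w [vw qw pb]]]; split=> //; exists w; split=> //; last by rewrite tr0.
    move=> _ g; apply: pb; have := good_pos par psdA g (c0 tr0).
    by rewrite A0E.
  apply: (t_le (K := 0)) => //; apply: t_skip; split=> //.
  exists (delta_mx (Ordinal n0) 0); split.
  + split=> [i|i]; rewrite (agv a2 1 isT) w1 tr0 /=.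
      by rewrite /support (negPf tr0) inE => /negPf ->.
    by rewrite mxE andbT -val_eqE /=; case: eqP.
  + rewrite (agr a2 1 isT) q0 qform_delta.
    have := mem_diag_support A0 (Ordinal n0).
    have [->//|ne] := eqVneq (A0 (Ordinal n0) (Ordinal n0)) 0.
    move=> _; exfalso; move: tr0; apply/negP; rewrite negbK.
    apply: lt_le_trans (_ : A0 (Ordinal n0) (Ordinal n0) <= _).
      by rewrite lt_def ne -qform_delta; exact: psd_ge0.
    rewrite /mxtrace (bigD1 (Ordinal n0)) //= lerDl sumr_ge0 // => j _.
    by rewrite -qform_delta; exact: psd_ge0.
  + by move=> h; rewrite h in tr0.
  + by rewrite dotv_delta.
move=> s3 a3 [v3 [w [vw qw pb z]]] _; apply: t_blocks => /=; set s4 := set_rreg _ 5 _.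
have a4 : agree [:: (0, 38); (2, 10); (2, 5)]%N s3 s4.
  by split=> x; rewrite !inE !xpair_eqE /=; do ?case: (x == _) => //=.
have r5 : rreg s4 5 = qform A0 w by rewrite /= addr0.
have a34 := agree_trans a3 a4; have a24 := agree_trans a2 a34.
have n134 : nreg s4 13 = 0%N by rewrite (agn a24 13 isT).
have w4 : isvec S (rarr s4 1) w by [].
have q4 : rreg s4 1 = qform A0 w by [].
have v4 : vectors n S s4 by [].
split; last exact: n134.
clearbody s4; have t0 : (0 < thr)%N by rewrite expn_gt0.
split=> //.
- exact: (core_agree a34).
- exists w; split; [by []|by rewrite A0E|move=> g].
  have [tr0|tr0] := boolP (0 < \tr A0); last first.
    have nt : ~ 0 < trc A0 v 0 by rewrite /trc A0E; exact/negP.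
    exact: (@semantics_zero _ _ _ _ _ _ _ _ U par psdA 0 s4 w 0 (leq0n T) nt (z tr0) g).
  have tk : tracking T eps lg Ei A0 v U 0 w (rreg s4 5) 0.
    have -> : rreg s4 5 = qform (decr A0 v 0) w by rewrite A0E.
    apply: (tracking0 par psdA) => //; first exact: c0.
    by rewrite A0E; exact: pb.
  have [w1' acc] := tracking_correct par vT psdA (start_vectors_norm R n lg Suniq b) g (leq0n T) tk.
  by split.
- by rewrite (agn a24 12 isT) n12 n134 !addn0.
- by move=> _ _; rewrite (agn a24 9 isT) n9 (agr a34 3 isT) r32 /trc A0E.
- by move=> _; rewrite n134 leqn0 => /eqP h; rewrite h in t0.
- move=> _; rewrite (agn a34 2 isT) n22 (agn a24 4 isT) (agn a24 5 isT) n4 n5 /insize.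
  by rewrite take0 big_nil !addn0 leq_addr.
Qed.

End Initialize.

(** * The whole run *)

Lemma params_exist (R : realType) n (eps : R) : (0 < n)%N -> 0 < eps < 1 -> n%:R^-1 < eps ->
  exists lg Ei, [/\ params n eps lg Ei, forall j, (j < lg)%N -> (2 ^ j < n)%N
    & forall j, (j < Ei)%N -> j%:R * eps < 1].
Proof.
move=> n0 /andP[e0 e1] ne.
have nR : 0 < n%:R :> R by rewrite ltr0n.
have n1 : (1 < n)%N.
  rewrite ltnNge; apply/negP => h; have nE : n = 1%N by apply/eqP; rewrite eqn_leq h n0.
  by move: ne; rewrite nE invr1; apply/negP; rewrite -leNgt ltW.
have exl : exists l, (n <= 2 ^ l)%N by exists n; exact/ltnW/ltn_expl.
pose lg := ex_minn exl.
have [lP lmin] : (n <= 2 ^ lg)%N /\ forall j, (j < lg)%N -> (2 ^ j < n)%N.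
  rewrite /lg; case: ex_minnP => l h1 h2; split=> // j jl; rewrite ltnNge.
  by apply/negP => /h2; rewrite leqNgt jl.
have exE : exists E : nat, 1 <= E%:R * eps.
  exists (Num.truncn (eps^-1)).+1; rewrite -ler_pdivrMr // div1r ltW //.
  by rewrite truncnS_gt.
pose Ei := ex_minn exE.
have [EP Emin] : 1 <= Ei%:R * eps /\ forall j, (j < Ei)%N -> j%:R * eps < 1.
  rewrite /Ei; case: ex_minnP => l h1 h2; split=> // j jl; rewrite ltNge.
  by apply/negP => /h2; rewrite leqNgt jl.
have l0 : (0 < lg)%N by case: (lg) lP => // h; rewrite leqNgt n1 in h.
have E0 : (0 < Ei)%N by case: (Ei) EP => //; rewrite mul0r ler10.
exists lg, Ei; split=> //; split=> //.
- by rewrite e0 e1.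
- by rewrite mulrC -ltr_pdivrMr // div1r.
- by have := lmin lg.-1; rewrite prednK // leqnn => /(_ isT); case: (lg) l0 => // l _ /=; rewrite expnS; lia.
- by apply: Emin; rewrite prednK.
Qed.

Lemma insize_le (R : realType) n T (A0 : 'M[R]_n) v : size v = T -> (0 < nnz A0)%N ->
  (insize A0 v T <= 4 * (nnz A0 + \sum_(u <- v) maxn 1 (nnz u)))%N.
Proof.
move=> vT a0; rewrite /insize take_oversize ?vT //.
have h : (\sum_(u <- v) (nnz u).+1 <= 2 * \sum_(u <- v) maxn 1 (nnz u))%N.
  by rewrite big_distrr /=; apply: leq_sum => u _; lia.
move: (\sum_(u <- v) _)%N (\sum_(u <- v) _)%N h => X Y; lia.
Qed.

(** The starts contribute lg, the iterations lg Ei twice (once through the quota), and [inv_eta]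
    lg^2 Ei; 36 comes from 2k + 1 <= 3k. *)
Lemma rate_le (R : realType) n (eps : R) lg Ei J : params n eps lg Ei ->
  (nstarts lg * iters lg Ei * (quota lg Ei * (lg + J)))%N%:R <=
  156 * 12 * 36 * 32 ^+ 3 * (lg%:R ^+ 5 * Ei%:R ^+ 3 * (lg%:R + J%:R)) :> R.
Proof.
move=> par; have k0 := iters_gt0 par.
apply: (@le_trans _ _ (nstarts lg * iters lg Ei * ((3 * iters lg Ei) * inv_eta lg Ei * (lg + J)))%N%:R).
  rewrite ler_nat leq_mul2l; apply/orP; right; rewrite leq_mul2r; apply/orP; right.
  by rewrite leq_mul2r; apply/orP; right; lia.
rewrite /nstarts /iters /inv_eta !natrM natrD le_eqVlt; apply/orP; left; apply/eqP; ring.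
Qed.

Section Runs.
Variables (R : realType) (n T : nat) (eps : R) (lg Ei : nat).
Variables (A0 : 'M[R]_n) (v : seq 'cV[R]_n).
Hypothesis par : params n eps lg Ei.
Hypothesis lgm : forall j, (j < lg)%N -> (2 ^ j < n)%N.
Hypothesis Em : forall j, (j < Ei)%N -> j%:R * eps < 1.
Hypotheses (vT : size v = T) (psdA : forall t, (t <= T)%N -> psd (decr A0 v t)).
Implicit Types s : memory R.

Let n0 : (0 < n)%N. Proof. exact: ltnW (par_n par). Qed.

Local Notation S := (support A0).
Local Notation k := (iters lg Ei).
Local Notation r := (nstarts lg).
Local Notation m := (size S).
Local Notation U b := (start_vectors R n lg S b).
Local Notation thr := (det_threshold lg).
Local Notation insize := (insize A0 v).
Local Notation trc := (trc A0 v).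
Local Notation phi := (phi lg Ei A0 v).
Local Notation inv b := (inv T eps lg Ei A0 v (U b) S).
Local Notation P := (Program Init Update).

Lemma inv_correct b t s Rc : (t <= T)%N -> inv b t s Rc ->
  good_starts T eps lg Ei A0 v (U b) -> correct_at eps (decr A0 v t) s.
Proof.
move=> tT iv g; have [w [[_ wE] qE sem]] := i_sem iv; have [w1 acc _] := sem g.
have oE : out_vector n s = w by apply/colP => i; rewrite mxE wE.
split; rewrite ?oE /out_value ?qE //; last exact/l2norm1.
exact: max_qform_ub (psdA tT) w1.
Qed.

Lemma updates_run b d t s Rc : (t + d = T)%N -> inv b t s Rc ->
  exists tr c s' Rc', [/\ exec_updates Update s (drop t v) [::] tr c,
    forall j, (j <= d)%N -> exists Rcj, inv b (t + j) (nth (mem0 R) (s :: tr) j) Rcj,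
    inv b T s' Rc' & (c + phi t (nreg s 13) Rc <= phi T (nreg s' 13) Rc')%N].
Proof.
elim: d t s Rc => [|d IHd] t s Rc tdT iv.
  rewrite addn0 in tdT; exists [::], 0%N, s, Rc; split.
  - by rewrite drop_oversize ?vT ?tdT //; constructor.
  - by case=> // _; exists Rc; rewrite addn0.
  - by move: iv; rewrite tdT.
  - by rewrite tdT.
have tT : (t < T)%N by rewrite -tdT addnS ltnS leq_addr.
have hv t' (i : 'I_n) : (t' < T)%N -> nth 0 v t' i 0 != 0 -> val i \in S.
  by move=> h1 h2; refine (support_update vT psdA h1 h2).
have hl t' : (t' <= T)%N -> 0 < trc t' -> exists2 j, (j < r + m)%N &
    \tr (decr A0 v t' ^+ (2 * k)) <= 2 * n%:R * moment (decr A0 v t') (U b j) (2 * k).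
  apply: (unit_start_lower par vT psdA (support_uniq A0) (support_ltn n0 (A0 := A0))).
  exact: support_diag psdA.
have [s1 [c1 [ex1 [Rc1 iv1 c1K]]]] := y_update par vT psdA (support_uniq A0)
  (support_ltn n0 (A0 := A0)) hv (support_size A0)
  (start_vectors_norm R n lg (support_uniq A0) b) hl tT iv.
have [tr [c2 [s2 [Rc2 [ex2 h iv2 c2K]]]]] := IHd t.+1 s1 Rc1 (etrans (addSnnS _ _) tdT) iv1.
exists (s1 :: tr), (c1 + c2)%N, s2, Rc2; split.
- rewrite (drop_nth 0) ?vT //; exact: (@ExecUpdatesCons _ _ _ _ _ _ _ [::] [::] _ _ _ ex1 ex2).
- case=> [|j] jd; first by exists Rc; rewrite addn0.
  by have [Rcj] := h j jd; exists Rcj; rewrite addnS -addSn.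
- exact: iv2.
- by move: (phi t _ _) (phi t.+1 _ _) c1K c2K; lia.
Qed.

(** Only the finitely many positive traces matter, so a step bound for all coins exists even when
    A_T = 0. *)
Lemma trace_halvings : exists J, forall t, (t <= T)%N -> 0 < trc t -> trc 0 <= 2 ^+ J * trc t.
Proof.
suff h N : (N <= T)%N -> exists J, forall t, (t <= N)%N -> 0 < trc t -> trc 0 <= 2 ^+ J * trc t.
  exact: h (leqnn T).
elim: N => [|N IHN] NT.
  by exists 0%N => t; rewrite leqn0 => /eqP -> _; rewrite expr0 mul1r.
have [J hJ] := IHN (ltnW NT); have [j hj] : exists j : nat, trc 0 / trc N.+1 < j%:R.
  by exists (Num.truncn (trc 0 / trc N.+1)).+1; rewrite truncnS_gt.
exists (maxn J j) => t; rewrite leq_eqVlt ltnS => /orP[/eqP -> t0|tN t0]; last first.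
  apply: le_trans (hJ t tN t0) _; rewrite ler_pM2r // ler_weXn2l ?ler1n // leq_maxl.
  done.
rewrite -ler_pdivrMr //; apply: le_trans (ltW hj) _.
apply: (@le_trans _ _ (2 ^+ j)); first by rewrite -natrX ler_nat ltnW // ltn_expl.
by rewrite ler_weXn2l ?ler1n // leq_maxr.
Qed.

Definition tape J : nat := (4000 * (insize 0 * (r * k)) + phi T J (quota lg Ei * (lg + J)))%N.

Lemma phi_mono t J J' Rc Rc' : (J <= J')%N -> (Rc <= Rc')%N -> (phi t J Rc <= phi t J' Rc')%N.
Proof.
move=> JJ RR; rewrite /phi; apply: leq_add.
  rewrite leq_mul2l; apply/orP; right; rewrite leq_mul2l; apply/orP; right.
  by apply: leq_add; [rewrite leq_add2l|rewrite leq_mul2l RR orbT].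
by case: ifP => // h; rewrite (leq_trans h JJ).
Qed.

Lemma run_exists J b : (forall t, (t <= T)%N -> 0 < trc t -> trc 0 <= 2 ^+ J * trc t) ->
  size b = (r * m)%N -> exists tr c,
  [/\ run P eps A0 v b tr c, (c <= tape J)%N
    & good_starts T eps lg Ei A0 v (U b) -> correct_trace eps A0 v tr].
Proof.
move=> hJ szb; have [s0 [c0 [ex0 c0K [iv0 J0]]]] := t_init par lgm Em vT psdA szb.
have [tr [c [s' [Rc' [ex h iv' cK]]]]] := updates_run (add0n T) iv0.
rewrite drop0 in ex; exists (s0 :: tr), (c0 + c)%N; split.
- by rewrite -[X in run _ _ _ _ X]cats0; exact: (@Run R n P eps A0 v s0 b [::] tr c0 c ex0 ex).
- rewrite /tape; apply: leq_add c0K _; apply: leq_trans (leq_addr _ _) (leq_trans cK _).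
  have [co _ _ cr _ _ _] := iv'.
  (* If halvings were counted, [i_J] provides a time whose positive trace is less than twice r_4, so
     J - 1 or fewer halvings cannot have overshot. *)
  have JJ : (nreg s' 13 <= J)%N.
    case: (i_J co) => [->//|[t [tT t0]]]; rewrite (i_h co) => lt.
    have := le_lt_trans (hJ t tT t0) (_ : _ < 2 ^+ J * (2 * (trc 0 / 2 ^+ nreg s' 13))).
    rewrite ltr_pM2l ?exprn_gt0 // => /(_ lt).
    have tr0 : 0 < trc 0 by apply: lt_le_trans t0 _; exact: (trc_mono A0 vT).
    rewrite mulrA -exprSr mulrCA -[X in X < _]mulr1 ltr_pM2l //.
    rewrite ltr_pdivlMr ?exprn_gt0 // mul1r -!natrX ltr_nat ltn_exp2l //.
  apply: phi_mono => //; apply: (@leq_trans (quota lg Ei * (lg + nreg s' 13))).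
    by rewrite -cr leq_addl.
  by rewrite leq_mul2l leq_add2l JJ orbT.
- move=> g t; rewrite vT => tT; have [Rc iv] := h t tT.
  exact: inv_correct tT iv g.
Qed.

Lemma tape_ge J : (r * m <= tape J)%N.
Proof.
apply: leq_trans (leq_addr _ _); have k0 := iters_gt0 par.
have mN : (m <= insize 0)%N.
  by apply: leq_trans (support_size A0) _; rewrite /insize; lia.
apply: leq_trans (leq_pmull _ _) => //; rewrite mulnCA leq_mul2l (leq_trans mN) ?orbT //.
by rewrite leq_pmulr.
Qed.

Lemma tape_le J : (tape J <=
  (4400 + 3 * (det_const + 1000)) * (insize T * (r * k * (quota lg Ei * (lg + J)))))%N.
Proof.
have k0 := iters_gt0 par; have l0 := lg_gt0 par.
have r0 : (0 < r)%N by rewrite /nstarts muln_gt0.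
have q0 : (0 < quota lg Ei)%N by rewrite /quota muln_gt0 (inv_eta_gt0 par).
have NN : (insize 0 <= insize T)%N by rewrite /insize take0 big_nil addn0; lia.
have Q1 : (lg + J <= quota lg Ei * (lg + J))%N by rewrite leq_pmull.
(* The factor n in the cost of densification is absorbed by J, which is at least 2^(6 lg). *)
have thrJ : (thr <= J)%N -> (n <= J)%N.
  apply: leq_trans; apply: leq_trans (n_le_lg par) _; rewrite /det_threshold leq_exp2l //; lia.
have Y1 : (r * k <= r * k * (quota lg Ei * (lg + J)))%N.
  by rewrite leq_pmulr // muln_gt0 q0 addn_gt0 l0.
have Y2 : (quota lg Ei * (lg + J) <= r * k * (quota lg Ei * (lg + J)))%N.
  by rewrite leq_pmull // muln_gt0 r0.
rewrite /tape /phi; move: (det_const + 1000)%N => Dc.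
move: (quota lg Ei * (lg + J))%N Q1 Y1 Y2 => Q Q1 Y1 Y2.
move: (r * k * Q)%N Y1 Y2 => Y Y1 Y2; move: (r * k)%N Y1 => rk Y1.
have h1 : (insize 0 * rk <= insize T * Y)%N by exact: leq_mul.
have h2 : (insize T * (1 + J + Y) <= 3 * (insize T * Y))%N.
  by rewrite mulnCA leq_mul2l; apply/orP; right; lia.
have h3 : ((if (thr <= J)%N then 400 * n * insize T else 0) <= 400 * (insize T * Y))%N.
  case: ifP => // /thrJ nJ; rewrite -mulnA leq_mul2l /= mulnC leq_mul2l; apply/orP; right; lia.
move: (if _ then _ else _) h3 => X h3.
have h4 := leq_mul (leqnn Dc) h2.
move: (insize T * Y)%N (insize 0 * rk)%N (insize T * _)%N h1 h3 h4 => Z W V h1 h3 h4.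
rewrite mulnDl -mulnA (mulnCA 3).
move: (Dc * V)%N (Dc * (3 * Z))%N h4 => V1 V2 h4; lia.
Qed.

Lemma pr_outcome J : (forall t, (t <= T)%N -> 0 < trc t -> trc 0 <= 2 ^+ J * trc t) ->
  1 - n%:R^-1 <= prob_coins R (outcome P eps A0 v (k := tape J) (correct_trace eps A0 v)).
Proof.
move=> hJ; have good := pr_good par vT psdA (support_uniq A0) (support_ltn n0 (A0 := A0))
  (support_diag psdA).
apply: le_trans good _.
rewrite /pr -(mean_take (r * m) (tape J - r * m)) subnKC ?tape_ge //.
apply: (@prob_coinsE _ _ _ (fun w => good_starts T eps lg Ei A0 v (U (take (r * m) w)))) => w g.
have szb : size (take (r * m) w) = (r * m)%N by rewrite size_takel ?size_tuple ?tape_ge.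
have [tr [c [rn cK cor]]] := run_exists hJ szb.
by exists (take (r * m) w), tr, c; split=> //; [exact: prefix_take|exact: cor].
Qed.

Lemma outcome_true J (w : (tape J).-tuple bool) :
  (forall t, (t <= T)%N -> 0 < trc t -> trc 0 <= 2 ^+ J * trc t) ->
  outcome P eps A0 v (fun=> True) w.
Proof.
move=> hJ; have szb : size (take (r * m) w) = (r * m)%N by rewrite size_takel ?size_tuple ?tape_ge.
have [tr [c [rn cK _]]] := run_exists hJ szb.
by exists (take (r * m) w), tr, c; split=> //; exact: prefix_take.
Qed.

End Runs.

(** * Comparison with the claimed running time *)

Lemma nonneg_bound (R : realType) (L D : R) : 1 / 2 <= L -> 1 <= D -> 0 <= 1 + 2 * (L + D).
Proof. lra. Qed.

Lemma succ_bound (R : realType) (x L y D : R) : y <= D -> x <= 2 * (L + y) ->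
  x + 1 <= 1 + 2 * (L + D).
Proof. lra. Qed.

Lemma ln2_ge (R : realType) : 1 / 2 <= ln 2 :> R.
Proof. by rewrite -ler_expR lnK ?posrE //; exact: expR_half_le2. Qed.

(** L is ln n, M is ln (n / eps), D the logarithm of the eigenvalue ratio floored at 1, l and E are
    lg and Ei. The algorithm needs only L^6 D / eps^3; the surplus M^6 / L^3 is at least 1/8 because
    M >= L >= 1/2. *)
Lemma growth (R : realType) (L M D e l E J : R) : 1 / 2 <= L -> L <= M -> 1 <= D ->
  0 < e < 1 -> 0 <= l -> l <= 4 * L -> 0 <= E -> E * e <= 2 -> 0 <= J ->
  J <= 1 + 2 * (L + D) ->
  l ^+ 5 * E ^+ 3 * (l + J) <= 4 ^+ 5 * 2 ^+ 3 * 12 * 8 * (L ^+ 3 * M ^+ 6 * D / e ^+ 4).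
Proof.
move=> L2 LM D1 /andP[e0 e1] l0 l4 E0 Ee J0 J1.
have L0 : 0 <= L by lra.
have M0 : 0 <= M by lra.
have D0 : 0 <= D by lra.
have E2 : E <= 2 / e by rewrite ler_pdivlMr.
have lJ : l + J <= 12 * (L * D) by nra.
have i0 : 0 <= e^-1 by rewrite invr_ge0 ltW.
have i1 : 1 <= e^-1 by rewrite invf_ge1 // ltW.
apply: (@le_trans _ _ ((4 * L) ^+ 5 * (2 / e) ^+ 3 * (12 * (L * D)))).
  apply: ler_pM => //; rewrite ?addr_ge0 ?mulr_ge0 ?exprn_ge0 //.
  by apply: ler_pM; rewrite ?exprn_ge0 // lerXn2r ?nnegrE ?mulr_ge0.
have -> : (4 * L) ^+ 5 * (2 / e) ^+ 3 * (12 * (L * D)) =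
    4 ^+ 5 * 2 ^+ 3 * 12 * (L ^+ 3 * L ^+ 3 * D * e^-1 ^+ 3) by ring.
have -> : 4 ^+ 5 * 2 ^+ 3 * 12 * 8 * (L ^+ 3 * M ^+ 6 * D / e ^+ 4) =
    4 ^+ 5 * 2 ^+ 3 * 12 * (L ^+ 3 * (8 * M ^+ 6) * D * (e^-1 ^+ 3 * e^-1)).
  by rewrite -exprVn; ring.
have c0 : 0 <= 4 ^+ 5 * 2 ^+ 3 * 12 :> R by rewrite !mulr_ge0 ?exprn_ge0.
apply: ler_wpM2l => //.
have L3 : L ^+ 3 <= M ^+ 3 by rewrite lerXn2r ?nnegrE.
have M3 : 1 <= 8 * M ^+ 3.
  have : (1 / 2) ^+ 3 <= M ^+ 3 by rewrite lerXn2r ?nnegrE //; lra.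
  lra.
have M6 : L ^+ 3 <= 8 * M ^+ 6.
  apply: (le_trans L3); rewrite (_ : 8 * M ^+ 6 = M ^+ 3 * (8 * M ^+ 3)); last by ring.
  by rewrite ler_peMr ?exprn_ge0.
apply: ler_pM; rewrite ?mulr_ge0 ?exprn_ge0 //.
  by apply: ler_wpM2r => //; apply: ler_wpM2l; rewrite ?exprn_ge0.
by rewrite ler_peMr ?exprn_ge0.
Qed.

(** 2^lg <= 2n <= n^2, and ln 2 >= 1/2. *)
Lemma lg_le_ln (R : realType) n (eps : R) lg Ei : params n eps lg Ei ->
  lg%:R <= 4 * ln n%:R :> R.
Proof.
move=> par; have n1 := par_n par; have nR : 0 < n%:R :> R by rewrite ltr0n ltnW.
have : ln (2 ^+ lg) <= ln (n%:R ^+ 2) :> R.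
  rewrite ler_ln ?posrE ?exprn_gt0 // -!natrX ler_nat.
  by apply: leq_trans (par_lg2 par) _; rewrite expnS expn1 leq_mul2r n1 orbT.
rewrite !lnXn // => h; have h2 := ln2_ge R; have l0 : 0 <= lg%:R :> R by [].
move: h; rewrite -[ln 2 *+ _]mulr_natl -[ln n%:R *+ 2]mulr_natl; have := ler_wpM2l l0 h2; lra.
Qed.

Lemma halvings_le (R : realType) n (a b : R) J : (1 < n)%N -> 0 < a -> 0 < b ->
  2 ^+ J * b < n%:R * a -> J%:R <= 2 * (ln n%:R + ln (a / b)).
Proof.
move=> n1 a0 b0 h; have nR : 0 < n%:R :> R by rewrite ltr0n ltnW.
have : ln (2 ^+ J) <= ln (n%:R * (a / b)).
  rewrite ler_ln; [|by rewrite posrE exprn_gt0|by rewrite posrE mulr_gt0 ?divr_gt0].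
  by rewrite mulrA ler_pdivlMr // ltW.
rewrite lnXn // lnM ?posrE ?divr_gt0 // -[ln 2 *+ _]mulr_natl; have := ln2_ge R.
have J0 : 0 <= J%:R :> R by [].
move=> h2; have := ler_wpM2l J0 h2; lra.
Qed.

Theorem mainTheorem1 (R : realType) :
  exists (P : program) (C : R),
    forall (n T : nat) (eps : R) (A0 : 'M[R]_n) (v : T.-tuple 'cV[R]_n),
      (0 < n)%N -> 0 < eps < 1 -> n%:R^-1 < eps ->
      (forall t, (t <= T)%N -> psd (decr A0 v t)) ->
      exists k : nat,
        [/\ forall w : k.-tuple bool, outcome P eps A0 v (fun=> True) w,
            0 < lambda_max (decr A0 v T) ->
              k%:R <= C * time_bound eps A0 v (decr A0 v T)
          & 1 - n%:R^-1 <=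
              prob_coins R (outcome P eps A0 v (k := k) (correct_trace eps A0 v))].
Proof.
pose c1 : R := (4400 + 3 * (det_const + 1000))%N%:R.
pose c2 : R := 156 * 12 * 36 * 32 ^+ 3.
pose c3 : R := 4 ^+ 5 * 2 ^+ 3 * 12 * 8.
exists (Program Init Update), (c1 * 4 * (c2 * c3)) => n T eps A0 v n0 eps01 neps psdA.
have [lg [Ei [par lgm Em]]] := params_exist n0 eps01 neps.
have vT : size v = T by exact: size_tuple.
pose exJb := 
  fun J : nat => `[< forall t, (t <= T)%N -> 0 < trc A0 v t -> trc A0 v 0 <= 2 ^+ J * trc A0 v t >].
have exb : exists J, exJb J by have [J hJ] := trace_halvings T A0 v; exists J; exact/asboolP.
(* J is least, so J - 1 fails at some time. As the trace lies between the largest eigenvalue and n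
   times it, this bounds J by ln n plus the logarithm of the eigenvalue ratio, up to constants. *)
pose J := ex_minn exb.
have [JP Jmin] : exJb J /\ forall j, (j < J)%N -> ~~ exJb j.
  rewrite /J; case: ex_minnP => j h1 h2; split=> // i ij; apply/negP => /h2.
  by rewrite leqNgt ij.
have {}JP := asboolW JP.
exists (tape T lg Ei A0 v J); split.
- by move=> w; exact: (outcome_true par lgm Em vT psdA).
- move=> lT; have pT := psdA T (leqnn T).
  have p0 : psd A0 by have := psdA 0%N (leq0n T); rewrite decr0.
  have trT : 0 < trc A0 v T by apply: lt_le_trans (lambda_max_le pT).
  have l0 : lambda_max A0 * n%:R >= trc A0 v 0 by rewrite mulrC /trc decr0; exact: lambda_max_ge.
  have nR : 0 < n%:R :> R by rewrite ltr0n.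
  have tr0 : 0 < trc A0 v 0 by apply: lt_le_trans trT _; exact: (trc_mono A0 vT).
  have l00 : 0 < lambda_max A0 by rewrite -(pmulr_lgt0 _ nR); apply: lt_le_trans l0.
  (* A nonzero entry lets nnz(A_0) absorb the additive constant in [insize]. *)
  have nz0 : (0 < nnz A0)%N.
    rewrite lt0n; apply: contraTneq tr0 => z; rewrite -leNgt /trc decr0 /mxtrace big1 // => i _.
    by have := card0_eq z (i, i); rewrite !inE /= => /negbFE /eqP.
  set L : R := ln n%:R; set D : R := Num.max 1 (ln (lambda_max A0 / lambda_max (decr A0 v T))).
  have D1 : 1 <= D by rewrite le_max lexx.
  have e0 := eps_gt0 par; have e1 := eps_lt1 par.
  have LM : L <= ln (n%:R / eps).
    by rewrite ler_ln ?posrE ?divr_gt0 // ler_pdivlMr // ler_piMr ?(ltW nR) // ltW.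
  have L2 : 1 / 2 <= L.
    by apply: (le_trans (ln2_ge R)); rewrite ler_ln ?posrE // ler_nat (par_n par).
  have EE : Ei%:R * eps <= 2.
    have := par_E2 par; rewrite -[in X in _ -> X](prednK (Ei_gt0 par)) -natr1 mulrDl mul1r; lra.
  have JJ : J%:R <= 1 + 2 * (L + D).
    case E : J => [|j]; first by apply: nonneg_bound.
    have /asboolPn nj : ~~ exJb j by apply: Jmin; rewrite E.
    have hj : 2 ^+ j * lambda_max (decr A0 v T) < n%:R * lambda_max A0.
      rewrite ltNge; apply/negP => h; apply: nj => // t tT t0.
      rewrite mulrC in l0; apply: (le_trans l0); apply: (le_trans h).
      rewrite ler_wpM2l ?exprn_ge0 //; apply: (le_trans (lambda_max_le pT)).
      exact: (trc_mono A0 vT).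
    have h1 := halvings_le (par_n par) l00 lT hj; rewrite -/L in h1.
    rewrite -natr1; have h2 : ln (lambda_max A0 / lambda_max (decr A0 v T)) <= D by rewrite le_max lexx orbT.
    exact: succ_bound h2 h1.
  have N4 := insize_le vT nz0.
  set X := (nnz A0 + _)%N in N4.
  apply: (@le_trans _ _ (c1 * ((4 * X%:R) * (c2 * (c3 * (L ^+ 3 * ln (n%:R / eps) ^+ 6 * D / eps ^+ 4)))))).
    apply: (@le_trans _ _ (c1 * (insize A0 v T *
        (nstarts lg * iters lg Ei * (quota lg Ei * (lg + J))))%N%:R)).
      by rewrite /c1 -natrM ler_nat; exact: tape_le par vT J.
    apply: ler_wpM2l; first exact: ler0n.
    rewrite natrM; apply: ler_pM => //; first by rewrite -natrM ler_nat.
    apply: le_trans (rate_le J par) _; apply: ler_wpM2l.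
      by rewrite !mulr_ge0 ?exprn_ge0.
    exact: growth (lg_le_ln par) _ EE _ JJ.
  by rewrite /time_bound -/L -/D -/X le_eqVlt; apply/orP; left; apply/eqP; ring.
- exact: (pr_outcome par lgm Em vT psdA).
Qed.
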